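(* Consider the directed Chung--Lu model with adjacency matrix $A_n$. If the rank-one weight profile assumption (W) and the growth assumption (X) (stated in the context) hold, then, as $n\to\infty$, $$\sqrt{\frac{n}{s_n}}\,\big(\lambda_1(A_n)-\mathbb{E}[\lambda_1(A_n)]\big)\longrightarrow G\quad\text{in distribution},$$ where $G$ is a centered Gaussian random variable with variance $$\sigma^2=\frac{\left(\int_{\mathbb{R}_+^2}(x^+)^2x^-\,d\rho(x^+,x^-)\right)\left(\int_{\mathbb{R}_+^2}x^+(x^-)^2\,d\rho(x^+,x^-)\right)}{\left(\int_{\mathbb{R}_+^2}x^+x^-\,d\rho(x^+,x^-)\right)^2}.$$
   Context: Model. For every $n$ let $(w_x^+,w_x^-)_{x\in[n]}$ be deterministic non-negative weights (depending on $n$) with $\sum_{x=1}^n w_x^+=\sum_{x=1}^n w_x^-=:\mathbf{w}_n$. The matrix $A_n=(a_{xy})_{x,y\in[n]}$ has independent Bernoulli entries with $p_{xy}:=\mathbb{P}(a_{xy}=1)=s_n w_x^+w_y^-/\mathbf{w}_n$, where $s_n>0$; under the assumptions below $p_{xy}<1$ for large $n$. (W) There exist constants $0<c<C<\infty$ with $c\le w_x^\pm\le C$ for all $x\in[n]$, $n\ge1$; moreover there is a compactly supported probability measure $\rho$ on $(0,\infty)^2$ such that $\frac1n\sum_{x=1}^n\delta_{\sqrt{n/\mathbf{w}_n}\,(w_x^+,w_x^-)}$ converges weakly to $\rho$. (X) There exists $\xi>4$ such that $\log^\xi(n)\ll s_n\ll n$, where $a_n\ll b_n$ means $a_n/b_n\to0$.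 $\lambda_1(M)$ denotes the eigenvalue of largest modulus of $M$. *)

(* Defs.v *)
From HB Require Import structures.
From mathcomp Require Import all_boot all_order all_algebra.
From mathcomp Require Import complex.
From mathcomp Require Import all_classical all_reals all_analysis.

Set Implicit Arguments.
Unset Strict Implicit.
Unset Printing Implicit Defensive.

Import Order.TTheory GRing.Theory Num.Theory.
Import numFieldNormedType.Exports.

Local Open Scope classical_set_scope.
Local Open Scope ring_scope.
Local Open Scope complex_scope.

(* Test functions for weak convergence of probability measures on the plane. *)
Definition bounded_continuous (R : realType) (f : R * R -> R) : Prop :=
  continuous f /\ exists M : R, forall z, `|f z| <= M.

(* Convergence in distribution for complex random variables, C being identified
   with the plane R * R; each Z n may live on its own probability space. *)
Definition cvg_in_distribution (R : realType)
    (d : nat -> measure_display) (Omega : forall n, measurableType (d n))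
    (P : forall n, probability (Omega n) R) (Z : forall n, Omega n -> R[i])
    (d' : measure_display) (Omega' : measurableType d')
    (Q : probability Omega' R) (G : Omega' -> R[i]) : Prop :=
  forall f : R * R -> R, bounded_continuous f ->
    (fun n => \int[P n]_w f (complex.Re (Z n w), complex.Im (Z n w))) @ \oo
      --> \int[Q]_w f (complex.Re (G w), complex.Im (G w)).

Definition complex_expectation (R : realType) (d : measure_display)
    (Omega : measurableType d) (P : probability Omega R)
    (Z : Omega -> R[i]) : R[i] :=
  fine 'E_P[fun w => complex.Re (Z w)] +i* fine 'E_P[fun w => complex.Im (Z w)].

Definition mutually_independent (R : realType) (d d' : measure_display)
    (Omega : measurableType d) (T : measurableType d')
    (P : probability Omega R) (I : finType)
    (X : I -> {RV P >-> T}) : Prop :=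
  forall (J : {set I}) (B : I -> set T), (forall i, measurable (B i)) ->
    P [set w | forall i, i \in J -> B i (X i w)]
    = (\prod_(i in J) P [set w | B i (X i w)])%E.

(* z is an eigenvalue of M of largest modulus.  Among several such eigenvalues one
   with largest real part is taken, so that for a matrix with non-negative entries
   z is the Perron-Frobenius eigenvalue.  For other matrices z need not be unique:
   a conjugate pair is not separated. *)
Definition is_lambda1 (R : realType) (n : nat) (M : 'M[R[i]]_n) (z : R[i]) :
    Prop :=
  eigenvalue M z /\
  forall w : R[i], eigenvalue M w ->
    `|w| <= `|z| /\ (`|w| = `|z| -> complex.Re w <= complex.Re z).

(* Picks one such z; the default value 0 is only taken for the empty matrix. *)
Definition lambda1 (R : realType) (n : nat) (M : 'M[R[i]]_n) : R[i] :=
  xget 0 [set z | is_lambda1 M z].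

Definition adjacency (R : realType) (n : nat) (d : measure_display)
    (Omega : measurableType d) (P : probability Omega R)
    (a : 'I_n -> 'I_n -> {RV P >-> bool}) (w : Omega) : 'M[R[i]]_n :=
  \matrix_(x < n, y < n) (a x y w)%:R.

Definition total_weight (R : realType) (n : nat) (w : 'I_n -> R) : R :=
  \sum_(x < n) w x.

Definition directed_Chung_Lu (R : realType) (n : nat) (d : measure_display)
    (Omega : measurableType d) (P : probability Omega R)
    (wp wm : 'I_n -> R) (s : R) (a : 'I_n -> 'I_n -> {RV P >-> bool}) : Prop :=
  (forall x y : 'I_n,
     P [set w | a x y w = true] = (s * wp x * wm y / total_weight wp)%:E) /\
  mutually_independent (fun xy : 'I_n * 'I_n => a xy.1 xy.2).

(* The last clause is the weak convergence to rho of the rescaled empirical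
   measure of the weights: the integral of f against an average of n Dirac
   masses is the average of the n values of f. *)
Definition assumption_W (R : realType) (wp wm : forall n, 'I_n -> R)
    (rho : probability (R * R)%type R) : Prop :=
  [/\ exists c C : R, [/\ 0 < c, c < C &
        forall n (x : 'I_n), c <= wp n x <= C /\ c <= wm n x <= C],
      exists K : set (R * R), [/\ compact K,
        K `<=` [set z | 0 < z.1 /\ 0 < z.2] & rho K = 1%E] &
      forall f : R * R -> R, bounded_continuous f ->
        (fun n => n%:R^-1 * \sum_(x < n)
           f (Num.sqrt (n%:R / total_weight (wp n)) * wp n x,
              Num.sqrt (n%:R / total_weight (wp n)) * wm n x)) @ \oo
          --> \int[rho]_z f z].

Definition assumption_X (R : realType) (s : nat -> R) : Prop :=
  exists xi : R, [/\ 4 < xi,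
    (fun n => (ln n%:R) `^ xi / s n) @ \oo --> (0 : R) &
    (fun n => s n / n%:R) @ \oo --> (0 : R)].

Definition sigma2 (R : realType) (rho : probability (R * R)%type R) : R :=
  ((\int[rho]_z (z.1 ^+ 2 * z.2)) * (\int[rho]_z (z.1 * z.2 ^+ 2)))
  / (\int[rho]_z (z.1 * z.2)) ^+ 2.

(* Main.v *)
(** Write A = alpha w+ (w-)^T + H with H = A - E[A], and S0 = <w+, w->.  First-order
   perturbation of the rank-one part suggests that lambda1(A) - E[lambda1(A)] is
   close to the linear statistic L = (w-)^T H w+ / S0, and this is made rigorous by
   the Efron-Stein inequality applied to lambda1(A) - L: flipping the entry (x,y)
   moves lambda1 by exactly V_x U_y / <V,U>, where V is the left Perron eigenvector
   before the flip and U the right one after it, and both eigenvectors are close to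
   w- and w+ as soon as ||H|| <= eps s_n.  Hence the variance of the remainder is
   o(s_n / n).

   The bound ||H|| <= eps s_n holds outside an event of probability O(n^-8), by a
   recursion on the moments Ex tr X^(2m) of the symmetric dilation X of H: writing
   one factor X as the sum of its independent centered entries, each of them turns
   into a discrete derivative of the remaining power, and tr (S X1^q S X0^(2m-q)) is
   bounded by convexity in q.

   Finally sqrt(n / s_n) L is asymptotically Gaussian by Stein's method, and its
   variance converges to sigma2 rho because (W) gives convergence of the moments of
   the rescaled weights. *)

(* Efron-Stein bounds a variance, so the mean of lambda1 is never estimated: L is centered, and the
   unknown E[lambda1] simply drops out. What must be estimated are n^2 discrete derivatives whose
   squares, summed over all entries, have to be o(1), because the weight p(1 - p) contributes only
   the factor s_n / n. A worst-case bound per entry is too weak for this. The error of each flip is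
   therefore bounded relative to V_x U_y, and the squares of these products sum to |V|^2 |U|^2,
   which is comparable to S0^2.

   The norm bound is used with a fixed eps, which is chosen from the target precision before n
   grows. On the exceptional event only |lambda1| <= n is available; the resulting loss of order n^4
   is beaten by the probability n^-8.

   Two discrepancies with the real, all-n picture remain: the p_xy are probabilities only for large
   n, and lambda1 is a complex number. On the good event it is the Perron root, hence real, and off
   it the imaginary part is at most n. The limit law thus sits on the real axis of the plane. *)
Require Import Defs.
From HB Require Import structures.
From mathcomp Require Import all_boot all_order all_algebra.
From mathcomp Require Import complex zify ring lra.
From mathcomp Require Import all_classical all_reals all_analysis measurable_realfun.

Set Implicit Arguments.
Unset Strict Implicit.
Unset Printing Implicit Defensive.

Import Order.TTheory GRing.Theory Num.Theory.
Import numFieldNormedType.Exports.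

Local Open Scope classical_set_scope.
Local Open Scope ring_scope.
Local Open Scope complex_scope.

(** * Finite product Bernoulli spaces *)

Section BernoulliSpace.
Variables (R : realType) (E : finType) (p : E -> R).
Implicit Types (M : {ffun E -> bool}) (F G : {ffun E -> bool} -> R) (e : E).

Definition bern_weight M : R := \prod_e (if M e then p e else 1 - p e).

Definition Ex F : R := \sum_M bern_weight M * F M.

Definition upd M e (b : bool) : {ffun E -> bool} :=
  [ffun i => if i == e then b else M i].

Definition disc_deriv e F M : R := F (upd M e true) - F (upd M e false).

(** The conditional expectation of [F] given all coordinates other than [e]. *)
Definition resample e F M : R :=
  p e * F (upd M e true) + (1 - p e) * F (upd M e false).

Lemma updE M e b i : upd M e b i = if i == e then b else M i.
Proof. by rewrite ffunE. Qed.

Lemma upd_id M e : upd M e (M e) = M.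
Proof. by apply/ffunP => i; rewrite updE; case: eqP => // ->. Qed.

Lemma upd_upd M e b b' : upd (upd M e b) e b' = upd M e b'.
Proof. by apply/ffunP => i; rewrite !updE; case: eqP. Qed.

Lemma updC M e e' b b' : e != e' ->
  upd (upd M e b) e' b' = upd (upd M e' b') e b.
Proof.
move=> nee'; apply/ffunP => i; rewrite !updE.
by case: (eqVneq i e') => [->|//]; rewrite eq_sym (negbTE nee').
Qed.

Lemma sum_pair_upd e (Phi : {ffun E -> bool} -> R) :
  \sum_M Phi M = \sum_(M : {ffun E -> bool} | M e) (Phi M + Phi (upd M e false)).
Proof.
rewrite (bigID (fun M : {ffun E -> bool} => M e)) /= big_split /=; congr (_ + _).
rewrite (reindex_onto (fun M : {ffun E -> bool} => upd M e false) (fun M => upd M e true)) /=.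
  apply: eq_bigl => M; rewrite updE eqxx /= upd_upd.
  apply/eqP/idP => [<-|Me]; first by rewrite updE eqxx.
  by rewrite -[RHS](upd_id M e) Me.
move=> M /negbTE Me; rewrite upd_upd.
by rewrite -[RHS](upd_id M e) Me.
Qed.

(** The same [w] serves both values of [b]; as no division by [p e] occurs, the degenerate cases
    [p e = 0] and [p e = 1] are covered. *)
Lemma bern_weight_upd e M : exists w : R, forall b : bool,
  bern_weight (upd M e b) = (if b then p e else 1 - p e) * w.
Proof.
exists (\prod_(i | i != e) (if M i then p i else 1 - p i)) => b.
rewrite /bern_weight (bigD1 e) //= updE eqxx; congr (_ * _).
by apply: eq_bigr => i /negbTE ie; rewrite updE ie.
Qed.

(** Tower property. It reduces statements about expectations to pointwise ones about the two values
    at coordinate [e], and is used in this way throughout. *)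
Lemma Ex_resample e F : Ex F = Ex (resample e F).
Proof.
rewrite /Ex (sum_pair_upd e) [RHS](sum_pair_upd e).
apply: eq_bigr => M Me; have [w hw] := bern_weight_upd e M.
have EM : upd M e true = M by rewrite -{1}Me upd_id.
have := hw true; rewrite EM => ->.
by rewrite hw /resample !upd_upd EM; ring.
Qed.

Lemma eq_Ex F G : F =1 G -> Ex F = Ex G.
Proof. by move=> FG; apply: eq_bigr => M _; rewrite FG. Qed.

Lemma ExD F G : Ex (fun M => F M + G M) = Ex F + Ex G.
Proof. by rewrite -big_split /=; apply: eq_bigr => M _; rewrite mulrDr. Qed.

Lemma ExZ c F : Ex (fun M => c * F M) = c * Ex F.
Proof. by rewrite mulr_sumr; apply: eq_bigr => M _; rewrite mulrCA. Qed.

Lemma ExN F : Ex (fun M => - F M) = - Ex F.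
Proof.
by rewrite -[RHS]mulN1r -ExZ; apply: eq_Ex => M; rewrite mulN1r.
Qed.

Lemma ExB F G : Ex (fun M => F M - G M) = Ex F - Ex G.
Proof. by rewrite ExD ExN. Qed.

Lemma Ex_sum (I : Type) (r : seq I) (P : pred I) (F : I -> {ffun E -> bool} -> R) :
  Ex (fun M => \sum_(i <- r | P i) F i M) = \sum_(i <- r | P i) Ex (F i).
Proof. by rewrite /Ex exchange_big; apply: eq_bigr => M _; rewrite mulr_sumr. Qed.

Lemma Ex_prod (f : E -> bool -> R) :
  Ex (fun M => \prod_e f e (M e))
  = \prod_e (p e * f e true + (1 - p e) * f e false).
Proof.
rewrite /Ex; transitivity (\sum_(M : {ffun E -> bool}) \prod_e
   ((if M e then p e else 1 - p e) * f e (M e))).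
  by apply: eq_bigr => M _; rewrite -big_split.
rewrite -(bigA_distr_bigA (fun e b => (if b then p e else 1 - p e) * f e b)).
by apply: eq_bigr => e _; rewrite big_bool.
Qed.

Lemma Ex_cst c : Ex (fun=> c) = c.
Proof.
have E1 : Ex (fun=> 1) = 1.
  have := Ex_prod (fun _ _ => 1).
  rewrite [RHS]big1 => [H|e _]; last by rewrite !mulr1 addrC subrK.
  by rewrite -[RHS]H; apply: eq_Ex => M; rewrite big1.
by rewrite -[RHS]mulr1 -E1 -ExZ; apply: eq_Ex => M; rewrite mulr1.
Qed.

(** Discrete integration by parts. It drives both the trace recursion and Stein's method. *)
Lemma Ex_centered_mul e F :
  Ex (fun M => ((M e)%:R - p e) * F M)
  = p e * (1 - p e) * Ex (disc_deriv e F).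
Proof.
rewrite (Ex_resample e) -ExZ; apply: eq_Ex => M.
by rewrite /resample /disc_deriv !updE eqxx /=; ring.
Qed.

Hypothesis p01 : forall e, 0 <= p e <= 1.

Lemma bern_weight_ge0 M : 0 <= bern_weight M.
Proof.
apply: prodr_ge0 => e _; case/andP: (p01 e) => p0 p1.
by case: ifP => _ //; rewrite subr_ge0.
Qed.

Lemma ler_Ex F G : (forall M, F M <= G M) -> Ex F <= Ex G.
Proof.
by move=> FG; apply: ler_sum => M _; rewrite ler_wpM2l ?bern_weight_ge0.
Qed.

Lemma Ex_ge0 F : (forall M, 0 <= F M) -> 0 <= Ex F.
Proof. by move=> F0; rewrite -(Ex_cst 0) ler_Ex. Qed.

Lemma ler_norm_Ex F : `|Ex F| <= Ex (fun M => `|F M|).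
Proof.
apply: le_trans (ler_norm_sum _ _ _) _; apply: ler_sum => M _.
by rewrite normrM (ger0_norm (bern_weight_ge0 M)).
Qed.

Lemma sqr_Ex_le F : (Ex F) ^+ 2 <= Ex (fun M => F M ^+ 2).
Proof.
have : 0 <= Ex (fun M => (F M - Ex F) ^+ 2) by apply: Ex_ge0 => M; exact: sqr_ge0.
suff -> : Ex (fun M => (F M - Ex F) ^+ 2) = Ex (fun M => F M ^+ 2) - Ex F ^+ 2.
  by rewrite subr_ge0.
transitivity (Ex (fun M => (F M ^+ 2 - (2 * Ex F) * F M) + Ex F ^+ 2)).
  by apply: eq_Ex => M; ring.
by rewrite ExD ExB ExZ Ex_cst; ring.
Qed.

Lemma Ex_norm_le_sqrt F b : 0 <= b -> Ex (fun M => F M ^+ 2) <= b ^+ 2 ->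
  Ex (fun M => `|F M|) <= b.
Proof.
move=> b0 hF; rewrite -(@ler_pXn2r _ 2) ?nnegrE //; last exact: Ex_ge0.
apply: le_trans (sqr_Ex_le _) _; apply: le_trans hF.
by apply: ler_Ex => M; rewrite real_normK ?num_real.
Qed.

(** [resample e] is an orthogonal projection in L^2: it is idempotent and self-adjoint. *)
Lemma Ex_resample_mul e F G :
  Ex (fun M => F M * resample e G M)
  = Ex (fun M => resample e F M * resample e G M).
Proof.
rewrite (Ex_resample e); apply: eq_Ex => M.
by rewrite /resample !upd_upd; ring.
Qed.

Lemma Ex_sqr_resample_le e G :
  Ex (fun M => resample e G M ^+ 2) <= Ex (fun M => G M ^+ 2).
Proof.
rewrite [leRHS](Ex_resample e); apply: ler_Ex => M; rewrite /resample.
set u := G _; set v := G _; rewrite -subr_ge0.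
rewrite (_ : _ - _ = p e * (1 - p e) * (u - v) ^+ 2); last by ring.
case/andP: (p01 e) => p0 p1.
by rewrite mulr_ge0 ?sqr_ge0 // mulr_ge0 // subr_ge0.
Qed.

Lemma Ex_sqr_sub_resample e F :
  Ex (fun M => (F M - resample e F M) ^+ 2)
  = p e * (1 - p e) * Ex (fun M => disc_deriv e F M ^+ 2).
Proof.
rewrite (Ex_resample e) -ExZ; apply: eq_Ex => M.
by rewrite /resample /disc_deriv !upd_upd; ring.
Qed.

(* Averaging out the coordinates one at a time is a sequence of orthogonal
   projections, so that the squared increments add up. *)
Lemma Ex_sqr_sub_foldr (r : seq E) F :
  Ex (fun M => (F M - foldr resample F r M) ^+ 2)
  <= \sum_(e <- r) p e * (1 - p e) * Ex (fun M => disc_deriv e F M ^+ 2).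
Proof.
elim: r => [|e r IH] /=.
  rewrite big_nil [leLHS](_ : _ = 0) // -(Ex_cst 0).
  by apply: eq_Ex => M; rewrite subrr expr0n.
rewrite big_cons -Ex_sqr_sub_resample; set G := foldr _ _ _ in IH *.
pose X M := F M - resample e F M; pose D M := F M - G M.
(* By linearity [F - resample e G] equals [X + resample e D]. The cross term vanishes because
   [resample e X = 0]. *)
have -> : Ex (fun M => (F M - resample e G M) ^+ 2)
   = Ex (fun M => X M ^+ 2 + 2 * (X M * resample e D M) + resample e D M ^+ 2).
  by apply: eq_Ex => M; rewrite /X /D /resample; ring.
rewrite !ExD ExZ Ex_resample_mul.
have -> : Ex (fun M => resample e X M * resample e D M) = 0.
  rewrite -(Ex_cst 0); apply: eq_Ex => M.
  by rewrite /X /resample !upd_upd; ring.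
rewrite mulr0 addr0 lerD2l; apply: le_trans IH; exact: Ex_sqr_resample_le.
Qed.

Lemma foldr_resample_upd (r : seq E) F e b M : e \in r ->
  foldr resample F r (upd M e b) = foldr resample F r M.
Proof.
elim: r M => //= e' r IH M; rewrite inE; case: (eqVneq e e') => [->|nee'] /= er.
  by rewrite /resample !upd_upd.
by rewrite /resample !(updC _ _ _ nee') !IH.
Qed.

(** Averaging over every coordinate forgets the configuration: [M] is changed into [M'] one
    coordinate at a time, and no single change is felt. *)
Lemma foldr_resample_cst F M M' :
  foldr resample F (enum E) M = foldr resample F (enum E) M'.
Proof.
set T := foldr _ _ _.
suff H (r : seq E) : T [ffun i => if i \in r then M' i else M i] = T M.
  rewrite -(H (enum E)); congr T; apply/ffunP => i.
  by rewrite ffunE mem_enum.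
elim: r => [|e r <-]; first by congr T; apply/ffunP => i; rewrite ffunE.
rewrite -[RHS](foldr_resample_upd _ (M' e) _ (_ : e \in enum E)) ?mem_enum //.
congr T; apply/ffunP => i; rewrite updE !ffunE inE.
by case: eqP => [->|].
Qed.

Lemma Ex_foldr_resample F (r : seq E) : Ex (foldr resample F r) = Ex F.
Proof. by elim: r => //= e r <-; rewrite -Ex_resample. Qed.

(** Once all coordinates are averaged out, [F] has become a constant, which can only be its mean;
    the telescoped projection bound is then a variance bound. *)
Theorem Efron_Stein F :
  Ex (fun M => (F M - Ex F) ^+ 2)
  <= \sum_e p e * (1 - p e) * Ex (fun M => disc_deriv e F M ^+ 2).
Proof.
have := Ex_sqr_sub_foldr (enum E) F; rewrite big_enum /=.
suff H M : foldr resample F (enum E) M = Ex F.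
  by apply: le_trans; apply: ler_Ex => M; rewrite H.
rewrite -[RHS](Ex_foldr_resample F (enum E)).
rewrite -[LHS]Ex_cst; apply: eq_Ex => M'; exact: foldr_resample_cst.
Qed.

End BernoulliSpace.

(** * Transfer from an abstract probability space to the product space *)

Section Transfer.
Variables (R : realType) (d : measure_display) (Omega : measurableType d).
Variables (P : probability Omega R) (E : finType) (X : E -> {RV P >-> bool}).
Variable p : E -> R.
Hypothesis marginal : forall e, P [set w | X e w = true] = (p e)%:E.
Hypothesis indep : mutually_independent X.

Definition pattern (w : Omega) : {ffun E -> bool} := [ffun e => X e w].

Lemma measurable_marginal e b : measurable [set w | X e w = b].
Proof.
rewrite (_ : [set w | _] = X e @^-1` [set b]) //.
by rewrite -[_ @^-1` _]setTI; apply: measurable_funP.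
Qed.

Lemma marginal_false e : P [set w | X e w = false] = (1 - p e)%:E.
Proof.
rewrite (_ : [set w | _] = ~` [set w | X e w = true]).
  by rewrite probability_setC ?marginal //; exact: measurable_marginal.
by apply/seteqP; split => w /=; case: (X e w).
Qed.

Lemma marginal_01 e : 0 <= p e <= 1.
Proof.
rewrite -!lee_fin -marginal measure_ge0 probability_le1 //.
exact: measurable_marginal.
Qed.

Lemma pattern_law M : P [set w | pattern w = M] = (bern_weight p M)%:E.
Proof.
have mB e : measurable [set M e] by [].
have := @indep (finset.setTfor E) (fun e => [set M e]) mB.
have -> : [set w | forall i, i \in finset.setTfor E -> [set M i] (X i w)]
    = [set w | pattern w = M].
  apply/seteqP; split => w /=.
    by move=> h; apply/ffunP => e; rewrite ffunE h // finset.in_setT.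
  by move=> <- e _; rewrite ffunE.
move=> ->; rewrite /bern_weight -prodEFin; apply: eq_big => e.
  by rewrite finset.in_setT.
move=> _ /=; case: (M e); [exact: marginal | exact: marginal_false].
Qed.

Lemma measurable_pattern M : measurable [set w | pattern w = M].
Proof.
rewrite (_ : [set w | _] = \big[setI/setT]_(e : E) [set w | X e w = M e]).
  by apply: bigsetI_measurable => e _; exact: measurable_marginal.
apply/seteqP; split => w /=.
  by move=> <-; rewrite -bigcap_seq => e _ /=; rewrite ffunE.
rewrite -bigcap_seq => h; apply/ffunP => e; rewrite ffunE; apply: h => /=.
by rewrite mem_index_enum.
Qed.

(** [Phi \o pattern] is a finite combination of indicators. Integrals of functions of the entries
    thereby become finite sums, and no measurability of eigenvalues is ever at stake. *)
Lemma Rintegral_pattern (Phi : {ffun E -> bool} -> R) :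
  \int[P]_w Phi (pattern w) = Ex p Phi.
Proof.
rewrite /Rintegral /Ex.
have E1 w : (Phi (pattern w))%:E
   = (\sum_M (Phi M)%:E * (\1_[set w' | pattern w' = M] w)%:E)%E.
  rewrite (bigD1 (pattern w)) //= big1 => [|M Mw]; last first.
    rewrite indicE (_ : (w \in _) = false) ?mule0 //; apply/negbTE/negP => /set_mem /=.
    by move=> E1; rewrite E1 eqxx in Mw.
  by rewrite indicE mem_set //= mule1 adde0.
under eq_integral do rewrite E1.
rewrite integral_sum //; last first.
  move=> M; apply: integrableZl => //; apply: integrable_indic.
  exact: measurable_pattern.
rewrite (eq_bigr (fun M => (bern_weight p M * Phi M)%:E)); first by rewrite sumEFin.
move=> M _; rewrite integralZl //; last first.
  by apply: integrable_indic; exact: measurable_pattern.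
rewrite integral_indic ?setIT //; last exact: measurable_pattern.
rewrite mulrC EFinM; congr (_ * _)%E; exact: pattern_law.
Qed.

End Transfer.

(** * Operator norm of the centered matrix *)

Section TraceInequalities.
Variable R : realType.

Lemma mxtrace_sqr_ge0 (m n : nat) (B : 'M[R]_(m, n)) : 0 <= \tr (B^T *m B).
Proof.
rewrite /mxtrace; apply: sumr_ge0 => i _; rewrite mxE; apply: sumr_ge0 => j _.
by rewrite mxE -expr2 sqr_ge0.
Qed.

Lemma mxtrace_AMGM (m n : nat) (B C : 'M[R]_(m, n)) :
  2 * \tr (B^T *m C) <= \tr (B^T *m B) + \tr (C^T *m C).
Proof.
have := mxtrace_sqr_ge0 (B - C).
rewrite [(B - C)^T]raddfB /= mulmxBl !mulmxBr !raddfB /=.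
rewrite -[\tr (C^T *m B)]mxtrace_tr trmx_mul trmxK; lra.
Qed.

Lemma trmx_exp (N : nat) (X : 'M[R]_N) k : X^T = X -> (X ^+ k)^T = X ^+ k.
Proof.
move=> XT; elim: k => [|k IH]; first by rewrite !expr0 trmx1.
by rewrite [in LHS]exprS -mulmxE trmx_mul IH XT mulmxE -exprSr.
Qed.

(** Discrete maximum principle: a convex sequence has no strict maximum in the interior, so the
    bound extends from [m] to [m.+1]. *)
Lemma convex_seq_le_max (c : nat -> R) m :
  (forall i, (i.+2 <= m)%N -> 2 * c i.+1 <= c i + c i.+2) ->
  forall i, (i <= m)%N -> c i <= Num.max (c 0) (c m).
Proof.
elim: m => [|m IH] cvx i im; first by move: im; rewrite leqn0 => /eqP ->; rewrite le_max lexx.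
have {}IH j : (j <= m)%N -> c j <= Num.max (c 0) (c m).
  by apply: IH => k km; apply: cvx; rewrite (leq_trans km).
rewrite leq_eqVlt in im; case/orP: im => [/eqP ->|im]; first by rewrite le_max lexx orbT.
suff cm : c m <= Num.max (c 0) (c m.+1).
  apply: le_trans (IH _ im) _; rewrite ge_max cm andbT le_max lexx //.
case: m {im} cvx IH => [|m] cvx IH; first by rewrite le_max lexx.
rewrite leNgt gt_max; apply/negP => /andP [c0 cS].
have := IH m (leqnSn m); rewrite (max_idPr _) ?(ltW c0) // => cm.
have := cvx m (leqnn _); lra.
Qed.

(* The even-indexed traces form a convex sequence, and an odd-indexed one is
   below the mean of its neighbours. *)
Lemma mxtrace_alternating_le (N : nat) (S X Y : 'M[R]_N) (m q : nat) :
  S^T = S -> X^T = X -> Y^T = Y -> (q <= 2 * m)%N ->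
  \tr (S * X ^+ q * S * Y ^+ (2 * m - q))
  <= \tr (S * S * X ^+ (2 * m)) + \tr (S * S * Y ^+ (2 * m)).
Proof.
move=> ST XT YT qm.
pose a q := \tr (S * X ^+ q * S * Y ^+ (2 * m - q)).
(* [a (k + l)] is the Frobenius inner product of X^k S Y^(m-k) and X^l S Y^(m-l), so AM-GM yields
   midpoint convexity. *)
have mid i j : (i <= m)%N -> (j <= m)%N ->
    2 * a (i + j)%N <= a (2 * i)%N + a (2 * j)%N.
  move=> im jm.
  have aE k l : (k <= m)%N -> (l <= m)%N -> a (k + l)%N
      = \tr ((X ^+ k * S * Y ^+ (m - k))^T *m (X ^+ l * S * Y ^+ (m - l))).
    move=> km lm; rewrite -!mulmxE !trmx_mul !trmx_exp // ST !mulmxE.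
    rewrite -!mulrA -mulmxE mxtrace_mulC mulmxE -!mulrA -exprD.
    rewrite [X ^+ k * (X ^+ l * _)]mulrA -exprD /a -!mulrA.
    congr (\tr (_ * (_ * (_ * Y ^+ _)))).
    lia.
  rewrite aE // mul2n -addnn mul2n -addnn !aE //; exact: mxtrace_AMGM.
have a0 : a 0%N = \tr (S * S * Y ^+ (2 * m)) by rewrite /a expr0 mulr1 subn0.
have am : a (2 * m)%N = \tr (S * S * X ^+ (2 * m)).
  by rewrite /a subnn expr0 mulr1 -!mulmxE mxtrace_mulC mulmxA.
have a_ge0 i : (i <= m)%N -> 0 <= a (2 * i)%N.
  move=> im; have := mid i i im im; rewrite addnn -mul2n => h.
  have aE : a (2 * i)%N
      = \tr ((X ^+ i * S * Y ^+ (m - i))^T *m (X ^+ i * S * Y ^+ (m - i))).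
    rewrite -!mulmxE !trmx_mul !trmx_exp // ST !mulmxE.
    rewrite -!mulrA -mulmxE mxtrace_mulC mulmxE -!mulrA -exprD.
    rewrite [X ^+ i * (X ^+ i * _)]mulrA -exprD /a -!mulrA.
    by congr (\tr (_ * (X ^+ _ * (_ * Y ^+ _)))); lia.
  by rewrite aE mxtrace_sqr_ge0.
have even_le i : (i <= m)%N -> a (2 * i)%N <= a (2 * m)%N + a 0%N.
  move=> im; apply: le_trans (@convex_seq_le_max (fun i => a (2 * i)%N) m _ i im) _.
    move=> k km; have := mid k k.+2 (ltnW (ltnW km)) km.
    by rewrite (_ : (k + k.+2 = 2 * k.+1)%N) //; lia.
  by rewrite ge_max muln0 lerDr lerDl a_ge0 // -[0%N](muln0 2) a_ge0.
rewrite -am -a0 -/(a q).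
have := mid q./2 (uphalf q); rewrite addnC uphalf_half -addnA addnn odd_double_half.
have q2 : (q./2 <= m)%N by lia.
have q2' : (odd q + q./2 <= m)%N by lia.
move=> /(_ q2 q2'); have := even_le _ q2; have := even_le _ q2'; lra.
Qed.

Lemma exprB_telescope (T : pzRingType) (x y : T) k :
  x ^+ k - y ^+ k = \sum_(q < k) x ^+ q * (x - y) * y ^+ (k.-1 - q).
Proof.
elim: k => [|k IH]; first by rewrite !expr0 subrr big_ord0.
rewrite big_ord_recr /= subnn expr0 mulr1 [X in _ = X + _](_ : _ = (x ^+ k - y ^+ k) * y).
  by rewrite !exprSr mulrBr mulrBl [RHS]addrC addrA subrK.
rewrite IH mulr_suml; apply: eq_bigr => q _; rewrite -[in RHS]mulrA -exprSr.
by congr (_ * _ ^+ _); have := ltn_ord q; lia.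
Qed.

Section TraceMoment.
Variables (E : finType) (p : E -> R) (N : nat) (S : E -> 'M[R]_N).
Hypothesis p01 : forall e, 0 <= p e <= 1.
Hypothesis S_sym : forall e, (S e)^T = S e.

Definition centered_sum (M : {ffun E -> bool}) : 'M[R]_N :=
  \sum_e ((M e)%:R - p e) *: S e.

Lemma centered_sum_sym M : (centered_sum M)^T = centered_sum M.
Proof.
by rewrite /centered_sum linear_sum; apply: eq_bigr => e _; rewrite linearZ /= S_sym.
Qed.

Lemma centered_sum_upd M e :
  centered_sum (upd M e true) - centered_sum (upd M e false) = S e.
Proof.
rewrite /centered_sum -sumrB (bigD1 e) //= big1 => [|i /negbTE ie].
  rewrite addr0 !updE eqxx -scalerBl /= (_ : _ - _ = 1) ?scale1r //; ring.
by rewrite !updE ie subrr.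
Qed.

Lemma mxtrace_sqr_exp_ge0 (X : 'M[R]_N) e m : X^T = X ->
  0 <= \tr (S e * S e * X ^+ (2 * m)).
Proof.
move=> XT; have := mxtrace_sqr_ge0 (X ^+ m * S e).
rewrite -mulmxE trmx_mul S_sym trmx_exp // !mulmxE.
rewrite -!mulrA [X ^+ m * (X ^+ m * _)]mulrA -exprD addnn -mul2n.
set Z := X ^+ _; suff -> : \tr (S e * (Z * S e)) = \tr (S e * (S e * Z)) by [].
by rewrite -[LHS]mxtrace_mulC mulmxE -mulrA -[LHS]mxtrace_mulC mulmxE mulrA.
Qed.

(* With D_e the discrete derivative, Ex ((M_e - p_e) F) = p_e (1 - p_e) Ex (D_e F);
   for F = tr (S_e X^(2m+1)) the difference D_e F telescopes into 2m+1 traces of the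
   form bounded by mxtrace_alternating_le. *)
Theorem trace_moment_step m :
  Ex p (fun M => \tr (centered_sum M ^+ (2 * m.+1)))
  <= (2 * m + 1)%:R * Ex p (fun M =>
       \sum_e ((M e)%:R + p e) * \tr (S e * S e * centered_sum M ^+ (2 * m))).
Proof.
pose X := centered_sum.
have -> : Ex p (fun M => \tr (X M ^+ (2 * m.+1)))
  = \sum_e Ex p (fun M => ((M e)%:R - p e) * \tr (S e * X M ^+ (2 * m + 1))).
  rewrite -Ex_sum; apply: eq_Ex => M.
  rewrite (_ : (2 * m.+1 = (2 * m + 1).+1)%N); last by lia.
  rewrite exprS {1}/X /centered_sum mulr_suml raddf_sum; apply: eq_bigr => e _.
  by rewrite /= -mulmxE -scalemxAl mxtraceZ.
rewrite Ex_sum mulr_sumr; apply: ler_sum => e _.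
(* Integrating by parts on the left and resampling on the right leaves a pointwise comparison
   between the two states of entry [e]. The weight [(M e)%:R + p e] averages to p(1 + p) g1 + p(1 -
   p) g0, which exceeds p(1 - p)(g1 + g0) by 2 p^2 g1. *)
rewrite Ex_centered_mul -ExZ -ExZ [leRHS](Ex_resample _ e).
apply: ler_Ex => // M; rewrite /disc_deriv /resample !updE eqxx /=.
set X1 := X _; set X0 := X _.
have X1T : X1^T = X1 by exact: centered_sum_sym.
have X0T : X0^T = X0 by exact: centered_sum_sym.
rewrite -/X -/X1 -/X0.
set g1 := \tr (_ * X1 ^+ (2 * m)); set g0 := \tr (_ * X0 ^+ (2 * m)).
have g10 : 0 <= g1 by exact: mxtrace_sqr_exp_ge0.
have g00 : 0 <= g0 by exact: mxtrace_sqr_exp_ge0.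
have D : \tr (S e * X1 ^+ (2 * m + 1)) - \tr (S e * X0 ^+ (2 * m + 1))
    <= (2 * m + 1)%:R * (g1 + g0).
  rewrite -raddfB -mulrBr exprB_telescope centered_sum_upd mulr_sumr raddf_sum.
  apply: le_trans (_ : \sum_(q < 2 * m + 1) (g1 + g0) <= _); last first.
    by rewrite sumr_const card_ord mulr_natl.
  apply: ler_sum => q _; rewrite [(_.-1 - q)%N](_ : _ = 2 * m - q)%N; last by lia.
  rewrite /= 2!(mulrA (S e)).
  by apply: mxtrace_alternating_le => //; have := ltn_ord q; lia.
case/andP: (p01 e) => p0 p1.
have q0 : 0 <= 1 - p e by rewrite subr_ge0.
have k0 : 0 <= (2 * m + 1)%:R :> R by [].
apply: le_trans (ler_wpM2l (mulr_ge0 p0 q0) D) _.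
rewrite -subr_ge0 (_ : _ - _ = (2 * m + 1)%:R * (2 * (p e * p e * g1))); last by ring.
by rewrite !mulr_ge0.
Qed.

End TraceMoment.
End TraceInequalities.

(** * Euclidean norm, operator norm and traces of powers *)

Section EuclideanSpace.
Variable R : realType.
Implicit Types (n : nat).

Definition dot n (u v : 'cV[R]_n) : R := \sum_i u i 0 * v i 0.
Definition nrm n (u : 'cV[R]_n) : R := Num.sqrt (dot u u).

Lemma dotC n (u v : 'cV[R]_n) : dot u v = dot v u.
Proof. by apply: eq_bigr => i _; rewrite mulrC. Qed.

Lemma dotDl n (u v w : 'cV[R]_n) : dot (u + v) w = dot u w + dot v w.
Proof. by rewrite -big_split; apply: eq_bigr => i _; rewrite mxE mulrDl. Qed.

Lemma dotZl n c (u v : 'cV[R]_n) : dot (c *: u) v = c * dot u v.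
Proof. by rewrite mulr_sumr; apply: eq_bigr => i _; rewrite mxE mulrA. Qed.

Lemma dotNl n (u v : 'cV[R]_n) : dot (- u) v = - dot u v.
Proof. by rewrite -scaleN1r dotZl mulN1r. Qed.

Lemma dotBl n (u v w : 'cV[R]_n) : dot (u - v) w = dot u w - dot v w.
Proof. by rewrite dotDl dotNl. Qed.

Lemma dotDr n (u v w : 'cV[R]_n) : dot u (v + w) = dot u v + dot u w.
Proof. by rewrite ![dot u _]dotC dotDl. Qed.

Lemma dotZr n c (u v : 'cV[R]_n) : dot u (c *: v) = c * dot u v.
Proof. by rewrite ![dot u _]dotC dotZl. Qed.

Lemma dotBr n (u v w : 'cV[R]_n) : dot u (v - w) = dot u v - dot u w.
Proof. by rewrite ![dot u _]dotC dotBl. Qed.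

Lemma dot_mulmx m n (A : 'M[R]_(m, n)) u v : dot (A *m u) v = dot u (A^T *m v).
Proof.
rewrite /dot; under eq_bigr do rewrite mxE mulr_suml.
rewrite exchange_big; apply: eq_bigr => j _; rewrite mxE mulr_sumr.
by apply: eq_bigr => i _; rewrite mxE; ring.
Qed.

Lemma dot_delta n (u : 'cV[R]_n) i : dot (delta_mx i 0) u = u i 0.
Proof.
rewrite /dot (bigD1 i) //= mxE !eqxx mul1r big1 ?addr0 // => j /negbTE ji.
by rewrite mxE ji mul0r.
Qed.

Lemma dot_ge0 n (u : 'cV[R]_n) : 0 <= dot u u.
Proof. by apply: sumr_ge0 => i _; rewrite -expr2 sqr_ge0. Qed.

Lemma dot_eq0 n (u : 'cV[R]_n) : (dot u u == 0) = (u == 0).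
Proof.
apply/eqP/eqP => [|->]; last by rewrite /dot big1 // => i _; rewrite mxE mul0r.
move=> /eqP; rewrite psumr_eq0 => [/allP h|i _]; last by rewrite -expr2 sqr_ge0.
apply/matrixP => i j; rewrite ord1 mxE.
by have := h i (mem_index_enum i); rewrite /= -expr2 sqrf_eq0 => /eqP.
Qed.

Lemma sqr_dot_le n (u v : 'cV[R]_n) : dot u v ^+ 2 <= dot u u * dot v v.
Proof.
have [/eqP|vv] := eqVneq (dot v v) 0.
  rewrite dot_eq0 => /eqP ->; rewrite [dot u 0]dotC -(scale0r (0 : 'cV_n)) !dotZl.
  by rewrite !mul0r mulr0 expr0n.
have v0 : 0 < dot v v by rewrite lt_def vv dot_ge0.
have := dot_ge0 (dot v v *: u - dot u v *: v).
rewrite !(dotBl, dotBr, dotZl, dotZr) [dot v u]dotC.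
rewrite (_ : _ - _ = dot v v * (dot u u * dot v v - dot u v ^+ 2)); last by ring.
by rewrite pmulr_rge0 // subr_ge0.
Qed.

Lemma nrm_ge0 n (u : 'cV[R]_n) : 0 <= nrm u.
Proof. exact: sqrtr_ge0. Qed.

Lemma sqr_nrm n (u : 'cV[R]_n) : nrm u ^+ 2 = dot u u.
Proof. by rewrite sqr_sqrtr // dot_ge0. Qed.

Lemma nrm_eq0 n (u : 'cV[R]_n) : (nrm u == 0) = (u == 0).
Proof. by rewrite -dot_eq0 -sqr_nrm sqrf_eq0. Qed.

Lemma nrm_gt0 n (u : 'cV[R]_n) : (0 < nrm u) = (u != 0).
Proof. by rewrite lt_def nrm_ge0 andbT nrm_eq0. Qed.

Lemma dot_le_nrm n (u v : 'cV[R]_n) : `|dot u v| <= nrm u * nrm v.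
Proof.
rewrite -(@ler_pXn2r _ 2) ?nnegrE ?mulr_ge0 ?nrm_ge0 //.
by rewrite exprMn !sqr_nrm real_normK ?num_real // sqr_dot_le.
Qed.

Lemma nrmD n (u v : 'cV[R]_n) : nrm (u + v) <= nrm u + nrm v.
Proof.
rewrite -(@ler_pXn2r _ 2) ?nnegrE ?addr_ge0 ?nrm_ge0 //.
rewrite sqrrD !sqr_nrm dotDl !dotDr [dot v u]dotC.
have := ler_norm (dot u v); have := dot_le_nrm u v; lra.
Qed.

Lemma nrmZ n c (u : 'cV[R]_n) : nrm (c *: u) = `|c| * nrm u.
Proof.
by rewrite /nrm dotZl dotZr mulrA -expr2 sqrtrM ?sqr_ge0 // sqrtr_sqr.
Qed.

Lemma nrmN n (u : 'cV[R]_n) : nrm (- u) = nrm u.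
Proof. by rewrite -scaleN1r nrmZ normrN1 mul1r. Qed.

Lemma coord_le_nrm n (u : 'cV[R]_n) i : `|u i 0| <= nrm u.
Proof.
rewrite -(@ler_pXn2r _ 2) ?nnegrE ?nrm_ge0 // sqr_nrm real_normK ?num_real //.
rewrite /dot (bigD1 i) //= expr2 lerDl.
by apply: sumr_ge0 => j _; rewrite -expr2 sqr_ge0.
Qed.

Lemma nrm_delta n (i : 'I_n) : nrm (delta_mx i 0) = 1.
Proof. by rewrite /nrm dot_delta mxE !eqxx sqrtr1. Qed.

Definition opnorm_le m n (H : 'M[R]_(m, n)) (k : R) : Prop :=
  forall u, nrm (H *m u) <= k * nrm u.

Lemma opnorm_le_tr m n (H : 'M[R]_(m, n)) k :
  0 <= k -> opnorm_le H k -> opnorm_le H^T k.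
Proof.
move=> k0 h u; have [z0|z0] := eqVneq (nrm (H^T *m u)) 0.
  by rewrite z0 mulr_ge0 ?nrm_ge0.
have zp : 0 < nrm (H^T *m u) by rewrite lt_def z0 nrm_ge0.
rewrite -(ler_pM2r zp) -expr2 sqr_nrm dot_mulmx trmxK.
apply: le_trans (ler_norm _) _; apply: le_trans (dot_le_nrm _ _) _.
by rewrite mulrAC mulrC ler_wpM2r ?nrm_ge0 // h.
Qed.

Lemma opnorm_leD m n (H K : 'M[R]_(m, n)) k l :
  opnorm_le H k -> opnorm_le K l -> opnorm_le (H + K) (k + l).
Proof.
move=> h h' u; rewrite mulmxDl mulrDl; apply: le_trans (nrmD _ _) _.
by rewrite lerD ?h ?h'.
Qed.

Lemma opnorm_leN m n (H : 'M[R]_(m, n)) k : opnorm_le H k -> opnorm_le (- H) k.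
Proof. by move=> h u; rewrite mulNmx nrmN. Qed.

Lemma opnorm_le_trans m n (H : 'M[R]_(m, n)) k l :
  k <= l -> opnorm_le H k -> opnorm_le H l.
Proof.
by move=> kl h u; apply: le_trans (h u) _; rewrite ler_wpM2r ?nrm_ge0.
Qed.

Lemma delta_mulmx m n (x : 'I_m) (y : 'I_n) (u : 'cV[R]_n) :
  delta_mx x y *m u = u y 0 *: delta_mx x 0.
Proof.
apply/matrixP => i j; rewrite !mxE ord1 (bigD1 y) //= mxE eqxx andbT.
rewrite big1 ?addr0 => [|k /negbTE ky]; last by rewrite mxE ky andbF mul0r.
by rewrite mulrC.
Qed.

Lemma opnorm_le_delta m n (x : 'I_m) (y : 'I_n) :
  opnorm_le (delta_mx x y : 'M[R]__) 1.
Proof.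
by move=> u; rewrite delta_mulmx nrmZ nrm_delta mulr1 mul1r coord_le_nrm.
Qed.

(** Log-convexity makes the ratios m(k+1) / m(k) nondecreasing, so all of them are at least m(1) /
    m(0). The proof multiplies out, since terms may vanish. *)
Lemma log_convex_seq (m : nat -> R) :
  (forall k, 0 <= m k) -> (forall k, m k.+1 ^+ 2 <= m k * m k.+2) ->
  forall q, m 1%N ^+ q.+1 <= m 0%N ^+ q * m q.+1.
Proof.
move=> m0 cvx.
have step k : m 1%N * m k <= m 0%N * m k.+1.
  elim: k => [|k IH]; first by rewrite mulrC.
  have [->|mk1] := eqVneq (m k.+1) 0; first by rewrite mulr0 mulr_ge0.
  have mk : 0 < m k.
    rewrite lt_def m0 andbT; apply: contraNneq mk1 => mk.
    by have := cvx k; rewrite mk mul0r -sqrf_eq0 eq_le sqr_ge0 andbT.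
  rewrite -(ler_pM2l mk); apply: le_trans (_ : m 0%N * m k.+1 ^+ 2 <= _).
    by rewrite expr2 mulrCA mulrA mulrA ler_wpM2r // mulrC.
  by rewrite [leRHS]mulrCA ler_wpM2l.
elim => [|q IH]; first by rewrite expr1 expr0 mul1r.
rewrite exprS; apply: le_trans (ler_wpM2l (m0 1%N) IH) _.
by rewrite mulrCA [X in _ <= X * _]exprSr -mulrA ler_wpM2l ?exprn_ge0.
Qed.

(* k |-> |X^k u|^2 is log-convex for symmetric X. *)
Lemma nrm_exp_le_mxtrace N (X : 'M[R]_N) (u : 'cV[R]_N) q : X^T = X ->
  nrm (X *m u) ^+ (2 * q.+1) <= \tr (X ^+ (2 * q.+1)) * nrm u ^+ (2 * q.+1).
Proof.
move=> XT; pose m k := dot (X ^+ k *m u) (X ^+ k *m u).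
have XS k v : X ^+ k.+1 *m v = X *m (X ^+ k *m v) by rewrite mulmxA mulmxE -exprS.
have /(_ q) : forall q, m 1%N ^+ q.+1 <= m 0%N ^+ q * m q.+1.
  apply: log_convex_seq => k; first exact: dot_ge0.
  rewrite /m {1}XS dot_mulmx XT -XS; exact: sqr_dot_le.
have m0 : m 0%N = nrm u ^+ 2 by rewrite /m expr0 mul1mx sqr_nrm.
have m1 : m 1%N = nrm (X *m u) ^+ 2 by rewrite /m expr1 sqr_nrm.
rewrite m0 m1 -!exprM => h; apply: le_trans h _.
rewrite [X in _ <= _ * X](_ : _ = nrm u ^+ (2 * q) * nrm u ^+ 2); last first.
  by rewrite -exprD mulnS addnC.
rewrite [leRHS]mulrCA ler_wpM2l ?exprn_ge0 ?nrm_ge0 //.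
rewrite sqr_nrm mulnC exprM.
(* By symmetry the trace is the squared Frobenius norm of X^(q+1), which dominates its action on [u]
   by Cauchy-Schwarz on each row. *)
have -> : \tr (X ^+ q.+1 ^+ 2) = \sum_i \sum_j (X ^+ q.+1) i j ^+ 2.
  apply: eq_bigr => i _; rewrite expr2 mxE; apply: eq_bigr => j _.
  by rewrite expr2; congr (_ * _); rewrite -{1}(trmx_exp q.+1 XT) mxE.
rewrite mulr_suml; apply: ler_sum => i _; rewrite -expr2.
have -> : (X ^+ q.+1 *m u) i 0 = dot (row i (X ^+ q.+1))^T u.
  by rewrite mxE; apply: eq_bigr => j _; rewrite !mxE.
apply: le_trans (sqr_dot_le _ _) _; rewrite ler_wpM2r ?dot_ge0 //.
by apply: ler_sum => j _; rewrite !mxE.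
Qed.

End EuclideanSpace.

Section OperatorNorm.
Variable R : realType.

(** Markov's inequality for 2 to the number of ones in [J]: by independence its mean is a product of
    factors 1 + p e <= exp (p e). *)
Lemma chernoff_pow2 (E : finType) (p : E -> R) (J : pred E) d k :
  (forall e, 0 <= p e <= 1) -> \sum_(e | J e) p e <= d ->
  Ex p (fun M => (k <= \sum_(e | J e) M e)%N%:R) <= expR d / 2 ^+ k.
Proof.
move=> p01 hd.
pose f e (b : bool) : R := if J e then 2 ^+ b else 1.
apply: le_trans (_ : Ex p (fun M => (2 ^+ k)^-1 * \prod_e f e (M e)) <= _).
  apply: ler_Ex => // M.
  have -> : \prod_e f e (M e) = 2 ^+ (\sum_(e | J e) M e)%N.
    by rewrite /f -big_mkcond /= -expr_sum.
  rewrite mulrC; case: leqP => h; last by rewrite divr_ge0 ?exprn_ge0.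
  by rewrite ler_pdivlMr ?exprn_gt0 // mul1r ler_eXn2l // ltrDl.
rewrite ExZ mulrC ler_wpM2r ?invr_ge0 ?exprn_ge0 // Ex_prod.
apply: le_trans (_ : \prod_e expR (if J e then p e else 0) <= _).
  apply: ler_prod => e _; case/andP: (p01 e) => p0 p1; rewrite /f.
  case: ifP => _; rewrite ?expr1 ?expr0.
    by move: (expR_ge1Dx (p e)) => h; apply/andP; split; lra.
  by rewrite expR0; apply/andP; split; lra.
by rewrite -expR_sum ler_expR -big_mkcond.
Qed.

Lemma norm_exp_entry_le (N : nat) (X : 'M[R]_N) k i j :
  (forall i j, `|X i j| <= 1) -> `|(X ^+ k) i j| <= N%:R ^+ k.
Proof.
move=> X1; elim: k i j => [|k IH] i j.
  by rewrite !expr0 mxE; case: (i == j); rewrite ?normr0 ?normr1 ?ler01.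
rewrite !exprS mxE; apply: le_trans (ler_norm_sum _ _ _) _.
apply: le_trans (_ : \sum_(l < N) N%:R ^+ k <= _).
  by apply: ler_sum => l _; rewrite normrM -[leRHS]mul1r ler_pM.
by rewrite sumr_const card_ord mulr_natl.
Qed.

Lemma sqr_exp_diag_ge0 (N : nat) (X : 'M[R]_N) k i :
  X^T = X -> 0 <= (X ^+ (2 * k)) i i.
Proof.
move=> XT; rewrite mul2n -addnn exprD mxE; apply: sumr_ge0 => j _.
by rewrite -{1}(trmx_exp k XT) mxE -expr2 sqr_ge0.
Qed.

Variables (n : nat) (p : 'I_n * 'I_n -> R).
Hypothesis p01 : forall e, 0 <= p e <= 1.

Definition noise (M : {ffun 'I_n * 'I_n -> bool}) : 'M[R]_n :=
  \matrix_(x, y) ((M (x, y))%:R - p (x, y)).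

Definition dilation_unit (e : 'I_n * 'I_n) : 'M[R]_(n + n) :=
  block_mx 0 (delta_mx e.1 e.2) (delta_mx e.2 e.1) 0.

Lemma dilation_unit_sym e : (dilation_unit e)^T = dilation_unit e.
Proof. by rewrite /dilation_unit tr_block_mx !trmx0 !trmx_delta. Qed.

Lemma centered_sum_dilation M :
  centered_sum p dilation_unit M = block_mx 0 (noise M) (noise M)^T 0.
Proof.
pose g (A : 'M[R]_n) := block_mx 0 A A^T 0.
have gD : {morph g : A B / A + B} by move=> A B; rewrite /g linearD add_block_mx !addr0.
have g0 : g 0 = 0 by rewrite /g trmx0 block_mx0.
rewrite /centered_sum; transitivity
  (\sum_e g (((M e)%:R - p e) *: delta_mx e.1 e.2)).
  apply: eq_bigr => e _.
  by rewrite /g scale_block_mx !scaler0 linearZ /= trmx_delta.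
rewrite -(big_morph g gD g0) -/(g _); congr g.
rewrite [RHS]matrix_sum_delta pair_bigA; apply: eq_bigr => -[x y] _.
by rewrite mxE.
Qed.

Let X := centered_sum p dilation_unit.

Lemma dilation_entry_le1 M i j : `|X M i j| <= 1.
Proof.
have H x y : `|noise M x y| <= 1.
  rewrite mxE; case/andP: (p01 (x, y)) => p0 p1.
  by case: (M (x, y)) => /=; rewrite ler_norml; apply/andP; split; lra.
rewrite /X centered_sum_dilation.
case: (split_ordP i) => x ->; case: (split_ordP j) => y ->.
- by rewrite block_mxEul mxE normr0 ler01.
- by rewrite block_mxEur.
- by rewrite block_mxEdl mxE.
- by rewrite block_mxEdr mxE normr0 ler01.
Qed.

(** The square of a dilation unit is the diagonal projection onto one row index and one column
    index. Weighted sums of these traces are thus governed by the row and column sums of the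
    weights, that is, by degrees. *)
Lemma mxtrace_dilation_unit e (Y : 'M[R]_(n + n)) :
  \tr (dilation_unit e * dilation_unit e * Y)
  = Y (lshift n e.1) (lshift n e.1) + Y (rshift n e.2) (rshift n e.2).
Proof.
have tr_delta (x : 'I_n) (Z : 'M[R]_n) : \tr (delta_mx x x *m Z) = Z x x.
  rewrite /mxtrace (bigD1 x) //= big1 => [|i /negbTE ix]; last first.
    by rewrite mxE big1 // => j _; rewrite mxE ix mul0r.
  rewrite addr0 mxE (bigD1 x) //= big1 => [|i /negbTE ix]; last first.
    by rewrite mxE ix andbF mul0r.
  by rewrite mxE !eqxx mul1r addr0.
rewrite /dilation_unit -!mulmxE -{1}(submxK Y) !mulmx_block.
rewrite !mul0mx !mulmx0 !mul_delta_mx !add0r !addr0 !mul0mx !addr0 !add0r.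
by rewrite mxtrace_block !tr_delta !mxE.
Qed.

Lemma sum_pair (F : 'I_n * 'I_n -> R) : \sum_e F e = \sum_x \sum_y F (x, y).
Proof. by rewrite pair_bigA; apply: eq_bigr => -[]. Qed.

Lemma sum_mxtrace_dilation_le (c : 'I_n * 'I_n -> R) K (Y : 'M[R]_(n + n)) :
  (forall i, 0 <= Y i i) ->
  (forall x, \sum_y c (x, y) <= K) -> (forall y, \sum_x c (x, y) <= K) ->
  \sum_e c e * \tr (dilation_unit e * dilation_unit e * Y) <= K * \tr Y.
Proof.
move=> Y0 row col; under eq_bigr do rewrite mxtrace_dilation_unit mulrDr.
rewrite big_split /mxtrace big_split_ord /= mulrDr !mulr_sumr; apply: lerD.
  rewrite sum_pair.
  by apply: ler_sum => x _; rewrite /= -mulr_suml ler_wpM2r.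
rewrite sum_pair exchange_big.
by apply: ler_sum => y _; rewrite /= -mulr_suml ler_wpM2r.
Qed.

Definition high_degree k (M : {ffun 'I_n * 'I_n -> bool}) : bool :=
  [exists x, k <= \sum_y M (x, y)]%N || [exists y, k <= \sum_x M (x, y)]%N.

Variable d : R.
Hypothesis row_le : forall x, \sum_y p (x, y) <= d.
Hypothesis col_le : forall y, \sum_x p (x, y) <= d.

Lemma Ex_high_degree k :
  Ex p (fun M => (high_degree k M)%:R) <= (2 * n)%:R * (expR d / 2 ^+ k).
Proof.
pose rowP x (e : 'I_n * 'I_n) := e.1 == x.
pose colP y (e : 'I_n * 'I_n) := e.2 == y.
have rowE (T : nmodType) (F : 'I_n * 'I_n -> T) x :
    \sum_(e | rowP x e) F e = \sum_y F (x, y).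
  transitivity (\sum_(e | (e.1 == x) && true) F (e.1, e.2)).
    by apply: eq_big => [e|[]//]; rewrite andbT.
  rewrite -(pair_big_dep (fun i => i == x) (fun _ _ => true) (fun i j => F (i, j))) /=.
  by rewrite big_pred1_eq.
have colE (T : nmodType) (F : 'I_n * 'I_n -> T) y :
    \sum_(e | colP y e) F e = \sum_x F (x, y).
  transitivity (\sum_(e | true && (e.2 == y)) F (e.1, e.2)).
    by apply: eq_big => [e|[]//].
  rewrite -(pair_big_dep (fun _ => true) (fun _ j => j == y) (fun i j => F (i, j))) /=.
  by apply: eq_bigr => i _; rewrite big_pred1_eq.
apply: le_trans (_ : Ex p (fun M =>
     \sum_x (k <= \sum_(e | rowP x e) M e)%N%:R
     + \sum_y (k <= \sum_(e | colP y e) M e)%N%:R) <= _).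
  apply: ler_Ex => // M; rewrite /high_degree.
  case: existsP => [[x hx]|_] /=.
    rewrite (bigD1 x) //= rowE hx -addrA lerDl.
    by rewrite addr_ge0 ?sumr_ge0 // => i _; rewrite ler0n.
  case: existsP => [[y hy]|_] /=; last first.
    by rewrite addr_ge0 ?sumr_ge0 // => i _; rewrite ler0n.
  rewrite [X in _ <= _ + X](bigD1 y) //= colE hy addrCA lerDl.
  by rewrite addr_ge0 ?sumr_ge0 // => i _; rewrite ler0n.
rewrite ExD !Ex_sum mul2n -addnn natrD mulrDl; apply: lerD.
  rewrite mulr_natl -[n in leRHS]card_ord -sumr_const.
  by apply: ler_sum => x _; apply: chernoff_pow2 => //; rewrite rowE.
rewrite mulr_natl -[n in leRHS]card_ord -sumr_const.
by apply: ler_sum => x _; apply: chernoff_pow2 => //; rewrite colE.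
Qed.

(* If no row or column of M has k ones, the factor M_e + p_e of trace_moment_step has
   row and column sums at most k + d; otherwise every term is bounded trivially. *)
Lemma trace_moment_recursion k m : 0 <= d ->
  Ex p (fun M => \tr (X M ^+ (2 * m.+1)))
  <= (2 * m + 1)%:R * ((k%:R + d) * Ex p (fun M => \tr (X M ^+ (2 * m)))
     + (2 * n)%:R ^+ (2 * m + 2) * ((2 * n)%:R * (expR d / 2 ^+ k))).
Proof.
move=> d0; apply: le_trans (trace_moment_step p01 dilation_unit_sym m) _.
rewrite ler_wpM2l //.
have XT M : (X M)^T = X M by apply: centered_sum_sym; exact: dilation_unit_sym.
have tr_le M : \tr (X M ^+ (2 * m)) <= (2 * n)%:R ^+ (2 * m + 1).
  apply: le_trans (_ : \sum_(i < n + n) (n + n)%:R ^+ (2 * m) <= _).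
    apply: ler_sum => i _; apply: le_trans (ler_norm _) _.
    by apply: norm_exp_entry_le => ? ?; exact: dilation_entry_le1.
  by rewrite sumr_const card_ord addnn -mul2n addn1 exprS mulr_natl.
apply: le_trans (_ : Ex p (fun M => (k%:R + d) * \tr (X M ^+ (2 * m))
   + (2 * n)%:R ^+ (2 * m + 2) * (high_degree k M)%:R) <= _); last first.
  rewrite ExD !ExZ lerD2l ler_wpM2l ?exprn_ge0 //; exact: Ex_high_degree.
apply: ler_Ex => // M.
have X0 i : 0 <= (X M ^+ (2 * m)) i i by exact: sqr_exp_diag_ge0.
have tr0 : 0 <= \tr (X M ^+ (2 * m)) by apply: sumr_ge0.
have [bad|/norP[]] := boolP (high_degree k M).
  apply: le_trans (sum_mxtrace_dilation_le (K := (2 * n)%:R) X0 _ _) _.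
  - move=> x; apply: le_trans (_ : \sum_(y < n) 2 <= _); last first.
      by rewrite sumr_const card_ord natrM mulr_natr.
    apply: ler_sum => y _; case/andP: (p01 (x, y)) => _.
    by case: (M (_, _)) => /=; lra.
  - move=> x; apply: le_trans (_ : \sum_(y < n) 2 <= _); last first.
      by rewrite sumr_const card_ord natrM mulr_natr.
    apply: ler_sum => y _; case/andP: (p01 (y, x)) => _.
    by case: (M (_, _)) => /=; lra.
  rewrite mulr1 -[leLHS]add0r lerD ?mulr_ge0 ?addr_ge0 //.
  by rewrite (addnS _ 1) exprS ler_wpM2l.
rewrite !negb_exists => /forallP hr /forallP hc.
rewrite mulr0 addr0; apply: sum_mxtrace_dilation_le => // x.
  rewrite big_split lerD // -natr_sum ler_nat ltnW //.
  by have := hr x; rewrite -ltnNge.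
rewrite big_split lerD // -natr_sum ler_nat ltnW //.
by have := hc x; rewrite -ltnNge.
Qed.

(** The last hypothesis keeps the additive error of each recursion step below 1. The main term is at
    least 1, so doubling the factor [B] absorbs the error. *)
Theorem trace_moment_le k q : (0 < n)%N -> 0 <= d -> 1 <= (2 * q)%:R * (k%:R + d) ->
  (2 * q)%:R * (2 * n)%:R ^+ (2 * q) * ((2 * n)%:R * (expR d / 2 ^+ k)) <= 1 ->
  Ex p (fun M => \tr (X M ^+ (2 * q)))
  <= (2 * n)%:R * (2 * ((2 * q)%:R * (k%:R + d))) ^+ q.
Proof.
move=> n0 d0; set B := (_ * (k%:R + d)) => B1 small.
suff H m : (m <= q)%N -> Ex p (fun M => \tr (X M ^+ (2 * m)))
    <= (2 * n)%:R * (2 * B) ^+ m by exact: H.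
have n1 : 1 <= (2 * n)%:R :> R by rewrite ler1n muln_gt0.
elim: m => [_|m IH mq].
  rewrite expr0 mulr1 -[leRHS](Ex_cst p) le_eqVlt; apply/orP; left; apply/eqP.
  by apply: eq_Ex => M; rewrite muln0 expr0 mxtrace1 addnn mul2n.
apply: le_trans (trace_moment_recursion k m d0) _; rewrite mulrDr.
have IH' := IH (ltnW mq).
have B2 : 1 <= 2 * B by lra.
apply: le_trans (_ : B * ((2 * n)%:R * (2 * B) ^+ m) + 1 <= _).
  apply: lerD.
    rewrite mulrA; apply: ler_pM => //.
    - by rewrite !mulr_ge0 ?addr_ge0.
    - by apply: Ex_ge0 => // M; apply: sumr_ge0 => i _; apply: sqr_exp_diag_ge0;
        apply: centered_sum_sym; exact: dilation_unit_sym.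
    - by rewrite ler_wpM2r ?addr_ge0 // ler_nat; lia.
  apply: le_trans small; rewrite mulrA; apply: ler_wpM2r.
    by rewrite mulr_ge0 // divr_ge0 ?expR_ge0 ?exprn_ge0.
  apply: ler_pM => //; first by rewrite ler_nat; lia.
  by rewrite ler_weXn2l //; lia.
have : 1 <= B * ((2 * n)%:R * (2 * B) ^+ m).
  by rewrite mulr_ege1 // mulr_ege1 // exprn_ege1.
rewrite exprS; lra.
Qed.

Theorem noise_opnorm_tail k q t : (0 < n)%N -> 0 <= d -> 0 < t ->
  1 <= (2 * q.+1)%:R * (k%:R + d) ->
  (2 * q.+1)%:R * (2 * n)%:R ^+ (2 * q.+1) * ((2 * n)%:R * (expR d / 2 ^+ k)) <= 1 ->
  Ex p (fun M => (~~ `[< opnorm_le (noise M) t >])%:R)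
  <= (2 * n)%:R * (2 * ((2 * q.+1)%:R * (k%:R + d)) / t ^+ 2) ^+ q.+1.
Proof.
move=> n0 d0 t0 h1 h2; have := trace_moment_le n0 d0 h1 h2.
move=> h; rewrite expr_div_n -exprM [leRHS]mulrA ler_pdivlMr ?exprn_gt0 // mulrC -ExZ.
apply: le_trans h; apply: ler_Ex => // M.
have XT : (X M)^T = X M by apply: centered_sum_sym; exact: dilation_unit_sym.
have tr0 : 0 <= \tr (X M ^+ (2 * q.+1)).
  by apply: sumr_ge0 => i _; exact: sqr_exp_diag_ge0.
case: asboolP => /= [_|]; first by rewrite mulr0.
move=> /existsNP [u /negP]; rewrite -ltNge mulr1 => hu.
have u0 : 0 < nrm u.
  rewrite nrm_gt0; apply: contraTneq hu => ->.
  by rewrite mulmx0 (_ : nrm 0 = 0) ?mulr0 ?ltxx //; apply/eqP; rewrite nrm_eq0.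
have nrmcol (a b : 'cV[R]_n) : nrm (col_mx a b) = Num.sqrt (dot a a + dot b b).
  rewrite /nrm /dot big_split_ord /=; congr (Num.sqrt (_ + _)).
    by apply: eq_bigr => i _; rewrite col_mxEu.
  by apply: eq_bigr => i _; rewrite col_mxEd.
have dot0 : dot (0 : 'cV[R]_n) 0 = 0 by apply/eqP; rewrite dot_eq0.
(* The dilation sends (0, u) to (H u, 0), so a vector violating the bound for the noise violates it
   for the symmetric matrix too. *)
have := nrm_exp_le_mxtrace (col_mx 0 u) q XT.
rewrite {1}/X centered_sum_dilation mul_block_col !mul0mx mulmx0 add0r addr0.
rewrite !nrmcol dot0 addr0 add0r -/(nrm _) -/(nrm u) => hq.
rewrite -(ler_pM2r (_ : 0 < nrm u ^+ (2 * q.+1))) ?exprn_gt0 //.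
apply: le_trans hq; rewrite -exprMn ler_pXn2r ?nnegrE ?nrm_ge0 ?mulr_ge0 //.
- by rewrite ltW.
- by rewrite ltW.
- by rewrite nrm_ge0.
Qed.

End OperatorNorm.

(** * Perron eigenvalue of a perturbed rank-one matrix *)

Section Perturbation.
Variable R : realType.

Lemma char_poly_horner n (A : 'M[R]_n) t : (char_poly A).[t] = \det (t%:M - A).
Proof.
rewrite /char_poly -horner_evalE -det_map_mx; congr (\det _).
apply/matrixP => i j; rewrite !mxE /= horner_evalE.
by rewrite hornerD hornerN hornerC hornerMn hornerX.
Qed.

Lemma monic_root_ge (q : {poly R}) t : q \is monic -> q.[t] <= 0 ->
  exists2 z, t <= z & root q z.
Proof.
move=> qm qt; have [T hT] := monic_Cauchy_bound qm.
pose b := Num.max t T; have tb : t <= b by rewrite le_max lexx.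
have qb : 0 < q.[b] by apply: hT; rewrite le_max lexx orbT.
have [|z /andP[tz _] rz] := @poly_ivt _ q t b tb; first by rewrite qt ltW.
by exists z.
Qed.

(** Matrix determinant lemma, by factoring one bordered matrix through each of its two Schur
    complements. *)
Lemma det_sub_rank1 n (M : 'M[R]_n) (a b : 'cV[R]_n) : M \in unitmx ->
  \det (M - a *m b^T) = \det M * (1 - dot b (invmx M *m a)).
Proof.
move=> Mu.
pose B := block_mx M a b^T (1 : 'M[R]_1).
have d1 : \det B = \det (M - a *m b^T).
  have -> : B = block_mx 1%:M a 0 1%:M *m block_mx (M - a *m b^T) 0 b^T 1%:M.
    by rewrite mulmx_block !mul1mx !mulmx1 !mul0mx !add0r ?mulmx0 subrK ?addr0.
  by rewrite det_mulmx det_ublock det_lblock !det1 !mul1r mulr1.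
have d2 : \det B = \det M * (1 - dot b (invmx M *m a)).
  have -> : B = block_mx M 0 b^T 1%:M *m
       block_mx 1%:M (invmx M *m a) 0 (1%:M - b^T *m (invmx M *m a)).
    rewrite mulmx_block !mul1mx !mulmx1 !mul0mx !addr0 !mulmxA.
    by rewrite mulmxV // mul1mx ?mulmx0 ?addr0 addrCA subrr addr0.
  rewrite det_mulmx det_ublock det_lblock !det1 mul1r mulr1; congr (_ * _).
  rewrite det_mx11 !mxE eqxx; congr (_ - _); apply: eq_bigr => i _.
  by rewrite !mxE.
by rewrite -d1.
Qed.

Lemma right_eigenvector n (A : 'M[R]_n) z : root (char_poly A) z ->
  exists2 u : 'cV[R]_n, u != 0 & A *m u = z *: u.
Proof.
rewrite /root char_poly_horner -det_tr => /det0P [v v0 hv].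
exists v^T; first by rewrite -(inj_eq trmx_inj) trmxK trmx0.
apply: trmx_inj; move: hv.
rewrite linearB /= tr_scalar_mx mulmxBr => /eqP; rewrite subr_eq0 => /eqP hv.
by rewrite trmx_mul trmxK linearZ /= trmxK -hv mul_mx_scalar.
Qed.

Section RankOne.
Variables (n : nat) (alpha eps Gam : R) (a b : 'cV[R]_n).
Let S0 := dot a b.
Let lam := alpha * S0.
Hypotheses (alpha0 : 0 < alpha) (S00 : 0 < S0) (eps0 : 0 <= eps).
(** [Gam] bounds the inverse cosine of the angle between [a] and [b]; it converts errors measured by
    |a| |b| into errors relative to S0. The constant 48 below keeps the later deviations of inner
    products from S0 at S0 / 12 in [large_root] and at S0 / 4 in [eigenvalue_unit_perturb]. *)
Hypothesis geom : nrm a * nrm b <= Gam * S0.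
Hypothesis small : 48 * eps * Gam <= 1.

Definition rank1_plus (H : 'M[R]_n) : 'M[R]_n := alpha *: (a *m b^T) + H.

Let Gam1 : 1 <= Gam.
Proof.
rewrite -(ler_pM2r S00) mul1r; apply: le_trans geom.
by apply: le_trans (ler_norm _) _; exact: dot_le_nrm.
Qed.

Let eps_small : 48 * eps <= 1.
Proof. by apply: le_trans small; rewrite ler_peMr // mulr_ge0. Qed.

Let lam0 : 0 < lam. Proof. by rewrite mulr_gt0. Qed.

Lemma rank1_mulmx (H : 'M[R]_n) u :
  rank1_plus H *m u = (alpha * dot b u) *: a + H *m u.
Proof.
rewrite mulmxDl -scalemxAl -scalerA -mulmxA; congr (_ *: _ + _).
apply/matrixP => i j; rewrite ord1 !mxE big_ord1 mulrC; congr (_ * _).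
by rewrite mxE; apply: eq_bigr => k _; rewrite mxE.
Qed.

(** [U] is the resolvent vector (1 - H / t)^-1 a, and H / t has norm at most 2 eps. Phrased as a
    fixed-point equation, the bound applies both to the vector in the determinant formula and to
    normalized eigenvectors. *)
Lemma resolvent_approx (H : 'M[R]_n) t U : opnorm_le H (eps * lam) ->
  lam / 2 <= t -> U = a + t^-1 *: (H *m U) ->
  nrm U <= 2 * nrm a /\ nrm (U - a) <= 4 * eps * nrm a.
Proof.
move=> hH ht hU; have t0 : 0 < t by apply: lt_le_trans ht; rewrite divr_gt0.
have d : nrm (U - a) <= 2 * eps * nrm U.
  rewrite {1}hU addrC addKr nrmZ gtr0_norm ?invr_gt0 // mulrC ler_pdivrMr //.
  apply: le_trans (hH U) _; rewrite [leRHS]mulrAC ler_wpM2r ?nrm_ge0 //.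
  by have := ler_wpM2l eps0 ht; lra.
have h : nrm U <= nrm a + nrm (U - a).
  by rewrite -{1}(subrK a U) addrC; exact: nrmD.
have U0 := nrm_ge0 U; have a0 := nrm_ge0 a.
have e1 : eps * nrm U <= 48^-1 * nrm U by rewrite ler_wpM2r //; have := eps_small; lra.
have U2 : nrm U <= 2 * nrm a by lra.
split=> //; have := ler_wpM2l eps0 U2; lra.
Qed.

Lemma no_large_eigenvector (H : 'M[R]_n) t (u : 'cV[R]_n) : opnorm_le H (eps * lam) ->
  lam / 2 <= t -> H *m u = t *: u -> u = 0.
Proof.
move=> hH ht hu; apply/eqP; rewrite -nrm_eq0; apply/negPn/negP => u0.
have up : 0 < nrm u by rewrite lt_def u0 nrm_ge0.
have t0 : 0 < t by apply: lt_le_trans ht; rewrite divr_gt0.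
have := hH u; rewrite hu nrmZ gtr0_norm // ler_pM2r // => h.
have := lam0; have : eps * lam <= 48^-1 * lam
  by apply: ler_wpM2r; [exact: ltW | have := eps_small; lra].
lra.
Qed.

(* The characteristic polynomial of H is positive at lam / 2, while the rank-one
   determinant formula makes that of the perturbed matrix non-positive there. *)
Lemma large_root (H : 'M[R]_n) : opnorm_le H (eps * lam) ->
  exists2 z, lam / 2 <= z & root (char_poly (rank1_plus H)) z.
Proof.
move=> hH; set t := lam / 2.
have t0 : 0 < t by rewrite divr_gt0.
have noroot s : t <= s -> ~~ root (char_poly H) s.
  move=> ts; apply/negP => /right_eigenvector[u /eqP u0 hu]; apply: u0.
  exact: no_large_eigenvector hH ts hu.
have detH : 0 < \det (t%:M - H).
  rewrite -char_poly_horner ltNge; apply/negP.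
  by move=> /(monic_root_ge (char_poly_monic H))[s /noroot/negP].
have Mu : t%:M - H \in unitmx by rewrite unitmxE unitfE gt_eqF.
apply: monic_root_ge; first exact: char_poly_monic.
rewrite char_poly_horner /rank1_plus opprD addrCA addrC scalemxAl.
rewrite det_sub_rank1 // pmulr_rle0 //.
rewrite -scalemxAr dotZr; set y := invmx _ *m a.
(* Hence t <b, y> is within S0 / 12 of S0, and alpha <b, y> is at least 2 * 11 / 12 > 1 at t = lam /
   2: the rank-one factor of the determinant is negative. *)
have hy : t *: y = a + t^-1 *: (H *m (t *: y)).
  rewrite -scalemxAr scalerA mulVf ?gt_eqF // scale1r.
  apply/eqP; rewrite -subr_eq -mul_scalar_mx -mulmxBl /y mulmxA mulmxV //.
  by rewrite mul1mx.
have [_ ya] := resolvent_approx hH (lexx _) hy.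
have : `|dot b (t *: y - a)| <= S0 / 12.
  apply: le_trans (dot_le_nrm _ _) _.
  apply: le_trans (ler_wpM2l (nrm_ge0 b) ya) _.
  rewrite mulrCA [nrm b * _]mulrC.
  apply: le_trans (ler_wpM2l _ geom) _; first by rewrite mulr_ge0.
  by have := ler_wpM2r (ltW S00) small; lra.
rewrite dotBr [dot b a]dotC -/S0 dotZr ler_norml => /andP[h _].
have : alpha * (S0 * (11 / 12)) <= alpha * (t * dot b y).
  by rewrite ler_pM2l //; lra.
rewrite mulrCA -(ler_pM2l t0) mulr0 mulrBr mulr1 /t /lam; have := lam0; rewrite /lam.
lra.
Qed.

(* The normalization is alpha <b, U> = z, which makes U a perturbation of a. *)
Lemma normalized_right_eigenvector (H : 'M[R]_n) z : opnorm_le H (eps * lam) ->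
  lam / 2 <= z -> root (char_poly (rank1_plus H)) z ->
  exists U, rank1_plus H *m U = z *: U /\ U = a + z^-1 *: (H *m U).
Proof.
move=> hH hz /right_eigenvector [u u0 hu].
have z0 : 0 < z by apply: lt_le_trans hz; rewrite divr_gt0.
(* Otherwise the rank-one part would kill [u], making it an eigenvector of [H] alone for too large
   an eigenvalue. *)
have bu : dot b u != 0.
  apply: contraNneq u0 => bu; apply/eqP; apply: (no_large_eigenvector hH hz).
  by rewrite -hu rank1_mulmx bu mulr0 scale0r add0r.
have c0 : alpha * dot b u != 0 by rewrite mulf_neq0 // gt_eqF.
exists ((z / (alpha * dot b u)) *: u); split.
  by rewrite -scalemxAr hu !scalerA mulrC.
rewrite -scalemxAr scalerA mulrA mulVf ?gt_eqF // mul1r.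
have -> : H *m u = z *: u - (alpha * dot b u) *: a.
  by rewrite -hu rank1_mulmx addrC addKr.
by rewrite scalerBr !scalerA mulVf // scale1r addrC subrK mulrC.
Qed.

(** Both causes of change, the unit matrix applied to [U1] and the shift of the eigenvalue, are
    proportional to the coordinate [U1 y 0]. The bound is therefore relative to this coordinate and
    gains a factor 1 / lam. *)
Lemma opnorm_le_unit_perturb_diff (H : 'M[R]_n) z0 z1 U0 U1 (V0 : 'cV[R]_n) x y :
  opnorm_le H (eps * lam) -> lam / 2 <= z0 -> lam / 2 <= z1 ->
  U0 = a + z0^-1 *: (H *m U0) ->
  U1 = a + z1^-1 *: ((H + delta_mx x y) *m U1) ->
  nrm V0 <= 2 * nrm b -> S0 / 2 <= dot V0 U1 ->
  z1 - z0 = V0 x 0 * U1 y 0 / dot V0 U1 ->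
  `|U1 y 0 - U0 y 0| <= (16 * Gam + 4) / lam * `|U1 y 0|.
Proof.
move=> hH hz0 hz1 hU0 hU1 hV0 hS hD.
have z0p : 0 < z0 by apply: lt_le_trans hz0; rewrite divr_gt0.
have z1p : 0 < z1 by apply: lt_le_trans hz1; rewrite divr_gt0.
set d := U1 - U0; set w := U1 y 0.
have dE : d = z1^-1 *: (H *m d) + (z1^-1 - z0^-1) *: (H *m U0)
              + (z1^-1 * w) *: delta_mx x 0.
  rewrite /d {1}hU1 {1}hU0 mulmxDl delta_mulmx mulmxBr.
  rewrite opprD addrACA subrr add0r.
  rewrite scalerDr scalerA -/w scalerBr scalerBl.
  by rewrite addrAC; congr (_ + _); rewrite addrA subrK.
have [_ hUa] := resolvent_approx hH hz0 hU0.
have HU0 : z0^-1 * nrm (H *m U0) <= nrm a.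
  have -> : z0^-1 * nrm (H *m U0) = nrm (U0 - a).
    by rewrite {2}hU0 addrC addKr nrmZ gtr0_norm ?invr_gt0.
  apply: le_trans hUa _; rewrite -[leRHS]mul1r ler_wpM2r ?nrm_ge0 //.
  have := eps_small; lra.
have Sp : 0 < dot V0 U1 by apply: lt_le_trans hS; rewrite divr_gt0.
have D : `|z1 - z0| <= 4 * nrm b * `|w| / S0.
  rewrite hD normrM normfV (gtr0_norm Sp) normrM ler_pdivrMr // mulrAC.
  rewrite ler_pdivlMr // -mulrA [leRHS]mulrAC.
  have c1 := coord_le_nrm V0 x; have w0 := normr_ge0 w; have b0 := nrm_ge0 b.
  apply: le_trans (_ : 2 * nrm b * (`|w| * S0) <= _).
    rewrite -[leLHS]mulrA -/w; apply: ler_wpM2r; last exact: le_trans c1 hV0.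
    by rewrite mulr_ge0 // ltW.
  rewrite [leRHS]mulrAC mulrA.
  have : 0 <= nrm b * `|w| by rewrite mulr_ge0.
  move=> bw; have := ler_wpM2l bw hS; lra.
have t2 : nrm ((z1^-1 - z0^-1) *: (H *m U0)) <= z1^-1 * (4 * Gam * `|w|).
  have -> : z1^-1 - z0^-1 = - (z1^-1 * ((z1 - z0) * z0^-1)).
    by field; rewrite ?gt_eqF.
  rewrite nrmZ normrN !normrM !normfV (gtr0_norm z1p) (gtr0_norm z0p) -!mulrA.
  rewrite ler_pM2l ?invr_gt0 //; apply: le_trans (ler_pM _ _ D HU0) _ => //.
    by rewrite mulr_ge0 ?nrm_ge0 // invr_ge0 ltW.
  rewrite mulrAC ler_pdivrMr //.
  have := ler_wpM2l (_ : 0 <= 4 * `|w|) geom; rewrite mulr_ge0 // => /(_ isT); lra.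
have t3 : nrm ((z1^-1 * w) *: delta_mx x 0) <= z1^-1 * `|w|.
  by rewrite nrmZ nrm_delta mulr1 normrM gtr0_norm ?invr_gt0.
have t1 : nrm (z1^-1 *: (H *m d)) <= nrm d / 2.
  rewrite nrmZ gtr0_norm ?invr_gt0 // mulrC ler_pdivrMr //.
  apply: le_trans (hH d) _; rewrite mulrC [leRHS]mulrAC -mulrA.
  rewrite ler_wpM2l ?nrm_ge0 //.
  have := ler_wpM2r (ltW lam0) eps_small; lra.
(* Absorbing [nrm d / 2] doubles the other terms, and z1 >= lam / 2 doubles them again; this
   produces 16 Gam + 4. *)
have hd : nrm d <= nrm d / 2 + z1^-1 * (4 * Gam * `|w|) + z1^-1 * `|w|.
  rewrite {1}dE; apply: le_trans (nrmD _ _) _; apply: lerD t3.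
  by apply: le_trans (nrmD _ _) _; exact: lerD.
have : nrm d <= z1^-1 * ((8 * Gam + 2) * `|w|) by lra.
have -> : U1 y 0 - U0 y 0 = d y 0 by rewrite !mxE.
move=> h; apply: le_trans (coord_le_nrm _ _) _; apply: le_trans h _.
rewrite mulrA ler_wpM2r // mulrC ler_pdivrMr // mulrAC ler_pdivlMr //.
have g0 : 0 <= 8 * Gam + 2 by have := Gam1; lra.
have := ler_wpM2l g0 hz1; lra.
Qed.

End RankOne.
End Perturbation.

Section Lambda1.
Variable R : realType.

Lemma Re_sum (I : Type) (r : seq I) (P : pred I) (F : I -> R[i]) :
  complex.Re (\sum_(i <- r | P i) F i) = \sum_(i <- r | P i) complex.Re (F i).
Proof. by apply: (big_morph (@complex.Re R)) => // -[? ?] [? ?]. Qed.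

Lemma Im_sum (I : Type) (r : seq I) (P : pred I) (F : I -> R[i]) :
  complex.Im (\sum_(i <- r | P i) F i) = \sum_(i <- r | P i) complex.Im (F i).
Proof. by apply: (big_morph (@complex.Im R)) => // -[? ?] [? ?]. Qed.

Variable n : nat.

(** A complex eigenvector is handled as two real vectors, so that real operator norm bounds apply to
    it. Rows become columns, and [A] becomes its transpose, because [eigenvalue] refers to row
    vectors. *)
Definition Re_col (v : 'rV[R[i]]_n) : 'cV[R]_n := \col_i complex.Re (v 0 i).
Definition Im_col (v : 'rV[R[i]]_n) : 'cV[R]_n := \col_i complex.Im (v 0 i).

Let toC (A : 'M[R]_n) := map_mx (real_complex R) A.

Lemma Re_col_mulmx v A : Re_col (v *m toC A) = A^T *m Re_col v.
Proof.
apply/matrixP => j k; rewrite !mxE Re_sum; apply: eq_bigr => i _.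
by rewrite !mxE; case: (v 0 i) => x y /=; rewrite mulr0 subr0 mulrC.
Qed.

Lemma Im_col_mulmx v A : Im_col (v *m toC A) = A^T *m Im_col v.
Proof.
apply/matrixP => j k; rewrite !mxE Im_sum; apply: eq_bigr => i _.
by rewrite !mxE; case: (v 0 i) => x y /=; rewrite mulr0 add0r mulrC.
Qed.

Lemma nrm_scale_complex (w : R[i]) v :
  nrm (Re_col (w *: v)) ^+ 2 + nrm (Im_col (w *: v)) ^+ 2
  = (complex.Re w ^+ 2 + complex.Im w ^+ 2)
    * (nrm (Re_col v) ^+ 2 + nrm (Im_col v) ^+ 2).
Proof.
rewrite !sqr_nrm /dot -!big_split mulr_sumr; apply: eq_bigr => i _.
rewrite !mxE; case: w (v 0 i) => a b [c d] /=; ring.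
Qed.

Lemma Re_Im_col_eq0 v : Re_col v = 0 -> Im_col v = 0 -> v = 0.
Proof.
move=> /matrixP hr /matrixP hi; apply/matrixP => j i; rewrite ord1.
have := hr i 0; have := hi i 0; rewrite !mxE.
by case: (v 0 i) => a b /= -> ->.
Qed.

Lemma normc_lt (w : R[i]) (z : R) : 0 <= z ->
  complex.Re w ^+ 2 + complex.Im w ^+ 2 < z ^+ 2 -> `|w| < `|z%:C|.
Proof.
move=> z0 h; rewrite !normc_def ltcR /= expr0n addr0 ltr_sqrt //.
by apply: le_lt_trans h; rewrite addr_ge0 ?sqr_ge0.
Qed.

(* A left eigenvector for an eigenvalue other than z is orthogonal to U, and A^T
   contracts the orthogonal complement of U. *)
Lemma lambda1_dominant (A : 'M[R]_n) z (U : 'cV[R]_n) k :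
  U != 0 -> A *m U = z *: U -> 0 <= k < z ->
  (forall P, dot P U = 0 -> nrm (A^T *m P) <= k * nrm P) ->
  lambda1 (toC A) = z%:C.
Proof.
move=> U0 AU /andP[k0 kz] contr; have z0 : 0 <= z by rewrite (le_trans k0) ?ltW.
have zeig : eigenvalue (toC A) z%:C.
  rewrite eigenvalue_root_char -map_char_poly fmorph_root /root char_poly_horner.
  rewrite -det_tr; apply/det0P; exists U^T; first by rewrite -trmx0 (inj_eq trmx_inj).
  by rewrite -trmx_mul mulmxBl mul_scalar_mx AU subrr trmx0.
have others w : eigenvalue (toC A) w -> w = z%:C \/ `|w| < `|z%:C|.
  move=> /eigenvalueP [v hv v0]; have [|wz] := eqVneq w z%:C; [by left|right].
  have vU : v *m map_mx (real_complex R) U = 0.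
    have : w *: (v *m map_mx (real_complex R) U) = z%:C *: (v *m map_mx (real_complex R) U).
      rewrite scalemxAl -hv -mulmxA -map_mxM AU map_mxZ -scalemxAr //.
    move/eqP; rewrite -subr_eq0 -scalerBl scaler_eq0 subr_eq0 (negbTE wz) /=.
    by move/eqP.
  have hP : dot (Re_col v) U = 0.
    transitivity (complex.Re ((v *m map_mx (real_complex R) U) 0 0)); last by rewrite vU mxE.
    rewrite mxE Re_sum; apply: eq_bigr => i _; rewrite !mxE.
    by case: (v 0 i) => a b /=; rewrite mulr0 subr0.
  have hQ : dot (Im_col v) U = 0.
    transitivity (complex.Im ((v *m map_mx (real_complex R) U) 0 0)); last by rewrite vU mxE.
    rewrite mxE Im_sum; apply: eq_bigr => i _; rewrite !mxE.
    by case: (v 0 i) => a b /=; rewrite mulr0 add0r.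
  apply: normc_lt => //; have := nrm_scale_complex w v.
  rewrite -hv Re_col_mulmx Im_col_mulmx; set W := (_ + _ in RHS).
  set N := (_ + _ in X in _ = _ * X) => E.
  have N0 : 0 < N.
    rewrite lt_def addr_ge0 ?sqr_ge0 // andbT paddr_eq0 ?sqr_ge0 //.
    rewrite !sqrf_eq0 !nrm_eq0; apply: contraNN v0 => /andP[/eqP h1 /eqP h2].
    by rewrite (Re_Im_col_eq0 h1 h2).
  suff : W * N <= k ^+ 2 * N.
    rewrite ler_pM2r // => h; apply: le_lt_trans h _.
    by rewrite ltr_pXn2r // nnegrE.
  rewrite -E mulrDr -!exprMn.
  by rewrite lerD // lerXn2r ?nnegrE ?mulr_ge0 ?nrm_ge0 // contr.
have zl : is_lambda1 (toC A) z%:C.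
  split=> // w /others[->|wz]; first by split.
  by split; [exact: ltW | move=> E; move: wz; rewrite E ltxx].
rewrite /lambda1; case: xgetP => [y _ [/others[//|yz] /(_ _ zeig)[zy _]]|/(_ _ zl)//].
by have := le_lt_trans zy yz; rewrite ltxx.
Qed.

End Lambda1.

Section PerronData.
Variable R : realType.

Lemma root_char_poly_tr n (A : 'M[R]_n) z :
  root (char_poly A^T) z = root (char_poly A) z.
Proof.
by rewrite /root !char_poly_horner -det_tr linearB /= tr_scalar_mx trmxK.
Qed.

Lemma rank1_plus_tr n alpha (a b : 'cV[R]_n) H :
  (rank1_plus alpha a b H)^T = rank1_plus alpha b a H^T.
Proof. by rewrite /rank1_plus linearD linearZ /= trmx_mul trmxK. Qed.

(** The fixed-point equations encode the normalizations of [U] and [V]. Transposing [H] exchanges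
    (a, U) with (b, V), so estimates for [U] carry over to [V]. *)
Definition perron_data n alpha (a b : 'cV[R]_n) (H : 'M[R]_n) z (U V : 'cV[R]_n) :=
  [/\ alpha * dot a b / 2 <= z,
      rank1_plus alpha a b H *m U = z *: U, U = a + z^-1 *: (H *m U),
      rank1_plus alpha b a H^T *m V = z *: V & V = b + z^-1 *: (H^T *m V)].

Lemma perron_data_tr n alpha (a b : 'cV[R]_n) H z U V :
  perron_data alpha a b H z U V -> perron_data alpha b a H^T z V U.
Proof. by case=> h1 h2 h3 h4 h5; split; rewrite ?trmxK // dotC. Qed.

Section Fixed.
Variables (n : nat) (alpha eps Gam : R) (a b : 'cV[R]_n).
Let S0 := dot a b.
Let lam := alpha * S0.
Hypotheses (alpha0 : 0 < alpha) (S00 : 0 < S0) (eps0 : 0 <= eps).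
Hypothesis geom : nrm a * nrm b <= Gam * S0.
Hypothesis small : 48 * eps * Gam <= 1.

Let lam0 : 0 < lam. Proof. by rewrite mulr_gt0. Qed.

Let geom' : nrm b * nrm a <= Gam * dot b a. Proof. by rewrite mulrC dotC. Qed.
Let S00' : 0 < dot b a. Proof. by rewrite dotC. Qed.

Let Gam1 : 1 <= Gam.
Proof.
rewrite -(ler_pM2r S00) mul1r; apply: le_trans geom.
by apply: le_trans (ler_norm _) _; exact: dot_le_nrm.
Qed.

Let eps_small : 48 * eps <= 1.
Proof. by apply: le_trans small; rewrite ler_peMr // mulr_ge0. Qed.

Let opnorm_tr (H : 'M[R]_n) : opnorm_le H (eps * lam) -> opnorm_le H^T (eps * (alpha * dot b a)).
Proof. by rewrite dotC; apply: opnorm_le_tr; rewrite mulr_ge0 // ltW. Qed.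

Lemma perron_data_exists H : opnorm_le H (eps * lam) ->
  exists z U V, perron_data alpha a b H z U V.
Proof.
move=> hH; have [z hz rz] := large_root alpha0 S00 eps0 geom small hH.
have [U [hU1 hU2]] := normalized_right_eigenvector alpha0 S00 eps0 geom small hH hz rz.
have hz' : alpha * dot b a / 2 <= z by rewrite dotC.
have rz' : root (char_poly (rank1_plus alpha b a H^T)) z.
  by rewrite -rank1_plus_tr root_char_poly_tr.
have [V [hV1 hV2]] := normalized_right_eigenvector alpha0 S00' eps0 geom' small
  (opnorm_tr hH) hz' rz'.
by exists z, U, V; split.
Qed.

Lemma perron_data_right H z U V : opnorm_le H (eps * lam) ->
  perron_data alpha a b H z U V ->
  nrm U <= 2 * nrm a /\ nrm (U - a) <= 4 * eps * nrm a.
Proof. by move=> hH [hz _ hU _ _]; apply: (resolvent_approx _ _ _ geom small hH hz hU). Qed.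

Lemma perron_data_left H z U V : opnorm_le H (eps * lam) ->
  perron_data alpha a b H z U V ->
  nrm V <= 2 * nrm b /\ nrm (V - b) <= 4 * eps * nrm b.
Proof.
move=> hH [hz _ _ _ hV]; have hz' : alpha * dot b a / 2 <= z by rewrite dotC.
exact: (resolvent_approx _ _ _ geom' small (opnorm_tr hH) hz' hV).
Qed.

Lemma dot_perturb_le (c e : R) (U V : 'cV[R]_n) : 0 <= c -> c * Gam <= e ->
  nrm U * nrm V <= c * (nrm a * nrm b) -> `|dot U V| <= e * S0.
Proof.
move=> c0 ce h; apply: le_trans (dot_le_nrm _ _) _; apply: le_trans h _.
apply: le_trans (ler_wpM2l c0 geom) _; rewrite mulrA ler_wpM2r //; exact: ltW.
Qed.

(** For P orthogonal to U one has <a, P> = - <P, U - a>, so the transposed rank-one part nearly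
    annihilates P. The contraction factor stays below lam / 2 <= z. *)
Lemma perron_lambda1 H z U V : opnorm_le H (eps * lam) ->
  perron_data alpha a b H z U V ->
  lambda1 (map_mx (real_complex R) (rank1_plus alpha a b H)) = z%:C.
Proof.
move=> hH hp; have [U2 Ua] := perron_data_right hH hp.
have a0 : 0 < nrm a.
  rewrite nrm_gt0; apply/eqP => E; move: S00.
  by rewrite /S0 E /dot big1 ?ltxx // => i _; rewrite mxE mul0r.
have U0 : U != 0.
  rewrite -nrm_gt0; have := nrmD (U - a) (- U).
  rewrite addrAC subrr add0r !nrmN.
  have := ler_wpM2r (nrm_ge0 a) eps_small; lra.
case: hp => hz AU _ _ _.
apply: (@lambda1_dominant _ _ _ _ _ ((4 * eps * Gam + eps) * lam) U0 AU).
  apply/andP; split.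
    have G0 : 0 <= Gam := le_trans ler01 Gam1.
    by apply: mulr_ge0; [rewrite addr_ge0 // !mulr_ge0 | exact: ltW].
  apply: lt_le_trans hz; rewrite -/S0 -/lam mulrC ltr_pM2l //.
  have := eps_small; have := small; lra.
move=> P PU; rewrite rank1_plus_tr rank1_mulmx.
apply: le_trans (nrmD _ _) _; rewrite !mulrDl; apply: lerD; last first.
  by apply: opnorm_le_tr => //; rewrite mulr_ge0 // ltW.
have -> : dot a P = - dot P (U - a) by rewrite dotBr PU dotC sub0r opprK.
rewrite nrmZ normrM normrN (gtr0_norm alpha0).
have h : `|dot P (U - a)| <= nrm P * (4 * eps * nrm a).
  by apply: le_trans (dot_le_nrm _ _) _; rewrite ler_wpM2l ?nrm_ge0.
apply: le_trans (_ : alpha * (nrm P * (4 * eps * nrm a)) * nrm b <= _).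
  by rewrite ler_wpM2r ?nrm_ge0 // ler_wpM2l // ltW.
rewrite (_ : _ * nrm b = (4 * eps * alpha * nrm P) * (nrm a * nrm b)); last by ring.
rewrite [leRHS](_ : _ = (4 * eps * alpha * nrm P) * (Gam * S0)); last first.
  by rewrite /lam; ring.
by rewrite ler_wpM2l // !mulr_ge0 ?nrm_ge0 // ltW.
Qed.

(** With A0 and A1 the matrices before and after, evaluate V0^T A1 U1 in two ways: A1 multiplies U1
    by z1, while A1 = A0 + delta_mx x y and A0^T multiplies V0 by z0. Mixing the left vector of one
    matrix with the right vector of the other makes the formula exact. *)
Lemma eigenvalue_unit_perturb H x y z0 U0 V0 z1 U1 V1 :
  opnorm_le H (eps * lam) -> opnorm_le (H + delta_mx x y) (eps * lam) ->
  perron_data alpha a b H z0 U0 V0 ->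
  perron_data alpha a b (H + delta_mx x y) z1 U1 V1 ->
  `|dot V0 U1 - S0| <= 12 * eps * Gam * S0 /\
  z1 - z0 = V0 x 0 * U1 y 0 / dot V0 U1.
Proof.
move=> hH hH' hp0 hp1.
have [U2 Ua] := perron_data_right hH' hp1.
have [V2 Va] := perron_data_left hH hp0.
have e0 : 0 <= eps * Gam by rewrite mulr_ge0 // (le_trans ler01 Gam1).
have hS : `|dot V0 U1 - S0| <= 12 * eps * Gam * S0.
  have -> : dot V0 U1 - S0 = dot (U1 - a) V0 + dot a (V0 - b).
    by rewrite dotBl dotBr [dot a V0]dotC [dot U1 V0]dotC [dot V0 a]dotC /S0; ring.
  apply: le_trans (ler_normD _ _) _.
  rewrite (_ : 12 * _ * _ * _ = (8 * eps * Gam) * S0 + (4 * eps * Gam) * S0); last by ring.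
  apply: lerD.
    apply: (@dot_perturb_le (8 * eps)) => //; first by rewrite mulr_ge0.
    apply: le_trans (ler_pM (nrm_ge0 _) (nrm_ge0 _) Ua V2) _.
    by rewrite le_eqVlt; apply/orP; left; apply/eqP; ring.
  apply: (@dot_perturb_le (4 * eps)) => //; first by rewrite mulr_ge0.
  apply: le_trans (ler_wpM2l (nrm_ge0 _) Va) _.
  by rewrite le_eqVlt; apply/orP; left; apply/eqP; ring.
split=> //.
have Sp : 0 < dot V0 U1.
  have := ler_wpM2r (ltW S00) small; move: hS; rewrite ler_norml => /andP[h _].
  by have := S00; lra.
case: hp0 hp1 => _ _ _ hV _ [_ hU _ _ _].
have h1 : dot V0 (rank1_plus alpha a b (H + delta_mx x y) *m U1) = z1 * dot V0 U1.
  by rewrite hU dotZr.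
have h0 : dot V0 (rank1_plus alpha a b H *m U1) = z0 * dot V0 U1.
  by rewrite -dotC dot_mulmx rank1_plus_tr hV dotZr dotC.
have : rank1_plus alpha a b (H + delta_mx x y) = rank1_plus alpha a b H + delta_mx x y.
  by rewrite /rank1_plus addrA.
move=> E; move: h1; rewrite E mulmxDl dotDr h0 delta_mulmx dotZr.
rewrite [dot V0 (delta_mx _ _)]dotC dot_delta => h1.
apply: (canRL (mulfK _)); first by rewrite gt_eqF.
by rewrite mulrBl -h1 addrC addKr mulrC.
Qed.

End Fixed.

Section Flips.
Variables (n : nat) (alpha eps Gam : R) (a b : 'cV[R]_n).
Let S0 := dot a b.
Let lam := alpha * S0.
Hypotheses (alpha0 : 0 < alpha) (S00 : 0 < S0) (eps0 : 0 <= eps).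
Hypothesis geom : nrm a * nrm b <= Gam * S0.
Hypothesis small : 48 * eps * Gam <= 1.

Let lam0 : 0 < lam. Proof. by rewrite mulr_gt0. Qed.

Let Gam1 : 1 <= Gam.
Proof.
rewrite -(ler_pM2r S00) mul1r; apply: le_trans geom.
by apply: le_trans (ler_norm _) _; exact: dot_le_nrm.
Qed.

Lemma right_perron_coord_diff H x y z0 U0 V0 z1 U1 V1 :
  opnorm_le H (eps * lam) -> opnorm_le (H + delta_mx x y) (eps * lam) ->
  perron_data alpha a b H z0 U0 V0 ->
  perron_data alpha a b (H + delta_mx x y) z1 U1 V1 ->
  `|U1 y 0 - U0 y 0| <= (16 * Gam + 4) / lam * `|U1 y 0|.
Proof.
move=> hH hH' hp0 hp1.
have [hS hz] := eigenvalue_unit_perturb alpha0 S00 eps0 geom small hH hH' hp0 hp1.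
have [V2 _] := perron_data_left alpha0 S00 eps0 geom small hH hp0.
case: (hp0) (hp1) => hz0 _ hU0 _ _ [hz1 _ hU1 _ _].
apply: (opnorm_le_unit_perturb_diff alpha0 S00 eps0 geom small hH hz0 hz1 hU0 hU1 V2) => //.
have := ler_wpM2r (ltW S00) small; move: hS; rewrite ler_norml => /andP[h _].
by rewrite -/S0 in h *; have := S00; lra.
Qed.

End Flips.

Section FlipSum.
Variables (n : nat) (alpha eps Gam : R) (a b : 'cV[R]_n).
Let S0 := dot a b.
Let lam := alpha * S0.
Let theta := (16 * Gam + 4) / lam.
Hypotheses (alpha0 : 0 < alpha) (S00 : 0 < S0) (eps0 : 0 <= eps).
Hypothesis geom : nrm a * nrm b <= Gam * S0.
Hypothesis small : 48 * eps * Gam <= 1.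
Hypothesis theta_small : theta <= 1 / 2.

Let lam0 : 0 < lam. Proof. by rewrite mulr_gt0. Qed.

Let Gam1 : 1 <= Gam.
Proof.
rewrite -(ler_pM2r S00) mul1r; apply: le_trans geom.
by apply: le_trans (ler_norm _) _; exact: dot_le_nrm.
Qed.

Let theta0 : 0 <= theta.
Proof. by rewrite divr_ge0 ?(ltW lam0) //; have := Gam1; lra. Qed.

(* (U, V) is attached to the observed matrix, which is H or H + delta_mx x y according
   to the value of the entry being flipped; the bound has to be in terms of (U, V) to
   be summed over all entries. *)
Lemma flip_diff_le H x y z0 U0 V0 z1 U1 V1 U V :
  opnorm_le H (eps * lam) -> opnorm_le (H + delta_mx x y) (eps * lam) ->
  perron_data alpha a b H z0 U0 V0 ->
  perron_data alpha a b (H + delta_mx x y) z1 U1 V1 ->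
  (U = U0 /\ V = V0) \/ (U = U1 /\ V = V1) ->
  `|z1 - z0 - b x 0 * a y 0 / S0|
  <= S0^-1 * ((4 * theta + 24 * eps * Gam) * `|V x 0 * U y 0|
              + `|V x 0 * U y 0 - b x 0 * a y 0|).
Proof.
move=> hH hH' hp0 hp1 hUV.
have [hS hz] := eigenvalue_unit_perturb alpha0 S00 eps0 geom small hH hH' hp0 hp1.
rewrite -/S0 in hS.
have hU := right_perron_coord_diff alpha0 S00 eps0 geom small hH hH' hp0 hp1.
have hV : `|V1 x 0 - V0 x 0| <= theta * `|V1 x 0|.
  have geom' : nrm b * nrm a <= Gam * dot b a by rewrite mulrC dotC.
  have S00' : 0 < dot b a by rewrite dotC.
  have el : eps * (alpha * dot b a) = eps * lam by rewrite dotC.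
  have e0 : 0 <= eps * lam by rewrite mulr_ge0 // ltW.
  have E : H^T + delta_mx y x = (H + delta_mx x y)^T by rewrite linearD /= trmx_delta.
  have := @right_perron_coord_diff n alpha eps Gam b a alpha0 S00' eps0 geom' small
     H^T y x z0 V0 U0 z1 V1 U1.
  rewrite E el {1}dotC -/S0 -/lam -/theta; apply.
  - exact: opnorm_le_tr.
  - exact: opnorm_le_tr.
  - exact: perron_data_tr.
  - exact: perron_data_tr.
rewrite -/theta in hU.
set w := V x 0 * U y 0; set w1 := V0 x 0 * U1 y 0.
(* [w1] mixes the two states and so differs from [w] in one factor only. When (U, V) belongs to the
   state before, theta <= 1/2 turns a bound relative to [U1] into one relative to [U0]. *)
have hw : `|w1 - w| <= 2 * theta * `|w|.
  case: hUV => -[EU EV]; rewrite /w /w1 EU EV.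
    rewrite -mulrBr !normrM mulrCA ler_wpM2l //; apply: le_trans (hU) _.
    have : `|U1 y 0| <= `|U1 y 0 - U0 y 0| + `|U0 y 0|.
      by rewrite -{1}(subrK (U0 y 0) (U1 y 0)); exact: ler_normD.
    have h1 := ler_wpM2r (normr_ge0 (U1 y 0)) theta_small => h2.
    have : `|U1 y 0| <= 2 * `|U0 y 0| by lra.
    by move=> h3; have := ler_wpM2l theta0 h3; lra.
  rewrite -mulrBl !normrM mulrA ler_wpM2r // distrC; apply: le_trans hV _.
  by rewrite ler_wpM2r //; have := theta0; lra.
set S := dot V0 U1 in hS hz.
have hS2 : S0 / 2 <= S.
  have := ler_wpM2r (ltW S00) small; move: hS; rewrite ler_norml => /andP[h _].
  by have := S00; lra.
have Sp : 0 < S by apply: lt_le_trans hS2; rewrite divr_gt0.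
have iS : S^-1 <= 2 / S0.
  by rewrite -[2 / S0]invf_div lef_pV2 // posrE divr_gt0.
(* Three errors: the coordinate changed by the flip, S in place of S0, and the eigenvectors in place
   of [b] and [a]. *)
have -> : z1 - z0 - b x 0 * a y 0 / S0
  = (w1 - w) / S + (w * ((S0 - S) / (S * S0)) + (w - b x 0 * a y 0) / S0).
  rewrite hz -/w1 -/S; field; by rewrite !gt_eqF.
apply: le_trans (ler_normD _ _) _.
have e1 : `|(w1 - w) / S| <= S0^-1 * (4 * theta * `|w|).
  rewrite normrM normfV (gtr0_norm Sp).
  apply: le_trans (ler_pM (normr_ge0 _) _ hw iS) _; first by rewrite invr_ge0 ltW.
  by rewrite le_eqVlt; apply/orP; left; apply/eqP; ring.
have e2 : `|w * ((S0 - S) / (S * S0))| <= S0^-1 * (24 * eps * Gam * `|w|).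
  rewrite normrM normf_div (gtr0_norm (mulr_gt0 Sp S00)) distrC invfM.
  apply: le_trans (_ : `|w| * (12 * eps * Gam * S0 * (2 / S0 * S0^-1)) <= _).
    rewrite ler_wpM2l //; apply: ler_pM => //.
      by rewrite mulr_ge0 ?invr_ge0 // ltW.
    by rewrite ler_wpM2r // invr_ge0 ltW.
  by rewrite le_eqVlt; apply/orP; left; apply/eqP; field; rewrite gt_eqF.
have e3 : `|(w - b x 0 * a y 0) / S0| = S0^-1 * `|w - b x 0 * a y 0|.
  by rewrite normrM normfV (gtr0_norm S00) mulrC.
apply: le_trans (_ : S0^-1 * (4 * theta * `|w|) +
   (S0^-1 * (24 * eps * Gam * `|w|) + S0^-1 * `|w - b x 0 * a y 0|) <= _).
  by apply: lerD => //; apply: le_trans (ler_normD _ _) _; rewrite e3 lerD.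
by rewrite le_eqVlt; apply/orP; left; apply/eqP; ring.
Qed.

Lemma sum_sqr_outer (u v : 'cV[R]_n) :
  \sum_x \sum_y (u x 0 * v y 0) ^+ 2 = nrm u ^+ 2 * nrm v ^+ 2.
Proof.
rewrite !sqr_nrm /dot mulr_suml; apply: eq_bigr => x _; rewrite mulr_sumr.
by apply: eq_bigr => y _; ring.
Qed.

Definition real_lambda1 (H : 'M[R]_n) : R :=
  complex.Re (lambda1 (map_mx (real_complex R) (rank1_plus alpha a b H))).

(** The slack 1 is the norm of a flipped entry, so one bound on the observed [H] controls all its
    neighbours. As (U, V) is the same for every entry, the squares sum to products of norms, and the
    total does not grow with n. *)
Theorem sum_sqr_flip_le (H : 'M[R]_n) (H0 : 'I_n -> 'I_n -> 'M[R]_n) k :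
  opnorm_le H k -> k + 1 <= eps * lam ->
  (forall x y, H = H0 x y \/ H = H0 x y + delta_mx x y) ->
  \sum_x \sum_y (real_lambda1 (H0 x y + delta_mx x y) - real_lambda1 (H0 x y)
                   - b x 0 * a y 0 / S0) ^+ 2
  <= 32 * Gam ^+ 2 * (4 * theta + 24 * eps * Gam) ^+ 2 + 320 * eps ^+ 2 * Gam ^+ 2.
Proof.
move=> hk kle hH0.
have hH : opnorm_le H (eps * lam) by apply: opnorm_le_trans hk; lra.
have [z [U [V hp]]] := perron_data_exists alpha0 S00 eps0 geom small hH.
have [U2 Ua] := perron_data_right alpha0 S00 eps0 geom small hH hp.
have [V2 Va] := perron_data_left alpha0 S00 eps0 geom small hH hp.
set C := 4 * theta + 24 * eps * Gam.
have G0 : 0 <= Gam := le_trans ler01 Gam1.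
have C0 : 0 <= C by apply: addr_ge0; [exact: mulr_ge0 | rewrite !mulr_ge0].
have key x y : (real_lambda1 (H0 x y + delta_mx x y) - real_lambda1 (H0 x y)
      - b x 0 * a y 0 / S0) ^+ 2
    <= S0 ^- 2 * (2 * C ^+ 2 * (V x 0 * U y 0) ^+ 2
       + (4 * ((V - b) x 0 * U y 0) ^+ 2 + 4 * (b x 0 * (U - a) y 0) ^+ 2)).
  have d1 := opnorm_le_delta x y.
  have h0 : opnorm_le (H0 x y) (eps * lam).
    apply: opnorm_le_trans kle _; case: (hH0 x y) => E.
      by rewrite -E; apply: opnorm_le_trans hk; rewrite lerDl.
    have -> : H0 x y = H + - delta_mx x y by rewrite E addrK.
    by apply: opnorm_leD => //; apply: opnorm_leN; exact: d1.
  have h1 : opnorm_le (H0 x y + delta_mx x y) (eps * lam).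
    apply: opnorm_le_trans kle _; case: (hH0 x y) => E.
      by rewrite -E; apply: opnorm_leD => //; exact: d1.
    by rewrite -E; apply: opnorm_le_trans hk; rewrite lerDl.
  have [z0 [U0 [V0 [z1 [U1 [V1 [p0 p1 hUV]]]]]]] : exists z0 U0 V0 z1 U1 V1,
      [/\ perron_data alpha a b (H0 x y) z0 U0 V0,
          perron_data alpha a b (H0 x y + delta_mx x y) z1 U1 V1 &
          (U = U0 /\ V = V0) \/ (U = U1 /\ V = V1)].
    case: (hH0 x y) => E.
      have [z1 [U1 [V1 p1]]] := perron_data_exists alpha0 S00 eps0 geom small h1.
      by exists z, U, V, z1, U1, V1; split=> //; [rewrite -E | left].
    have [z0 [U0 [V0 p0]]] := perron_data_exists alpha0 S00 eps0 geom small h0.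
    by exists z0, U0, V0, z, U, V; split=> //; [rewrite -E | right].
  rewrite /real_lambda1 (perron_lambda1 alpha0 S00 eps0 geom small h0 p0).
  rewrite (perron_lambda1 alpha0 S00 eps0 geom small h1 p1) /=.
  have := flip_diff_le h0 h1 p0 p1 hUV; rewrite -/C.
  set A := _ - _ - _; set w := V x 0 * U y 0; set bt := b x 0 * a y 0 => hA.
  have : A ^+ 2 <= (S0^-1 * (C * `|w| + `|w - bt|)) ^+ 2.
    rewrite -(real_normK (num_real A)) lerXn2r // nnegrE //.
    by rewrite mulr_ge0 ?invr_ge0 ?(ltW S00) // addr_ge0 // mulr_ge0.
  move=> h; apply: le_trans h _; rewrite exprMn exprVn ler_wpM2l //.
    by rewrite invr_ge0 exprn_ge0 // ltW.
  have sq (s t : R) : (s + t) ^+ 2 <= 2 * s ^+ 2 + 2 * t ^+ 2.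
    by have := sqr_ge0 (s - t); rewrite sqrrB sqrrD => q; lra.
  apply: le_trans (sq _ _) _; rewrite exprMn !real_normK ?num_real // mulrA lerD2l.
  have -> : w - bt = (V - b) x 0 * U y 0 + b x 0 * (U - a) y 0.
    by rewrite /w /bt !mxE; ring.
  by have := sq ((V - b) x 0 * U y 0) (b x 0 * (U - a) y 0); lra.
apply: le_trans (_ : S0 ^- 2 * (2 * C ^+ 2 * (nrm V ^+ 2 * nrm U ^+ 2)
   + (4 * (nrm (V - b) ^+ 2 * nrm U ^+ 2) + 4 * (nrm b ^+ 2 * nrm (U - a) ^+ 2))) <= _).
  rewrite -!sum_sqr_outer !mulr_sumr -!big_split mulr_sumr; apply: ler_sum => x _.
  by rewrite !mulr_sumr -!big_split mulr_sumr; apply: ler_sum => y _.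
have sqle (s t : R) : 0 <= s -> s <= t -> s ^+ 2 <= t ^+ 2.
  by move=> s0 st; rewrite lerXn2r // nnegrE // (le_trans s0).
rewrite mulrC ler_pdivrMr ?exprn_gt0 //.
set G := nrm a ^+ 2 * nrm b ^+ 2.
have hG : G <= Gam ^+ 2 * S0 ^+ 2.
  by rewrite /G -!exprMn sqle // mulr_ge0 ?nrm_ge0.
have g1 : nrm V ^+ 2 * nrm U ^+ 2 <= 16 * G.
  apply: le_trans (ler_pM _ _ (sqle _ _ (nrm_ge0 _) V2) (sqle _ _ (nrm_ge0 _) U2)) _.
  - exact: sqr_ge0.
  - exact: sqr_ge0.
  by rewrite le_eqVlt; apply/orP; left; apply/eqP; rewrite /G; ring.
have g2 : nrm (V - b) ^+ 2 * nrm U ^+ 2 <= 64 * eps ^+ 2 * G.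
  apply: le_trans (ler_pM _ _ (sqle _ _ (nrm_ge0 _) Va) (sqle _ _ (nrm_ge0 _) U2)) _.
  - exact: sqr_ge0.
  - exact: sqr_ge0.
  by rewrite le_eqVlt; apply/orP; left; apply/eqP; rewrite /G; ring.
have g3 : nrm b ^+ 2 * nrm (U - a) ^+ 2 <= 16 * eps ^+ 2 * G.
  apply: le_trans (ler_wpM2l (sqr_ge0 _) (sqle _ _ (nrm_ge0 _) Ua)) _.
  by rewrite le_eqVlt; apply/orP; left; apply/eqP; rewrite /G; ring.
(* 32 = 2 * 16 comes from [g1], and 320 = 4 * 64 + 4 * 16 from [g2] and [g3]. *)
apply: le_trans (_ : (32 * C ^+ 2 + 320 * eps ^+ 2) * G <= _).
  have := ler_wpM2l (_ : 0 <= 2 * C ^+ 2) g1; rewrite mulr_ge0 ?sqr_ge0 // => /(_ isT).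
  by lra.
apply: le_trans (ler_wpM2l _ hG) _; first by rewrite addr_ge0 // mulr_ge0 // sqr_ge0.
by rewrite le_eqVlt; apply/orP; left; apply/eqP; ring.
Qed.

End FlipSum.
End PerronData.

(** * Gaussian approximation by Stein's method *)

Section SteinEquation.
Variable R : realType.
Variable sigma : R.
Hypothesis sigma0 : 0 < sigma.
Let sne0 : sigma != 0. Proof. by rewrite gt_eqF. Qed.
Local Notation mu := (@lebesgue_measure R).
Local Notation phi := (normal_pdf 0 sigma).

Lemma integrable_bounded_mul_normal_pdf (h : R -> R) (M m : R) :
  measurable_fun [set: measurableTypeR R] h -> (forall x, `|h x| <= M) ->
  mu.-integrable setT (EFin \o (fun t => h t * normal_pdf m sigma t)).
Proof.
move=> mh hM.
have M0 : 0 <= M by apply: le_trans (hM 0).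
apply: (le_integrable _ _ _
  (_ : mu.-integrable setT (fun t => M%:E * (normal_pdf m sigma t)%:E)%E)) => //.
- by apply/measurable_EFinP/measurable_funM => //; exact: measurable_normal_pdf.
- move=> x _ /=; rewrite lee_fin !normrM ler_wpM2r // (le_trans (hM x)) //.
  exact: ler_norm.
- by apply: integrableZl => //; exact: integrable_normal_pdf.
Qed.

Lemma integral_normal_prob (h : R -> R) (M : R) :
  measurable_fun [set: measurableTypeR R] h -> (forall x, `|h x| <= M) ->
  \int[normal_prob 0 sigma]_t h t = \int[mu]_t (h t * phi t).
Proof.
move=> mh hM; rewrite /Rintegral; congr fine.
pose nu : {finite_measure set _ -> \bar R} := normal_prob 0 sigma.
have dom : nu `<< mu := normal_prob_dominates 0 sigma.
have ih : nu.-integrable setT (EFin \o h).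
  apply: (le_integrable _ _ _ (finite_measure_integrable_cst nu M measurableT)) => //.
    exact/measurable_EFinP.
  by move=> x _ /=; rewrite lee_fin (le_trans (hM x)) // ler_norm.
rewrite -(Radon_Nikodym_change_of_variables dom measurableT ih).
(* Both functions have the same integral over every measurable set. *)
have RN : ae_eq mu setT (Radon_Nikodym (charge_of_finite_measure nu) mu) (EFin \o phi).
  apply: integral_ae_eq => //.
  - exact: Radon_Nikodym_integrable.
  - by apply/measurable_EFinP; exact: measurable_normal_pdf.
  - by move=> A _ mA; rewrite -Radon_Nikodym_integral.
apply: ae_eq_integral => //.
- apply: emeasurable_funM; first exact/measurable_EFinP.
  by apply: measurable_int; exact: Radon_Nikodym_integrable.
- by apply/measurable_EFinP/measurable_funM => //; exact: measurable_normal_pdf.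
- by apply: filterS RN => x /= + _ => /(_ I) ->.
Qed.

(** Because t^2 >= x^2 + (t - x)^2 when t lies beyond x. Integrated, this bounds a Gaussian tail by
    a multiple of [phi x], uniformly up to x = 0. *)
Lemma normal_pdf_shift_le x t : 0 <= x * (t - x) ->
  phi t <= phi x / normal_peak sigma * normal_pdf x sigma t.
Proof.
move=> xt; rewrite !normal_pdfE // /normal_fun.
have pk := normal_peak_gt0 sne0.
rewrite [X in _ <= X / _ * _]mulrC mulfK ?gt_eqF //.
rewrite mulrCA; apply: ler_wpM2l; first exact: ltW.
rewrite -expRD ler_expR -mulrDl; apply: ler_wpM2r.
  by rewrite invr_ge0 mulrn_wge0 // sqr_ge0.
rewrite !subr0; have -> : t = x + (t - x) by rewrite addrC subrK.
by rewrite [X in _ - X ^+ 2](_ : _ = t - x) ?[x + _]addrC ?addrK //;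
  rewrite ?subrK; have := xt; rewrite !expr2; lra.
Qed.

Lemma Rintegral_normal_pdf_le1 m (A : set (measurableTypeR R)) : measurable A ->
  \int[mu]_(t in A) normal_pdf m sigma t <= 1.
Proof.
move=> mA; rewrite /Rintegral -[leRHS]/(fine 1%:E) fine_le //.
  apply: integrable_fin_num => //.
  by apply: (integrableS measurableT) => //; exact: integrable_normal_pdf.
rewrite -(integral_normal_pdf m sigma); apply: ge0_subset_integral => //.
  by apply/measurable_EFinP; exact: measurable_normal_pdf.
by move=> x _; rewrite lee_fin normal_pdf_ge0.
Qed.

Lemma normal_tail_le (psi : R -> R) M x (A : set (measurableTypeR R)) : measurable A -> 0 <= M ->
  mu.-integrable setT (EFin \o psi) -> (forall t, `|psi t| <= M * phi t) ->
  (forall t, A t -> 0 <= x * (t - x)) ->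
  `|\int[mu]_(t in A) psi t| <= M * phi x / normal_peak sigma.
Proof.
move=> mA M0 ipsi psiM Ax.
have pk := normal_peak_gt0 sne0.
have iA (f : R -> R) : mu.-integrable setT (EFin \o f) -> mu.-integrable A (EFin \o f).
  by move=> fi; apply: (integrableS measurableT).
have inorm m : mu.-integrable A (EFin \o normal_pdf m sigma).
  by apply: iA; exact: integrable_normal_pdf.
apply: (le_trans (le_normr_Rintegral mA (iA _ ipsi))).
pose c := M * phi x / normal_peak sigma.
have c0 : 0 <= c by rewrite !mulr_ge0 ?invr_ge0 ?normal_pdf_ge0 // ltW.
apply: le_trans (_ : \int[mu]_(t in A) (c * normal_pdf x sigma t) <= _).
  apply: le_Rintegral => //.
  - by have := integrable_norm (iA _ ipsi).
  - by have := integrableZl mA c (inorm x).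
  - move=> t At; apply: le_trans (psiM t) _; rewrite /c -!mulrA ler_wpM2l //.
    by rewrite mulrA; apply: normal_pdf_shift_le; exact: Ax.
by rewrite RintegralZl // -[leRHS]mulr1 ler_wpM2l // Rintegral_normal_pdf_le1.
Qed.

End SteinEquation.

Section SteinSolution.
Variable R : realType.
Variable sigma : R.
Hypothesis sigma0 : 0 < sigma.
Let sne0 : sigma != 0. Proof. by rewrite gt_eqF. Qed.
Local Notation mu := (@lebesgue_measure R).
Local Notation phi := (normal_pdf 0 sigma).

Lemma Lipschitz_continuous (h : R -> R) (K : R) : 0 <= K ->
  (forall x y, `|h x - h y| <= K * `|x - y|) -> continuous h.
Proof.
move=> K0 hK x; apply/cvgrPdist_le => /= e e0; near=> t.
apply: le_trans (hK _ _) _; apply: le_trans (_ : (K + 1) * `|x - t| <= _).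
  by rewrite ler_wpM2r // lerDl.
rewrite mulrC -ler_pdivlMr ?ltr_wpDl //; near: t.
by apply: cvgr_dist_le; [exact: cvg_id | rewrite divr_gt0 ?ltr_wpDl].
Unshelve. all: by end_near. Qed.

(** The classical solution g = Psi / (sigma^2 phi), where Psi is the integral of (h - m) phi up to
    x. Tail bounds make g bounded; the equation then gives linear growth of g' and a quadratically
    growing local Lipschitz constant, which second moments of the linear statistic can absorb. *)
Theorem Stein_solution (h : R -> R) (M K : R) :
  (forall x, `|h x| <= M) -> (forall x y, `|h x - h y| <= K * `|x - y|) ->
  exists g g' : R -> R, exists C : R,
  [/\ 0 <= C, forall x, `|g' x| <= C * (1 + `|x|), forall x, is_derive x (1 : R) g (g' x),
      forall x, sigma ^+ 2 * g' x - x * g x = h x - \int[normal_prob 0 sigma]_t h t &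
      forall x y, `|g' x - g' y| <= C * (1 + `|x| + `|y|) ^+ 2 * `|x - y| ].
Proof.
move=> hM hK.
have M0 : 0 <= M by apply: le_trans (hM 0).
have K0 : 0 <= K.
  by have := hK 1 0; rewrite subr0 normr1 mulr1; apply: le_trans.
have hc : continuous h := Lipschitz_continuous K0 hK.
have mh : measurable_fun [set: measurableTypeR R] h by exact: continuous_measurable_fun.
pose m : R := \int[normal_prob 0 sigma]_t h t.
have mE : m = \int[mu]_t (h t * phi t) by exact: (integral_normal_prob sigma mh hM).
pose psi t := (h t - m) * phi t.
have mM : `|m| <= M.
  rewrite mE; apply: le_trans (le_normr_Rintegral measurableT
    (integrable_bounded_mul_normal_pdf sigma 0 mh hM)) _.
  apply: le_trans (_ : \int[mu]_t (M * phi t) <= _).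
    apply: le_Rintegral => //.
    - by have := integrable_norm (integrable_bounded_mul_normal_pdf sigma 0 mh hM).
    - by have := integrableZl measurableT M (integrable_normal_pdf 0 sigma).
    - move=> t _; rewrite normrM (ger0_norm (normal_pdf_ge0 _ _ _)) ler_wpM2r //.
      exact: normal_pdf_ge0.
  rewrite RintegralZl //; last exact: integrable_normal_pdf.
  by rewrite -[leRHS]mulr1 ler_wpM2l // Rintegral_normal_pdf_le1.
have hmM x : `|h x - m| <= 2 * M.
  by apply: le_trans (ler_normB _ _) _; have := hM x; lra.
have mhm : measurable_fun [set: measurableTypeR R] (fun x => h x - m) by exact: measurable_funB.
have ipsi : mu.-integrable setT (EFin \o psi).
  exact: (integrable_bounded_mul_normal_pdf sigma 0 mhm hmM).
have psi0 : \int[mu]_t psi t = 0.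
  have iphi : mu.-integrable setT (EFin \o phi) by exact: integrable_normal_pdf.
  have imphi : mu.-integrable setT (EFin \o (fun t => m * phi t)).
    by have := integrableZl measurableT m iphi.
  rewrite (_ : (fun t => psi t) = (fun t => h t * phi t - m * phi t)); last first.
    by apply/funext => t; rewrite /psi mulrBl.
  rewrite RintegralB //; last exact: (integrable_bounded_mul_normal_pdf sigma 0 mh hM).
  rewrite -mE RintegralZl // [X in m * X](_ : _ = 1) ?mulr1 ?subrr //.
  by rewrite /Rintegral integral_normal_pdf.
have psiM t : `|psi t| <= 2 * M * phi t.
  by rewrite normrM (ger0_norm (normal_pdf_ge0 _ _ _)) ler_wpM2r // normal_pdf_ge0.
have cpsi : continuous psi.
  move=> t; apply: cvgM; last exact: continuous_normal_pdf.
  by apply: cvgB; [exact: hc | exact: cvg_cst].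
pose Psi x := \int[mu]_(t in `]-oo, x]) psi t.
have dPsi x : is_derive x (1 : R) Psi (psi x).
  have ipsix : mu.-integrable [set` Interval -oo%O (BRight (x + 1))] (EFin \o psi).
    exact: (integrableS measurableT).
  have xx1 : x < x + 1 by rewrite ltrDl.
  have [|d1 d2] := @continuous_FTC1 R psi -oo%O x (x + 1) xx1 ipsix _ (cpsi x).
    by rewrite ltNyr.
  by split; [exact: d1 | rewrite -derive1E; exact: d2].
have phi0 x : 0 < phi x.
  by rewrite normal_pdfE // mulr_gt0 ?normal_peak_gt0 ?expR_gt0.
have pk : 0 < normal_peak sigma by exact: normal_peak_gt0.
have PsiB x : `|Psi x| <= 2 * M * phi x / normal_peak sigma.
  have [x0|x0] := leP x 0.
    apply: (normal_tail_le sigma0 _ _ ipsi psiM) => //; first by rewrite mulr_ge0.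
    move=> t /=; rewrite in_itv /= => tx; rewrite mulr_le0 // subr_le0 //.
  (* [psi] has integral zero, so for x > 0 the right tail may replace the left one, which is not
     small. *)
  have -> : Psi x = - \int[mu]_(t in `]x, +oo[) psi t.
    have := @Rintegral_itvB R psi -oo%O +oo%O x.
    rewrite -/(Psi x) set_itvNyy => /(_ ipsi isT isT).
    by rewrite psi0 sub0r => <-; rewrite opprK.
  rewrite normrN; apply: (normal_tail_le sigma0 _ _ ipsi psiM) => //.
    by rewrite mulr_ge0.
  by move=> t /=; rewrite in_itv /= andbT => tx; rewrite mulr_ge0 // ltW ?subr_gt0.
pose v := sigma ^+ 2; have v0 : 0 < v by rewrite exprn_gt0.
pose q : R -> R := fun x => x ^+ 2 / (v *+ 2).
pose e : R -> R := expR \o q.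
have ephi x : phi x * e x = normal_peak sigma.
  rewrite normal_pdfE // /normal_fun /e /q /= -mulrA -expRD subr0 -/v.
  by rewrite mulNr addNr expR0 mulr1.
have de x : is_derive x (1 : R) e (x / v * e x).
  have dq : is_derive x (1 : R) q (x / v).
    have -> : q = (v *+ 2)^-1 \*: (id ^+ 2).
      by apply/funext => t; rewrite /q mulrC.
    apply: is_derive_eq; rewrite /GRing.scale /= expr1.
    by field; rewrite gt_eqF.
  by rewrite mulrC; exact: is_derive1_comp.
pose k := (v * normal_peak sigma)^-1.
pose g x := k * (Psi x * e x).
pose B := 2 * M / (v * normal_peak sigma).
have gB x : `|g x| <= B.
  rewrite /g normrM normrM (ger0_norm (expR_ge0 _)) gtr0_norm ?invr_gt0 ?mulr_gt0 //.
  rewrite mulrC; apply: ler_wpM2r; first by rewrite invr_ge0 mulr_ge0 // ltW.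
  apply: le_trans (ler_wpM2r (expR_ge0 _) (PsiB x)) _.
  by rewrite mulrAC -[_ * phi x * _]mulrA ephi mulfK ?gt_eqF.
pose g' x := v^-1 * (h x - m + x * g x).
have dg x : is_derive x (1 : R) g (g' x).
  have -> : g = k \*: (Psi * e) by [].
  have dPx := dPsi x; have dex := de x; apply: is_derive_eq.
  rewrite /GRing.scale /= /g' /g /psi.
  have -> : (h x - m) * phi x = (h x - m) * normal_peak sigma / e x.
    by rewrite -(ephi x); field; rewrite gt_eqF // expR_gt0.
  by rewrite /k; field; rewrite !gt_eqF ?expR_gt0.
have g'B x : `|g' x| <= v^-1 * (2 * M + `|x| * B).
  rewrite /g' normrM gtr0_norm ?invr_gt0 // ler_wpM2l ?invr_ge0 ?(ltW v0) //.
  by apply: le_trans (ler_normD _ _) _; rewrite lerD // normrM ler_wpM2l.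
have gL x y : `|g x - g y| <= v^-1 * (2 * M + (`|x| + `|y|) * B) * `|x - y|.
  wlog xy : x y / x <= y.
    by move=> H; case/orP: (le_total x y) => /H //; rewrite distrC [`|y - x|]distrC [`|y| + _]addrC.
  have gc : {within `[x, y], continuous g}.
    apply: continuous_subspaceT => t.
    by apply: differentiable_continuous; apply/derivable1_diffP; case: (dg t).
  have [c cxy] := MVT_segment xy (fun t _ => dg t) gc.
  rewrite distrC => ->; rewrite normrM [`|x - y|]distrC ler_wpM2r //.
  apply: le_trans (g'B c) _; rewrite ler_wpM2l ?invr_ge0 ?(ltW v0) // lerD2l.
  have B0 : 0 <= B by apply: le_trans (gB 0).
  rewrite ler_wpM2r //; move: cxy; rewrite in_itv /= => /andP[xc cy].
  have := ler_norm (- x); rewrite normrN; have := ler_norm y.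
  by rewrite ler_norml => *; have := normr_ge0 x; have := normr_ge0 y => *; apply/andP; split; lra.
have B0 : 0 <= B by apply: le_trans (gB 0).
pose D := v^-1 * (2 * M + B).
have D0 : 0 <= D.
  by rewrite /D mulr_ge0 ?invr_ge0 ?(ltW v0) // addr_ge0 // mulr_ge0.
exists g, g', (v^-1 * (K + B + D) + D); split.
- by rewrite addr_ge0 // mulr_ge0 ?invr_ge0 ?(ltW v0) // !addr_ge0.
- move=> x; apply: (le_trans (g'B x)).
  apply: (@le_trans _ _ (D * (1 + `|x|))); last first.
    rewrite ler_wpM2r ?addr_ge0 // lerDr mulr_ge0 ?invr_ge0 ?(ltW v0) //.
    by rewrite !addr_ge0.
  rewrite /D -mulrA ler_wpM2l ?invr_ge0 ?(ltW v0) //.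
  have x0 := normr_ge0 x; have Mx := mulr_ge0 M0 x0.
  by rewrite mulrDr mulr1 mulrDl; lra.
- by [].
- move=> x; rewrite -/v -/m /g' mulVKf ?gt_eqF //; ring.
move=> x y; apply: (@le_trans _ _ (v^-1 * (K + B + D) * (1 + `|x| + `|y|) ^+ 2 * `|x - y|)); last first.
  by rewrite ler_wpM2r // ler_wpM2r ?exprn_ge0 ?addr_ge0 // lerDl.
rewrite /D /g' -mulrBr normrM gtr0_norm ?invr_gt0 // -2![leRHS]mulrA.
rewrite ler_wpM2l ?invr_ge0 ?(ltW v0) //.
set a := `|x|; set b := `|y|; set d := `|x - y|.
have a0 : 0 <= a by exact: normr_ge0.
have b0 : 0 <= b by exact: normr_ge0.
have d0 : 0 <= d by exact: normr_ge0.
have -> : h x - m + x * g x - (h y - m + y * g y)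
   = (h x - h y) + ((x - y) * g x + y * (g x - g y)) by ring.
apply: le_trans (ler_normD _ _) _.
apply: le_trans (lerD (hK x y) (ler_normD _ _)) _.
rewrite (normrM (x - y)) (normrM y) -/d -/b.
apply: le_trans (_ : K * d + (d * B + b * (v^-1 * (2 * M + (a + b) * B) * d)) <= _).
  by rewrite lerD // lerD // ?ler_wpM2l //; exact: gL.
set w := v^-1; have w0 : 0 <= w by rewrite invr_ge0 ltW.
have s1 : 1 <= (1 + a + b) ^+ 2 by rewrite exprn_ege1 //; lra.
have s2 : b <= (1 + a + b) ^+ 2 by rewrite expr2; nra.
have s3 : b * (a + b) <= (1 + a + b) ^+ 2 by rewrite expr2; nra.
set s := (1 + a + b) ^+ 2 in s1 s2 s3 *.
rewrite (_ : _ + _ = (K + B + w * (2 * M * b + B * (b * (a + b)))) * d); last by ring.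
rewrite [leRHS]mulrA ler_wpM2r // [leRHS]mulrDl; apply: lerD.
  by rewrite -[leLHS]mulr1 ler_wpM2l // addr_ge0.
rewrite -[leRHS]mulrA ler_wpM2l // [leRHS]mulrDl.
by apply: lerD; rewrite ler_wpM2l // mulr_ge0.
Qed.

End SteinSolution.

Section BernoulliCLT.
Variables (R : realType) (E : finType) (p c : E -> R).
Hypothesis p01 : forall e, 0 <= p e <= 1.
Implicit Types M : {ffun E -> bool}.

Definition lin_stat M : R := \sum_e c e * ((M e)%:R - p e).
Definition lin_var : R := \sum_e c e ^+ 2 * (p e * (1 - p e)).

Lemma lin_stat_upd M e : lin_stat (upd M e true) - lin_stat (upd M e false) = c e.
Proof.
rewrite /lin_stat -sumrB (bigD1 e) //= big1 => [|i /negbTE ie].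
  by rewrite !updE eqxx /=; ring.
by rewrite !updE ie subrr.
Qed.

Lemma Ex_lin_stat_mul (g : R -> R) :
  Ex p (fun M => lin_stat M * g (lin_stat M))
  = \sum_e c e * (p e * (1 - p e)) * Ex p (disc_deriv e (g \o lin_stat)).
Proof.
transitivity (\sum_e Ex p (fun M => c e * (((M e)%:R - p e) * g (lin_stat M)))).
  rewrite -Ex_sum; apply: eq_Ex => M; rewrite {1}/lin_stat mulr_suml.
  by apply: eq_bigr => e _; rewrite mulrA.
by apply: eq_bigr => e _; rewrite ExZ Ex_centered_mul mulrA.
Qed.

Lemma Ex_lin_stat : Ex p lin_stat = 0.
Proof.
rewrite (_ : lin_stat = fun M => \sum_e c e * (((M e)%:R - p e) * 1)); last first.
  by apply/funext => M; apply: eq_bigr => e _; rewrite mulr1.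
rewrite Ex_sum big1 // => e _; rewrite ExZ Ex_centered_mul.
by rewrite (_ : disc_deriv _ _ = fun=> 0) ?Ex_cst ?mulr0 //; apply/funext => M; rewrite /disc_deriv subrr.
Qed.

Lemma Ex_sqr_lin_stat : Ex p (fun M => lin_stat M ^+ 2) = lin_var.
Proof.
have := Ex_lin_stat_mul id; rewrite /lin_var => h.
transitivity (Ex p (fun M => lin_stat M * id (lin_stat M))).
  by apply: eq_Ex => M; rewrite expr2.
rewrite h; apply: eq_bigr => e _.
rewrite (_ : disc_deriv _ _ = fun=> c e) ?Ex_cst; first by ring.
by apply/funext => M; rewrite /disc_deriv /= lin_stat_upd.
Qed.

Lemma lin_var_term_ge0 e : 0 <= p e * (1 - p e).
Proof. by case/andP: (p01 e) => p0 p1; rewrite mulr_ge0 // subr_ge0. Qed.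

(** After integration by parts each discrete derivative is c_e g'(xi) with xi within |c_e| of the
    statistic. Moving g' to the statistic costs another |c_e|, and one of the three factors |c_e| is
    bounded by kappa. *)
Lemma Stein_lin_stat (g g' : R -> R) (C kappa : R) :
  0 <= C -> (forall x, is_derive x (1 : R) g (g' x)) ->
  (forall x y, `|g' x - g' y| <= C * (1 + `|x| + `|y|) ^+ 2 * `|x - y|) ->
  kappa <= 1 -> (forall e, `|c e| <= kappa) ->
  `|Ex p (fun M => lin_stat M * g (lin_stat M))
    - lin_var * Ex p (fun M => g' (lin_stat M))|
  <= C * kappa * lin_var * (8 + 8 * lin_var).
Proof.
move=> C0 dg lg k1 ck; rewrite Ex_lin_stat_mul /lin_var mulr_suml -sumrB.
have key e M : `|disc_deriv e (g \o lin_stat) M - c e * g' (lin_stat M)|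
    <= C * (8 + 8 * lin_stat M ^+ 2) * `|c e| ^+ 2.
  set W := lin_stat M; set W1 := lin_stat (upd M e true).
  set W0 := lin_stat (upd M e false).
  have W10 : W1 - W0 = c e by exact: lin_stat_upd.
  have hW : W = W0 \/ W = W1.
    rewrite /W -{1 2}(upd_id M e); case: (M e); [by right|by left].
  have [xi hxi hd] : exists2 xi, `|xi - W| <= `|c e| & g W1 - g W0 = g' xi * c e.
    have gc x y : {within `[x, y], continuous g}.
      apply: continuous_subspaceT => t.
      by apply: differentiable_continuous; apply/derivable1_diffP; case: (dg t).
    have [h|h] := leP W0 W1.
      have [t] := MVT_segment h (fun t _ => dg t) (gc _ _).
      rewrite W10 in_itv /= => /andP[t1 t2] ->; exists t => //.
      have c0 : 0 <= c e by rewrite -W10 subr_ge0.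
      by rewrite (ger0_norm c0) ler_norml; apply/andP; case: hW => ->; split; lra.
    have [t] := MVT_segment (ltW h) (fun t _ => dg t) (gc _ _).
    rewrite in_itv /= => /andP[t1 t2] E1; exists t; last first.
      by rewrite -W10 -opprB E1; ring.
    have c0 : c e <= 0 by rewrite -W10 subr_le0 ltW.
    by rewrite (ler0_norm c0) ler_norml; apply/andP; case: hW => ->; split; lra.
  rewrite /disc_deriv /= -/W1 -/W0 hd mulrC -mulrBr normrM.
  have ce := normr_ge0 (c e).
  have xW : `|xi| <= `|W| + 1.
    have := ler_normD (xi - W) W; rewrite subrK; have := ck e; lra.
  (* Since kappa <= 1, the left side is at most (2 + 2 |W|)^2. *)
  have s : (1 + `|xi| + `|W|) ^+ 2 <= 8 + 8 * W ^+ 2.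
    apply: (@le_trans _ _ ((2 + 2 * `|W|) ^+ 2)).
      by apply: lerXn2r; rewrite ?nnegrE ?addr_ge0 ?mulr_ge0 //; lra.
    rewrite -[W ^+ 2]real_normK ?num_real // -subr_ge0.
    rewrite (_ : _ - _ = 4 * (`|W| - 1) ^+ 2); last by ring.
    by rewrite mulr_ge0 ?sqr_ge0.
  apply: le_trans (ler_wpM2l ce (lg xi W)) _.
  rewrite [`|c e| ^+ 2]expr2 mulrCA -[leRHS]mulrA [leRHS]mulrA -[leLHS]mulrA.
  rewrite [`|c e| * _]mulrC.
  have h1 : (1 + `|xi| + `|W|) ^+ 2 * (`|xi - W| * `|c e|) <= (8 + 8 * W ^+ 2) * (`|c e| * `|c e|).
    by apply: ler_pM => //; rewrite ?exprn_ge0 ?addr_ge0 ?mulr_ge0 // ler_wpM2r.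
  have := ler_wpM2l C0 h1; rewrite !mulrA => h2; apply: le_trans h2; apply: le_trans _ (lexx _).
  by rewrite le_eqVlt; apply/orP; left; apply/eqP; ring.
apply: le_trans (ler_norm_sum _ _ _) _.
apply: (@le_trans _ _ (\sum_e c e ^+ 2 * (p e * (1 - p e)) *
   (C * kappa * (8 + 8 * lin_var)))); last first.
  by rewrite -mulr_suml -/lin_var le_eqVlt; apply/orP; left; apply/eqP; ring.
apply: ler_sum => e _.
have -> : c e * (p e * (1 - p e)) * Ex p (disc_deriv e (g \o lin_stat))
   - c e ^+ 2 * (p e * (1 - p e)) * Ex p (fun M => g' (lin_stat M))
   = c e * (p e * (1 - p e)) *
     Ex p (fun M => disc_deriv e (g \o lin_stat) M - c e * g' (lin_stat M)).
  by rewrite ExB ExZ; ring.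
have q0 := lin_var_term_ge0 e; set q := p e * _ in q0 *.
rewrite normrM [`|c e * q|]normrM (ger0_norm q0).
have hE : `|Ex p (fun M => disc_deriv e (g \o lin_stat) M - c e * g' (lin_stat M))|
    <= C * (8 + 8 * lin_var) * `|c e| ^+ 2.
  apply: (le_trans (ler_norm_Ex p01 _)).
  apply: (@le_trans _ _ (Ex p (fun M => C * (8 + 8 * lin_stat M ^+ 2) * `|c e| ^+ 2))).
    exact: ler_Ex.
  rewrite -Ex_sqr_lin_stat le_eqVlt; apply/orP; left; apply/eqP.
  transitivity (Ex p (fun M => (C * `|c e| ^+ 2 * 8) * lin_stat M ^+ 2 + C * `|c e| ^+ 2 * 8)).
    by apply: eq_Ex => M; ring.
  by rewrite ExD ExZ Ex_cst; ring.
have ce := normr_ge0 (c e).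
apply: le_trans (ler_wpM2l _ hE) _; first by rewrite mulr_ge0.
rewrite -[c e ^+ 2]real_normK ?num_real //.
have v0 : 0 <= lin_var by apply: sumr_ge0 => i _; rewrite mulr_ge0 ?sqr_ge0 ?lin_var_term_ge0.
have F0 : 0 <= `|c e| ^+ 2 * q * (C * (8 + 8 * lin_var)).
  have s0 : 0 <= 8 + 8 * lin_var by rewrite addr_ge0 // mulr_ge0.
  exact: (mulr_ge0 (mulr_ge0 (sqr_ge0 _) q0) (mulr_ge0 C0 s0)).
by have := ler_wpM2l F0 (ck e); lra.
Qed.

End BernoulliCLT.

(** [C] is fixed before the index set, which will grow with n. The two errors are the mismatch of
    variances and the size of the largest coefficient. *)
Theorem Bernoulli_CLT (R : realType) (sigma : R) (h : R -> R) (B K : R) :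
  0 < sigma -> (forall x, `|h x| <= B) ->
  (forall x y, `|h x - h y| <= K * `|x - y|) ->
  exists2 C : R, 0 <= C & forall (E : finType) (p c : E -> R) (kappa : R),
    (forall e, 0 <= p e <= 1) -> kappa <= 1 -> (forall e, `|c e| <= kappa) ->
    `|Ex p (fun M => h (lin_stat p c M)) - \int[normal_prob 0 sigma]_t h t|
    <= C * (`|sigma ^+ 2 - lin_var p c| * (2 + lin_var p c)
            + kappa * lin_var p c * (8 + 8 * lin_var p c)).
Proof.
move=> sigma0 hB hK; have [g [g' [C [C0 g'B dg steq lg]]]] := Stein_solution sigma0 hB hK.
exists C => // E p c kappa p01 k1 ck.
set m := Rintegral _ _ _; set W := lin_stat p c; set v := lin_var p c.
have -> : Ex p (fun M => h (W M)) - m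
   = (sigma ^+ 2 - v) * Ex p (fun M => g' (W M))
     - (Ex p (fun M => W M * g (W M)) - v * Ex p (fun M => g' (W M))).
  rewrite (_ : Ex p (fun M => h (W M)) - m = Ex p (fun M => sigma ^+ 2 * g' (W M) - W M * g (W M))).
    by rewrite ExB ExZ; ring.
  by rewrite -{1}(Ex_cst p m) -ExB; apply: eq_Ex => M; rewrite steq.
apply: le_trans (ler_normB _ _) _; rewrite mulrDr; apply: lerD; last first.
  apply: le_trans (Stein_lin_stat p01 C0 dg lg k1 ck) _.
  by rewrite -/v !mulrA.
rewrite normrM mulrCA ler_wpM2l //.
apply: (le_trans (ler_norm_Ex p01 _)).
apply: (@le_trans _ _ (Ex p (fun M => C * W M ^+ 2 + C * 2))).
  apply: ler_Ex => // M; apply: le_trans (g'B _) _; rewrite -mulrDr ler_wpM2l //.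
  rewrite -[W M ^+ 2]real_normK ?num_real //.
  have := sqr_ge0 (`|W M| - 1); have := normr_ge0 (W M); rewrite sqrrB1; lra.
rewrite ExD ExZ Ex_cst Ex_sqr_lin_stat -/v; lra.
Qed.

(** * Weak convergence through bounded Lipschitz functions *)

Section LipschitzApproximation.
Variable R : realType.

Definition dist1 (z w : R * R) : R := `|z.1 - w.1| + `|z.2 - w.2|.

Definition bounded_Lipschitz (F : R * R -> R) : Prop :=
  (exists B : R, forall z, `|F z| <= B) /\
  (exists K : R, forall z w, `|F z - F w| <= K * dist1 z w).

Lemma dist1_ge0 z w : 0 <= dist1 z w.
Proof. by rewrite addr_ge0. Qed.

Lemma dist1_xx z : dist1 z z = 0.
Proof. by rewrite /dist1 !subrr normr0 addr0. Qed.

Lemma dist1C z w : dist1 z w = dist1 w z.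
Proof. by rewrite /dist1 distrC [`|z.2 - _|]distrC. Qed.

Lemma dist1_triangle u z w : dist1 z w <= dist1 z u + dist1 u w.
Proof.
by rewrite /dist1 [leRHS]addrACA lerD // ler_distD.
Qed.

(** For bounded f, the largest k-Lipschitz function below f with respect to [dist1] (Pasch-Hausdorff
    envelope). *)
Definition inf_convolution (f : R * R -> R) (k : nat) (z : R * R) : R :=
  inf [set f w + k%:R * dist1 z w | w in setT].

Section Properties.
Variables (f : R * R -> R) (B : R).
Hypothesis fB : forall z, `|f z| <= B.

Let lb k z : has_lbound [set f w + k%:R * dist1 z w | w in setT].
Proof.
exists (- B) => _ [w _ <-]; have := fB w; rewrite ler_norml => /andP[h _].
by rewrite (le_trans h) // lerDl mulr_ge0 // dist1_ge0.
Qed.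

Let ne k z : [set f w + k%:R * dist1 z w | w in setT] !=set0.
Proof. by exists (f z + k%:R * dist1 z z), z. Qed.

Lemma inf_convolution_le_at k z w : inf_convolution f k z <= f w + k%:R * dist1 z w.
Proof. by apply: ge_inf; [exact: lb | exists w]. Qed.

Lemma inf_convolution_le k z : inf_convolution f k z <= f z.
Proof. by have := inf_convolution_le_at k z z; rewrite dist1_xx mulr0 addr0. Qed.

Lemma inf_convolution_ge k z : - B <= inf_convolution f k z.
Proof.
apply: lb_le_inf; first exact: ne.
move=> _ [w _ <-]; have := fB w; rewrite ler_norml => /andP[h _].
by rewrite (le_trans h) // lerDl mulr_ge0 // dist1_ge0.
Qed.

Lemma inf_convolution_bound k z : `|inf_convolution f k z| <= B.
Proof.
rewrite ler_norml inf_convolution_ge (le_trans (inf_convolution_le _ _)) //.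
by apply: le_trans (fB z); exact: ler_norm.
Qed.

Lemma inf_convolution_Lipschitz k z w :
  `|inf_convolution f k z - inf_convolution f k w| <= k%:R * dist1 z w.
Proof.
have H u v : inf_convolution f k u <= inf_convolution f k v + k%:R * dist1 u v.
  rewrite -lerBlDr; apply: lb_le_inf; first exact: ne.
  move=> _ [t _ <-]; rewrite lerBlDr; apply: le_trans (inf_convolution_le_at k u t) _.
  rewrite -addrA lerD2l -mulrDr ler_wpM2l // addrC; exact: dist1_triangle.
rewrite ler_norml; have := H z w; have := H w z; rewrite [dist1 w z]dist1C => h1 h2.
by apply/andP; split; lra.
Qed.

(** Near z continuity controls f w; at distance at least r the penalty k r eventually exceeds the
    oscillation 2 B. *)
Lemma inf_convolution_cvg z : {for z, continuous f} ->
  (fun k => inf_convolution f k z) @ \oo --> f z.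
Proof.
move=> fc; apply/cvgrPdist_le => /= e e0.
have /cvgrPdist_le/(_ _ e0)/nbhs_ballP[r /= r0 rU] := fc.
have {}rU w : dist1 z w < r -> `|f z - f w| <= e.
  move=> zw; apply: rU; split; apply: le_lt_trans zw; first by rewrite lerDl.
  by rewrite lerDr.
near=> k; rewrite ler_norml; apply/andP; split.
  by have := inf_convolution_le k z; lra.
suff : f z - e <= inf_convolution f k z by lra.
apply: lb_le_inf; first exact: ne.
move=> _ [w _ <-]; have [wr|wr] := ltP (dist1 z w) r.
  have := rU w wr; rewrite ler_norml => /andP[_ h].
  by have : 0 <= k%:R * dist1 z w by [rewrite mulr_ge0 // dist1_ge0]; lra.
have h1 := fB z; have h2 := fB w; rewrite !ler_norml in h1 h2.
have : 2 * B <= k%:R * dist1 z w.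
  apply: le_trans (_ : k%:R * r <= _); last by rewrite ler_wpM2l.
  rewrite -ler_pdivrMr //; near: k; exact: nbhs_infty_ger.
by lra.
Unshelve. all: by end_near. Qed.

End Properties.

(* The functionals En n need only be monotone: f lies between inf_convolution f k and
   - inf_convolution (- f) k, which are Lipschitz and converge pointwise to f. *)
Theorem bounded_Lipschitz_portmanteau (En : nat -> (R * R -> R) -> R)
    (nu : probability (measurableTypeR R) R) :
  (forall n F G, (forall z, F z <= G z) -> En n F <= En n G) ->
  (forall F, bounded_Lipschitz F -> En ^~ F @ \oo --> \int[nu]_t F (t, 0)) ->
  forall f, bounded_continuous f -> En ^~ f @ \oo --> \int[nu]_t f (t, 0).
Proof.
move=> mono lipcvg f [fc [B fB]].
have slice_cont (g : R * R -> R) : continuous g -> continuous (fun t : R => g (t, 0)).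
  move=> gc t; apply: (@continuous_comp _ _ _ (fun t : R => (t, 0 : R)) g); last exact: gc.
  exact: (cvg_pair (@cvg_id _ _) (cvg_cst _)).
have mk (g : R * R -> R) k : (forall z, `|g z| <= B) ->
    measurable_fun [set: measurableTypeR R] (fun t : R => inf_convolution g k (t, 0)).
  move=> gB; apply: continuous_measurable_fun.
  apply: (@Lipschitz_continuous _ _ k%:R) => // x y.
  apply: le_trans (inf_convolution_Lipschitz gB _ _ _) _.
  by rewrite /dist1 /= subrr normr0 addr0.
have approx (g : R * R -> R) : continuous g -> (forall z, `|g z| <= B) ->
    (fun k => \int[nu]_t inf_convolution g k (t, 0)) @ \oo --> \int[nu]_t g (t, 0).
  move=> gc gB.
  have mg : measurable_fun [set: measurableTypeR R] (fun t : R => g (t, 0)).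
    exact: continuous_measurable_fun (slice_cont _ gc).
  have [||||| ig _ cv] := @dominated_convergence _ _ R nu setT measurableT
    (fun k t => (inf_convolution g k (t, 0))%:E) (fun t => (g (t, 0))%:E) (fun=> B%:E).
  - by move=> k; apply/measurable_EFinP; exact: mk.
  - by apply/measurable_EFinP.
  - apply: aeW => t _; apply: cvg_EFin; first by apply: nearW.
    exact: (inf_convolution_cvg gB (gc (t, 0))).
  - exact: finite_measure_integrable_cst.
  - by apply: aeW => t k _; rewrite lee_fin inf_convolution_bound.
  by apply: fine_cvg; rewrite fineK // integrable_fin_num.
have lipE (g : R * R -> R) k : (forall z, `|g z| <= B) -> bounded_Lipschitz (inf_convolution g k).
  move=> gB; split; first by exists B => z; exact: inf_convolution_bound.
  by exists k%:R => z w; exact: inf_convolution_Lipschitz.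
have nfc : continuous (fun z => - f z) by move=> z; apply: cvgN; exact: fc.
have nfB z : `|- f z| <= B by rewrite normrN.
apply/cvgrPdist_le => /= e e0.
have e20 : 0 < e / 2 by rewrite divr_gt0.
have [k1 _ /(_ k1 (leqnn _)) hk1] : \forall k \near \oo,
    `|\int[nu]_t f (t, 0) - \int[nu]_t inf_convolution f k (t, 0)| <= e / 2.
  by have /cvgrPdist_le/(_ _ e20) := approx f fc fB.
have [k2 _ /(_ k2 (leqnn _)) hk2] : \forall k \near \oo,
    `|\int[nu]_t - f (t, 0) - \int[nu]_t inf_convolution (fun z => - f z) k (t, 0)| <= e / 2.
  by have /cvgrPdist_le/(_ _ e20) := approx _ nfc nfB.
have lip2 : bounded_Lipschitz (fun z => - inf_convolution (fun z => - f z) k2 z).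
  have [[B' hB'] [K' hK']] := lipE _ k2 nfB; split.
    by exists B' => z; rewrite normrN.
  by exists K' => z w; rewrite -opprD normrN.
have /cvgrPdist_le/(_ _ e20) c1 := lipcvg _ (lipE _ k1 fB).
have /cvgrPdist_le/(_ _ e20) c2 := lipcvg _ lip2.
have Nint (g : R * R -> R) :
    measurable_fun [set: measurableTypeR R] (fun t : R => g (t, 0)) ->
    (forall z, `|g z| <= B) ->
    \int[nu]_t - g (t, 0) = - \int[nu]_t g (t, 0).
  move=> gc gB; rewrite -mulN1r -RintegralZl //.
    by apply: eq_Rintegral => t _; rewrite mulN1r.
  apply: (le_integrable _ _ _ (finite_measure_integrable_cst nu B measurableT)) => //.
    exact/measurable_EFinP.
  by move=> t _ /=; rewrite lee_fin (le_trans (gB _)) // ler_norm.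
near=> n.
have h1 : `|\int[nu]_t inf_convolution f k1 (t, 0) - En n (inf_convolution f k1)| <= e / 2.
  by near: n.
have h2 : `|\int[nu]_t - inf_convolution (fun z => - f z) k2 (t, 0)
     - En n (fun z => - inf_convolution (fun z => - f z) k2 z)| <= e / 2.
  by near: n.
have m1 : En n (inf_convolution f k1) <= En n f by apply: mono => z; exact: inf_convolution_le.
have m2 : En n f <= En n (fun z => - inf_convolution (fun z => - f z) k2 z).
  by apply: mono => z; rewrite lerNr; exact: inf_convolution_le nfB _ _.
have mf : measurable_fun [set: measurableTypeR R] (fun t : R => f (t, 0)).
  exact: continuous_measurable_fun (slice_cont _ fc).
rewrite (Nint _ mf fB) in hk2; rewrite (Nint _ (mk _ k2 nfB) (inf_convolution_bound nfB k2)) in h2.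
move: hk1 hk2 h1 h2; rewrite !ler_norml => /andP[a1 a2] /andP[a3 a4] /andP[a5 a6] /andP[a7 a8].
by apply/andP; split; lra.
Unshelve. all: by end_near. Qed.

End LipschitzApproximation.

(** * Measurability in the plane and truncated monomials *)

Section PlaneMeasure.
Variable R : realType.

(** The plane carries the product sigma-algebra, so an open set is written as a countable union of
    the rational boxes inside it; the other boxes are replaced by [set0]. *)
Lemma open_measurable_plane (U : set (R * R)) : open U -> measurable U.
Proof.
move=> oU.
pose J (q e : rat) : set R := `]ratr q - ratr e, ratr q + ratr e[%classic.
pose G q r e : set (R * R) := if `[< J q e `*` J r e `<=` U >] then J q e `*` J r e else set0.
have -> : U = \bigcup_(q : rat) \bigcup_(r : rat) \bigcup_(e : rat) G q r e.
  apply/seteqP; split => z; last first.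
    by move=> [q _ [r _ [e _]]]; rewrite /G; case: asboolP => // + Gz; apply.
  move=> Uz; have /nbhs_ballP[d /= d0 dU] : nbhs z U by exact: open_nbhs_nbhs.
  have d20 : 0 < d / 2 by rewrite divr_gt0.
  have [e] := rat_in_itvoo d20; rewrite in_itv /= => /andP[e0 ed].
  have near_rat t : exists q : rat, J q e t.
    have tt : t - ratr e < t + ratr e by rewrite ltrD2l; lra.
    have [q] := rat_in_itvoo tt; rewrite in_itv /= => /andP[h1 h2].
    by exists q; rewrite /J /= in_itv /=; apply/andP; split; lra.
  have [q hq] := near_rat z.1; have [r hr] := near_rat z.2.
  exists q => //; exists r => //; exists e => //; rewrite /G asboolT //.
  have close t u v : J t e u -> J t e v -> ball u d v.
    rewrite /J /= !in_itv /= => /andP[u1 u2] /andP[v1 v2].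
    by rewrite /ball /= ltr_norml; apply/andP; split; lra.
  by move=> y [y1 y2]; apply: dU; split; [exact: close hq y1 | exact: close hr y2].
apply: bigcupT_measurable_rat => q; apply: bigcupT_measurable_rat => r.
apply: bigcupT_measurable_rat => e; rewrite /G; case: asboolP => _ //.
apply: measurableX; exact: measurable_itv.
Qed.

Lemma compact_measurable_plane (K : set (R * R)) : compact K -> measurable K.
Proof.
move=> cK; rewrite -[K]setCK; apply: measurableC; apply: open_measurable_plane.
apply: closed_openC; apply: compact_closed cK; exact: norm_hausdorff.
Qed.

(** Monomials are unbounded and hence no test functions for (W). Clipping at a level beyond both the
    support of rho and the rescaled weights makes them bounded without changing the values that
    matter. *)
Definition clip (T t : R) : R := Num.max 0 (Num.min t T).

Lemma clip_id T t : 0 <= t <= T -> clip T t = t.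
Proof. by move=> /andP[t0 tT]; rewrite /clip (min_idPl tT); apply/max_idPr. Qed.

Lemma clip_ge0 T t : 0 <= clip T t.
Proof. by rewrite /clip le_max lexx. Qed.

Lemma clip_le T t : 0 <= T -> clip T t <= T.
Proof. by move=> T0; rewrite /clip ge_max T0 ge_min lexx orbT. Qed.

Lemma continuous_clip T : continuous (clip T).
Proof.
have H u v : clip T u - clip T v <= `|u - v|.
  have h1 := ler_norm (u - v); have h2 := normr_ge0 (u - v).
  rewrite /clip lerBlDr ge_max addr_ge0 ?le_max ?lexx //=.
  apply: (@le_trans _ _ (`|u - v| + Num.min v T)).
    rewrite -lerBlDl le_min; apply/andP; split.
      have : Num.min u T <= u by rewrite ge_min lexx.
      lra.
    have : Num.min u T <= T by rewrite ge_min lexx orbT.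
    lra.
  by rewrite lerD2l le_max lexx orbT.
apply: (@Lipschitz_continuous _ _ 1) => // x y; rewrite mul1r ler_norml H andbT.
by have := H y x; rewrite distrC; lra.
Qed.

Definition clipped_monomial (T : R) (i j : nat) (z : R * R) : R :=
  clip T z.1 ^+ i * clip T z.2 ^+ j.

Lemma bounded_continuous_clipped_monomial T i j : 0 <= T ->
  bounded_continuous (clipped_monomial T i j).
Proof.
move=> T0; split; last first.
  exists (T ^+ i * T ^+ j) => z; rewrite /clipped_monomial ger0_norm.
    by rewrite ler_pM ?exprn_ge0 ?clip_ge0 // lerXn2r ?nnegrE ?clip_ge0 ?clip_le.
  by rewrite mulr_ge0 ?exprn_ge0 ?clip_ge0.
have H k (g : R * R -> R) : continuous g -> continuous (fun z => clip T (g z) ^+ k).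
  move=> gc z; apply: (@continuous_comp _ _ _ g (fun t => clip T t ^+ k)); first exact: gc.
  apply: (@continuous_comp _ _ _ (clip T) (fun t => t ^+ k)); first exact: continuous_clip.
  exact: exprn_continuous.
move=> z; apply: (@cvgM _ _ _ _ (fun z : R * R => clip T z.1 ^+ i)
  (fun z : R * R => clip T z.2 ^+ j)).
  by apply: (H i fst) => y; exact: cvg_fst.
by apply: (H j snd) => y; exact: cvg_snd.
Qed.

Lemma Rintegral_clipped_monomial (rho : probability (R * R)%type R) (K : set (R * R)) T i j :
  compact K -> K `<=` [set z | 0 < z.1 /\ 0 < z.2] -> rho K = 1%E ->
  (forall z, K z -> z.1 <= T /\ z.2 <= T) ->
  \int[rho]_z clipped_monomial T i j z = \int[rho]_z (z.1 ^+ i * z.2 ^+ j).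
Proof.
move=> cK Kpos K1 KT; rewrite /Rintegral; congr fine.
have mK := compact_measurable_plane cK.
have mcoord (g : R * R -> R) : measurable_fun setT g -> measurable_fun setT (fun z => clip T (g z)).
  move=> mg; apply: (@measurableT_comp _ _ _ _ _ _ (clip T)) => //.
  by apply: continuous_measurable_fun; exact: continuous_clip.
apply: ae_eq_integral => //.
- apply/measurable_EFinP; apply: measurable_funM; apply: measurable_funX; apply: mcoord.
    exact: measurable_fst.
  exact: measurable_snd.
- apply/measurable_EFinP; apply: measurable_funM; apply: measurable_funX.
    exact: measurable_fst.
  exact: measurable_snd.
exists (~` K); split; first exact: measurableC.
  by have := probability_setC rho mK; rewrite K1 subee.
move=> z /= h Kz; apply: h => _; rewrite /clipped_monomial.
have [z1 z2] := Kpos _ Kz; have [t1 t2] := KT _ Kz.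
by rewrite !clip_id ?(ltW z1) ?(ltW z2).
Qed.

Lemma compact_plane_bounded (K : set (R * R)) : compact K ->
  exists T : R, 0 <= T /\ forall z, K z -> z.1 <= T /\ z.2 <= T.
Proof.
move=> /compact_bounded [M [_ hM]]; exists (`|M| + 1); split; first by rewrite addr_ge0.
move=> z Kz; have := hM (`|M| + 1) _ z Kz.
rewrite (le_lt_trans (ler_norm M)) ?ltrDl // => /(_ isT) h.
have [h1 h2] : `|z.1| <= `|M| + 1 /\ `|z.2| <= `|M| + 1.
  by move: h; rewrite /Num.norm /= ge_max => /andP.
by split; apply: le_trans (ler_norm _) _.
Qed.

End PlaneMeasure.

(** * The directed Chung-Lu model *)

Section EigenvalueBound.
Variables (R : realType) (n : nat).

Lemma opnorm_le_entries (A : 'M[R]_n) :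
  (forall i j, `|A i j| <= 1) -> opnorm_le A n%:R.
Proof.
move=> A1 u; rewrite -(@ler_pXn2r _ 2) ?nnegrE ?mulr_ge0 ?nrm_ge0 //.
rewrite exprMn !sqr_nrm.
apply: (@le_trans _ _ (\sum_(i < n) n%:R * dot u u)); last first.
  by rewrite sumr_const card_ord -[leLHS]mulr_natl mulrA -expr2.
apply: ler_sum => i _; rewrite -expr2.
have -> : (A *m u) i 0 = dot (row i A)^T u.
  by rewrite mxE; apply: eq_bigr => j _; rewrite !mxE.
apply: le_trans (sqr_dot_le _ _) _; rewrite ler_wpM2r ?dot_ge0 //.
rewrite -[n in leRHS]card_ord -sumr_const; apply: ler_sum => j _.
rewrite !mxE -expr2 -[leRHS](expr1n _ 2) -[leLHS]real_normK ?num_real //.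
by rewrite lerXn2r ?nnegrE.
Qed.

Lemma lambda1_bound (A : 'M[R]_n) : (forall i j, `|A i j| <= 1) ->
  complex.Re (lambda1 (map_mx (real_complex R) A)) ^+ 2
  + complex.Im (lambda1 (map_mx (real_complex R) A)) ^+ 2 <= n%:R ^+ 2.
Proof.
(* The second branch is the default value 0 of [lambda1]. *)
move=> A1; rewrite /lambda1; case: xgetP => [z _ [zeig _]|_]; last first.
  by rewrite /= !expr0n addr0 sqr_ge0.
have /eigenvalueP [v hv v0] := zeig; have := nrm_scale_complex z v.
rewrite -hv Re_col_mulmx Im_col_mulmx; set W := (_ + _ in RHS).
set N := (_ + _ in X in _ = _ * X) => E.
have N0 : 0 < N.
  rewrite lt_def addr_ge0 ?sqr_ge0 // andbT paddr_eq0 ?sqr_ge0 //.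
  rewrite !sqrf_eq0 !nrm_eq0; apply: contraNN v0 => /andP[/eqP h1 /eqP h2].
  by rewrite (Re_Im_col_eq0 h1 h2).
rewrite -(ler_pM2r N0) -E mulrDr -!exprMn.
have AT1 : opnorm_le A^T n%:R by apply: opnorm_le_entries => i j; rewrite mxE.
by rewrite lerD // lerXn2r ?nnegrE ?mulr_ge0 ?nrm_ge0 // AT1.
Qed.

End EigenvalueBound.

Lemma ler_normB_double (R : realType) (x y t : R) :
  `|x| <= t -> `|y| <= t -> `|x - y| <= 2 * t.
Proof. by move=> xt yt; apply: le_trans (ler_normB _ _) _; lra. Qed.

Section ChungLu.
Variables (R : realType) (n : nat) (wp wm : 'I_n -> R) (s c C : R).
Hypotheses (n0 : (0 < n)%N) (c0 : 0 < c) (cC : c < C) (s0 : 0 < s).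
Hypothesis hw : total_weight wp = total_weight wm.
Hypothesis hb : forall x, c <= wp x <= C /\ c <= wm x <= C.

Local Notation E := ('I_n * 'I_n)%type.

Definition edge_prob (e : E) : R := s * wp e.1 * wm e.2 / total_weight wp.

Hypothesis p01 : forall e, 0 <= edge_prob e <= 1.

Let w := total_weight wp.
Definition wp_col : 'cV[R]_n := \col_x wp x.
Definition wm_col : 'cV[R]_n := \col_x wm x.
Let S0 := dot wp_col wm_col.
Let alpha := s / w.
Let Gam := C ^+ 2 / c ^+ 2.

Definition adj_of (M : {ffun E -> bool}) : 'M[R[i]]_n := \matrix_(x, y) (M (x, y))%:R.
Definition ReL M : R := complex.Re (lambda1 (adj_of M)).
Definition ImL M : R := complex.Im (lambda1 (adj_of M)).
Definition lin_coef (e : E) : R := wm e.1 * wp e.2 / S0.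

Let C0 : 0 < C. Proof. exact: lt_trans cC. Qed.
Let nR : 0 < n%:R :> R. Proof. by rewrite ltr0n. Qed.
Let cge : 0 <= c := ltW c0.
Let Cge : 0 <= C := ltW C0.
Let sge : 0 <= s := ltW s0.

Lemma sum_bounds (u : 'I_n -> R) l h : (forall x, l <= u x <= h) ->
  l * n%:R <= \sum_x u x <= h * n%:R.
Proof.
move=> uh; rewrite !mulr_natr -[n in _ *+ n <= _]card_ord -[n in _ <= _ *+ n]card_ord -!sumr_const.
by apply/andP; split; apply: ler_sum => x _; case/andP: (uh x).
Qed.

Lemma total_weight_bounds : c * n%:R <= w <= C * n%:R.
Proof. by apply: sum_bounds => x; case: (hb x). Qed.

Let w0 : 0 < w.
Proof. by case/andP: total_weight_bounds => h _; rewrite (lt_le_trans _ h) // mulr_gt0. Qed.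

Lemma dot_weight_bounds : c ^+ 2 * n%:R <= S0 <= C ^+ 2 * n%:R.
Proof.
apply: sum_bounds => x; rewrite !mxE; case: (hb x) => /andP[a1 a2] /andP[b1 b2].
have a0 := le_trans (ltW c0) a1; have b0 := le_trans (ltW c0) b1.
by apply/andP; split; rewrite expr2 ler_pM // ltW.
Qed.

Let S00 : 0 < S0.
Proof. by case/andP: dot_weight_bounds => h _; rewrite (lt_le_trans _ h) // mulr_gt0 // exprn_gt0. Qed.

Let alpha0 : 0 < alpha. Proof. by rewrite divr_gt0. Qed.

Lemma nrm_weight_le : nrm wp_col * nrm wm_col <= Gam * S0.
Proof.
have sq (u : 'I_n -> R) : (forall x, c <= u x <= C) ->
    dot (\col_x u x) (\col_x u x) <= C ^+ 2 * n%:R.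
  move=> uC; have H x : 0 <= u x * u x <= C ^+ 2.
    case/andP: (uC x) => a1 a2; have a0 := le_trans (ltW c0) a1.
    by rewrite mulr_ge0 //= expr2 ler_pM.
  case/andP: (sum_bounds H) => _; apply: le_trans.
  by apply: ler_sum => x _; rewrite !mxE.
apply: (@le_trans _ _ (C ^+ 2 * n%:R)).
  rewrite -(@ler_pXn2r _ 2) ?nnegrE ?mulr_ge0 ?nrm_ge0 ?exprn_ge0 //.
  rewrite exprMn !sqr_nrm [leRHS]expr2 ler_pM ?dot_ge0 //; apply: sq => x; by case: (hb x).
rewrite /Gam [leRHS]mulrAC ler_pdivlMr ?exprn_gt0 // -mulrA ler_wpM2l ?exprn_ge0 //.
by rewrite mulrC; case/andP: dot_weight_bounds.
Qed.

Lemma edge_prob_le e : edge_prob e <= C ^+ 2 / c * (s / n%:R).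
Proof.
rewrite /edge_prob -/w -mulrA -mulrA; case: (hb e.1) (hb e.2) => /andP[a1 a2] _ [_ /andP[b1 b2]].
have a0 := le_trans (ltW c0) a1; have b0 := le_trans (ltW c0) b1.
rewrite [leRHS](_ : _ = s * (C ^+ 2 * (c * n%:R)^-1)); last by field; rewrite ?gt_eqF.
rewrite ler_wpM2l // mulrA ler_pM ?mulr_ge0 ?invr_ge0 ?(ltW w0) //.
  by rewrite expr2 ler_pM.
by rewrite lef_pV2 ?posrE ?mulr_gt0 //; case/andP: total_weight_bounds.
Qed.

Lemma edge_prob_row x : \sum_y edge_prob (x, y) <= C * s.
Proof.
rewrite (_ : \sum_y _ = wp x * s).
  by rewrite ler_wpM2r //; case: (hb x) => /andP[].
rewrite /edge_prob /= -/w -mulr_suml -mulr_sumr -[\sum_y wm y]/(total_weight wm) -hw -/w.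
by rewrite mulfK ?gt_eqF // mulrC.
Qed.

Lemma edge_prob_col y : \sum_x edge_prob (x, y) <= C * s.
Proof.
rewrite (_ : \sum_x _ = wm y * s).
  by rewrite ler_wpM2r //; case: (hb y) => _ /andP[].
rewrite /edge_prob /= -/w -mulr_suml -mulr_suml -mulr_sumr -[\sum_x wp x]/w.
by field; rewrite gt_eqF.
Qed.

Lemma adj_of_noise M :
  adj_of M = map_mx (real_complex R) (rank1_plus alpha wp_col wm_col (noise edge_prob M)).
Proof.
apply/matrixP => x y; rewrite !mxE big_ord1 !mxE /edge_prob /= -/w.
rewrite (_ : alpha * _ + _ = (M (x, y))%:R); first by rewrite rmorph_nat.
by rewrite /alpha; ring.
Qed.

Lemma noise_upd M x y :
  noise edge_prob (upd M (x, y) true)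
  = noise edge_prob (upd M (x, y) false) + delta_mx x y.
Proof.
apply/matrixP => i j; rewrite !mxE !updE -pair_eqE /=.
by case: (i == x); case: (j == y) => /=; ring.
Qed.

Lemma ReL_ImL_bound M : `|ReL M| <= n%:R /\ `|ImL M| <= n%:R.
Proof.
have := @lambda1_bound R n (\matrix_(x, y) (M (x, y))%:R).
rewrite (_ : map_mx _ _ = adj_of M); last first.
  by apply/matrixP => x y; rewrite !mxE rmorph_nat.
move=> H; have {}H := H _; rewrite -/(ReL M) -/(ImL M) in H.
have {}H : ReL M ^+ 2 + ImL M ^+ 2 <= n%:R ^+ 2.
  by apply: H => i j; rewrite mxE; case: (M _); rewrite ?normr0 ?normr1.
have r0 := sqr_ge0 (ReL M); have i0 := sqr_ge0 (ImL M).
by split; rewrite -(@ler_pXn2r _ 2) ?nnegrE // real_normK ?num_real //; lra.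
Qed.

Lemma lin_coef_bound e : 0 <= lin_coef e <= Gam / n%:R.
Proof.
rewrite /lin_coef; case: (hb e.1) (hb e.2) => _ /andP[a1 a2] [/andP[b1 b2] _].
have a0 := le_trans (ltW c0) a1; have b0 := le_trans (ltW c0) b1.
rewrite divr_ge0 ?mulr_ge0 ?(ltW S00) //=.
rewrite [leRHS](_ : _ = C ^+ 2 * (c ^+ 2 * n%:R)^-1); last by rewrite /Gam; field; rewrite ?gt_eqF.
rewrite ler_pM ?mulr_ge0 ?invr_ge0 ?(ltW S00) //; first by rewrite expr2 ler_pM.
by rewrite lef_pV2 ?posrE ?mulr_gt0 ?exprn_gt0 //; case/andP: dot_weight_bounds.
Qed.

Let lam := alpha * S0.
Let theta := (16 * Gam + 4) / lam.

Definition bad_prob (k : R) : R :=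
  Ex edge_prob (fun M => (~~ `[< opnorm_le (noise edge_prob M) k >])%:R).

Definition flip_const (eps th : R) : R :=
  32 * Gam ^+ 2 * (4 * th + 24 * eps * Gam) ^+ 2 + 320 * eps ^+ 2 * Gam ^+ 2.

Lemma flip_const_ge0 eps th : 0 <= flip_const eps th.
Proof.
exact: addr_ge0 (mulr_ge0 (mulr_ge0 (ler0n _ _) (sqr_ge0 _)) (sqr_ge0 _))
  (mulr_ge0 (mulr_ge0 (ler0n _ _) (sqr_ge0 _)) (sqr_ge0 _)).
Qed.

(** Efron-Stein for F = ReL - lin_stat, whose mean is that of ReL. On the good event the squared
    derivatives sum to at most [flip_const]; elsewhere each of the n^2 derivatives is at most 2 n +
    Gam. *)
Theorem ReL_remainder_variance eps k : 0 <= eps -> 48 * eps * Gam <= 1 ->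
  theta <= 1 / 2 -> k + 1 <= eps * lam ->
  Ex edge_prob (fun M =>
     (ReL M - lin_stat edge_prob lin_coef M - Ex edge_prob ReL) ^+ 2)
  <= C ^+ 2 / c * (s / n%:R) *
     (flip_const eps theta + n%:R ^+ 2 * (2 * n%:R + Gam) ^+ 2 * bad_prob k).
Proof.
move=> eps0 small th2 kle.
pose F M := ReL M - lin_stat edge_prob lin_coef M.
have EF : Ex edge_prob F = Ex edge_prob ReL by rewrite ExB Ex_lin_stat subr0.
rewrite -EF; apply: le_trans (Efron_Stein p01 F) _.
have Gam0 : 0 <= Gam by rewrite divr_ge0 ?sqr_ge0.
have rl M : real_lambda1 alpha wp_col wm_col (noise edge_prob M) = ReL M.
  by rewrite /ReL adj_of_noise.
have DF M x y : disc_deriv (x, y) F M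
   = real_lambda1 alpha wp_col wm_col (noise edge_prob (upd M (x, y) false) + delta_mx x y)
     - real_lambda1 alpha wp_col wm_col (noise edge_prob (upd M (x, y) false))
     - wm_col x 0 * wp_col y 0 / S0.
  have -> : wm_col x 0 * wp_col y 0 / S0 = lin_coef (x, y) by rewrite !mxE.
  rewrite -noise_upd !rl -(lin_stat_upd edge_prob lin_coef M) /disc_deriv /F.
  by move: (ReL _) (ReL _) (lin_stat _ _ _) (lin_stat _ _ _) => ? ? ? ?; ring.
have bound M : \sum_e disc_deriv e F M ^+ 2 <= flip_const eps theta
   + n%:R ^+ 2 * (2 * n%:R + Gam) ^+ 2 * (~~ `[< opnorm_le (noise edge_prob M) k >])%:R.
  case: asboolP => [good|_] /=.
    rewrite mulr0 addr0 sum_pair.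
    under eq_bigr do under eq_bigr do rewrite DF.
    apply: (sum_sqr_flip_le alpha0 S00 eps0 nrm_weight_le small th2
       (H0 := fun x y => noise edge_prob (upd M (x, y) false)) good kle).
    move=> x y; case E : (M (x, y)); [right|left].
      by rewrite -noise_upd -{1}E upd_id.
    by rewrite -{1}E upd_id.
  rewrite mulr1 -[leLHS]add0r lerD ?flip_const_ge0 //.
  apply: (@le_trans _ _ (\sum_(e : E) (2 * n%:R + Gam) ^+ 2)); last first.
    by rewrite sumr_const card_prod card_ord -[leLHS]mulr_natl natrM expr2.
  apply: ler_sum => e _; rewrite -real_normK ?num_real //.
  have g0 : 0 <= 2 * n%:R + Gam by apply: addr_ge0 => //; rewrite mulr_ge0.
  rewrite lerXn2r ?nnegrE //.
  have -> : disc_deriv e F M = ReL (upd M e true) - ReL (upd M e false) - lin_coef e.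
    rewrite /disc_deriv /F -(lin_stat_upd edge_prob lin_coef M e).
    by move: (ReL _) (ReL _) (lin_stat _ _ _) (lin_stat _ _ _) => ? ? ? ?; ring.
  have [h1 _] := ReL_ImL_bound (upd M e true); have [h2 _] := ReL_ImL_bound (upd M e false).
  have /andP[l0 l1] := lin_coef_bound e.
  apply: le_trans (ler_normB _ _) _; rewrite (ger0_norm l0).
  apply: lerD.
    exact: ler_normB_double h1 h2.
  apply: le_trans l1 _; rewrite ler_pdivrMr // ler_peMr // ler1n.
  exact: n0.
set P := C ^+ 2 / c * (s / n%:R).
have P0 : 0 <= P by rewrite mulr_ge0 ?divr_ge0 ?sqr_ge0 ?ltW.
apply: (@le_trans _ _ (\sum_e P * Ex edge_prob (fun M => disc_deriv e F M ^+ 2))).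
  apply: ler_sum => e _; rewrite ler_wpM2r //.
    by apply: Ex_ge0 => // M; exact: sqr_ge0.
  apply: le_trans (edge_prob_le e); case/andP: (p01 e) => q0 q1.
  by rewrite ler_piMr //; lra.
rewrite -mulr_sumr ler_wpM2l // -Ex_sum.
apply: le_trans (ler_Ex p01 bound) _.
by rewrite ExD Ex_cst ExZ.
Qed.

Lemma ImL_mean eps k : 0 <= eps -> 48 * eps * Gam <= 1 -> k + 1 <= eps * lam ->
  Ex edge_prob (fun M => `|ImL M|) <= n%:R * bad_prob k.
Proof.
move=> eps0 small kle; rewrite -ExZ; apply: ler_Ex => // M.
case: asboolP => [good|_] /=; last by rewrite mulr1; case: (ReL_ImL_bound M).
rewrite mulr0 /ImL adj_of_noise.
have hH : opnorm_le (noise edge_prob M) (eps * lam).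
  by apply: opnorm_le_trans good; lra.
have [z [U [V hp]]] := perron_data_exists alpha0 S00 eps0 nrm_weight_le small hH.
by rewrite (perron_lambda1 alpha0 S00 eps0 nrm_weight_le small hH hp) /= normr0.
Qed.

End ChungLu.

Lemma expR1_le4 (R : realType) : expR 1 <= 4 :> R.
Proof.
have h : (2 : R)^-1 <= expR (- 2^-1) by have := expR_ge1Dx (- (2 : R)^-1); lra.
rewrite [X in expR X](_ : _ = 2^-1 + 2^-1); last by field.
have {}h : expR (2^-1) <= 2 :> R.
  by rewrite -[leRHS]invrK -[leLHS]invrK lef_pV2 ?posrE ?invr_gt0 ?expR_gt0 // -expRN.
rewrite expRD (_ : 4 = 2 * 2 :> R); last by ring.
by rewrite ler_pM ?expR_ge0.
Qed.

Lemma double_sqrnS l : (l.+1 + l.+1 * (2 * l) + l.+1 = 2 * l.+1 ^ 2)%N.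
Proof. by rewrite -mulnn; lia. Qed.

Section FixedSize.
Variables (R : realType) (n : nat) (wp wm : 'I_n -> R) (s c C : R).
Hypotheses (n0 : (0 < n)%N) (c0 : 0 < c) (cC : c < C) (s0 : 0 < s).
Hypothesis hw : total_weight wp = total_weight wm.
Hypothesis hb : forall x, c <= wp x <= C /\ c <= wm x <= C.
Let pr : 'I_n * 'I_n -> R := edge_prob wp wm s.
Hypothesis p01 : forall e, 0 <= pr e <= 1.

Let C0 : 0 < C. Proof. exact: lt_trans cC. Qed.

Definition log2S : nat := (trunc_log 2 n).+1.

Lemma leq_exp_log2S : (n <= 2 ^ log2S)%N.
Proof. by apply: ltnW; exact: trunc_log_ltn. Qed.

(* The moments of order 2 q with q = log2S >= log2 n turn a per-moment ratio 2^-9 into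
   the bound n^-9; with degrees cut at 3 D, D ~ C s, the exceptional event has a
   probability that beats the trivial bound n^(2q) because (log n)^2 << s. *)
Lemma bad_prob_le delta : 0 < delta ->
  2 * (log2S.+1 ^ 2)%:R <= C * s -> 2 ^+ 14 * C * log2S%:R <= delta ^+ 2 * s ->
  bad_prob wp wm s (delta * s) <= 2 * n%:R / n%:R ^+ 9.
Proof.
move=> d0 hD hs; pose d := C * s.
have dge : 0 <= d by rewrite mulr_ge0 ?ltW.
have [D [dD Dd]] : exists D : nat, d <= D%:R /\ D%:R <= 2 * d.
  have /andP[h1 h2] := truncn_itv dge; exists (Num.truncn d).+1; split; first exact: ltW.
  have : (1 : R) <= (log2S.+1 ^ 2)%:R by rewrite ler1n expn_gt0.
  by move: h1; rewrite -natr1 -/d in hD *; lra.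
have n1 : (1 : R) <= n%:R by rewrite ler1n.
have nl : (n%:R : R) <= 2 ^+ log2S by rewrite -natrX ler_nat leq_exp_log2S.
have hDn : (2 * log2S.+1 ^ 2 <= D)%N.
  by rewrite -(ler_nat R) natrM (le_trans hD).
have l1 : (1 : R) <= log2S%:R by rewrite ler1n.
have D1 : (1 : R) <= D%:R by rewrite ler1n (leq_trans _ hDn) // muln_gt0 expn_gt0.
apply: le_trans (@noise_opnorm_tail R n pr p01 d _ _ (3 * D) (trunc_log 2 n)
  (delta * s) n0 dge _ _ _) _.
- by move=> x; exact: edge_prob_row hb x.
- by move=> y; apply: (edge_prob_col n0 c0 s0 hb).
- by rewrite mulr_gt0.
- rewrite -/log2S -[leLHS]mulr1 natrM; apply: ler_pM => //; first by lra.
  by rewrite natrM; lra.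
- rewrite -/log2S.
  (* exp d <= 4^D because e <= 4 and d <= D; the cut at 3 D leaves a factor 2^-D. *)
  have e1 : expR d / 2 ^+ (3 * D) <= (2 ^+ D)^-1.
    have h : expR d <= 2 ^+ (2 * D).
      apply: (@le_trans _ _ (expR (D%:R * 1))); first by rewrite ler_expR mulr1.
      rewrite expRM_natl exprM; apply: lerXn2r; rewrite ?nnegrE ?expR_ge0 ?exprn_ge0 //.
      by apply: le_trans (expR1_le4 R) _; rewrite -natrX ler_nat.
    have p3 : 0 < 2 ^+ (3 * D) :> R by rewrite exprn_gt0.
    have E3 : (3 * D = 2 * D + D)%N by rewrite addnC -mulSn.
    by rewrite (ler_pdivrMr _ _ p3) E3 exprD mulrCA mulVf ?mulr1 // expf_neq0.
  have e2 : (2 * log2S)%:R <= 2 ^+ log2S.+1 :> R.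
    by rewrite -natrX ler_nat expnS leq_mul2l /= ltnW // ltn_expl.
  have e3 : (2 * n)%:R <= 2 ^+ log2S.+1 :> R.
    by rewrite natrM exprS ler_wpM2l.
  have p2 k : 0 <= 2 ^+ k :> R by rewrite exprn_ge0.
  apply: (@le_trans _ _ (2 ^+ log2S.+1 * (2 ^+ log2S.+1) ^+ (2 * log2S) *
     (2 ^+ log2S.+1 * (2 ^+ D)^-1))).
    have q0 : 0 <= expR d / 2 ^+ (3 * D) by rewrite divr_ge0 ?expR_ge0.
    apply: ler_pM; [by rewrite mulr_ge0 ?exprn_ge0 | by rewrite mulr_ge0 | | exact: ler_pM].
    apply: ler_pM; [by [] | by rewrite exprn_ge0 | by [] |].
    by apply: lerXn2r; rewrite ?nnegrE.
  rewrite mulrA ler_pdivrMr ?exprn_gt0 // mul1r -!exprM -!exprD.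
  rewrite ler_eXn2l //; last by rewrite ltrDl.
  (* The powers of 2 from the trivial bounds add up to 2 (log2S + 1)^2, which 2^-D compensates. *)
  by apply: leq_trans hDn; rewrite double_sqrnS.
rewrite -/log2S -mulrA natrM -!mulrA ler_wpM2l // ler_wpM2l //.
(* 2^14 = 4 * 8 * 2^9: 4 log2S comes from the moment bound, 8 from 3 D + d <= 8 d, and 2^-9 is the
   target ratio. *)
apply: (@le_trans _ _ ((2 ^+ 9)^-1 ^+ log2S)).
  apply: lerXn2r; rewrite ?nnegrE ?invr_ge0 ?exprn_ge0 //.
    by rewrite !mulr_ge0 ?invr_ge0 ?exprn_ge0 ?mulr_ge0 ?addr_ge0 // ltW.
  rewrite !mulrA ler_pdivrMr ?exprn_gt0 ?mulr_gt0 // [leRHS]mulrC ler_pdivlMr ?exprn_gt0 //.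
  have k1 : (3 * D)%:R + d <= 8 * d by rewrite natrM; lra.
  have l0 : 0 <= log2S%:R * 2 ^+ 11 :> R by rewrite mulr_ge0 ?exprn_ge0.
  apply: (@le_trans _ _ (log2S%:R * 2 ^+ 11 * ((3 * D)%:R + d))).
    by rewrite natrM le_eqVlt; apply/orP; left; apply/eqP; ring.
  apply: le_trans (ler_wpM2l l0 k1) _.
  apply: (@le_trans _ _ (2 ^+ 14 * C * log2S%:R * s)).
    by rewrite le_eqVlt; apply/orP; left; apply/eqP; rewrite /d; ring.
  by have := ler_wpM2r (ltW s0) hs; rewrite exprMn [s ^+ 2]expr2 mulrA.
rewrite exprVn -exprM mulnC exprM lef_pV2 ?posrE ?exprn_gt0 ?ltr0n //.
by apply: lerXn2r; rewrite ?nnegrE ?exprn_ge0.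
Qed.

Let S0 := dot (wp_col wp) (wm_col wm).
Let Gam := C ^+ 2 / c ^+ 2.
Let lam := s / total_weight wp * S0.
Let theta := (16 * Gam + 4) / lam.
Let r := Num.sqrt (n%:R / s).

Definition scaled_coef (e : 'I_n * 'I_n) : R := r * lin_coef wp wm e.

Definition scaled_law (F : R * R -> R) : R :=
  Ex pr (fun M => F (r * (ReL R M - Ex pr (@ReL R n)), r * (ImL R M - Ex pr (@ImL R n)))).

Lemma lin_stat_scaled M : lin_stat pr scaled_coef M = r * lin_stat pr (lin_coef wp wm) M.
Proof. by rewrite /lin_stat mulr_sumr; apply: eq_bigr => e _; rewrite mulrA. Qed.

(** The factor r^2 = n / s cancels the s / n of the remainder variance, so the real part costs [e1]
    by Cauchy-Schwarz. The imaginary part and its mean each cost r n times the bad probability. *)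
Lemma scaled_law_approx (F : R * R -> R) K eps k e1 : 0 <= K ->
  (forall z w, `|F z - F w| <= K * dist1 z w) ->
  0 <= eps -> 48 * eps * Gam <= 1 -> theta <= 1 / 2 -> k + 1 <= eps * lam -> 0 <= e1 ->
  C ^+ 2 / c * (flip_const c C eps theta
     + n%:R ^+ 2 * (2 * n%:R + Gam) ^+ 2 * bad_prob wp wm s k) <= e1 ^+ 2 ->
  `|scaled_law F - Ex pr (fun M => F (lin_stat pr scaled_coef M, 0))|
  <= K * (e1 + 2 * r * n%:R * bad_prob wp wm s k).
Proof.
move=> K0 FK eps0 small th kle e10 he1.
have nR : 0 < n%:R :> R by rewrite ltr0n.
have r0 : 0 <= r by exact: sqrtr_ge0.
have r2 : r ^+ 2 = n%:R / s by rewrite sqr_sqrtr // divr_ge0 // ltW.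
have V := ReL_remainder_variance n0 c0 cC s0 hb p01 eps0 small th kle.
have I1 := ImL_mean n0 c0 cC s0 hb p01 eps0 small kle.
rewrite -/pr in V I1.
set T := @ReL R n in V *; set I := @ImL R n in I1 *.
set mT := Ex pr T in V *; pose mI := Ex pr I.
rewrite /scaled_law -/T -/I -/mT -/mI -ExB; apply: (le_trans (ler_norm_Ex p01 _)).
pose Rm M := T M - lin_stat pr (lin_coef wp wm) M - mT.
apply: (@le_trans _ _ (Ex pr (fun M => K * (r * `|Rm M|) + K * (r * (`|I M| + `|mI|))))).
  apply: ler_Ex => // M; apply: le_trans (FK _ _) _; rewrite -mulrDr ler_wpM2l //.
  rewrite /dist1 /= lin_stat_scaled subr0; apply: lerD.
    rewrite -mulrBr normrM (ger0_norm r0) ler_wpM2l // /Rm.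
    by move: (T M) (lin_stat _ _ _) => a b; rewrite addrAC.
  by rewrite normrM (ger0_norm r0) ler_wpM2l // ler_normB.
rewrite ExD !ExZ ExD Ex_cst -mulrDr ler_wpM2l //; apply: lerD.
  have E1 : r * Ex pr (fun M => `|Rm M|) = Ex pr (fun M => `|r * Rm M|).
    by rewrite -ExZ; apply: eq_Ex => M; rewrite normrM (ger0_norm r0).
  rewrite E1; apply: Ex_norm_le_sqrt => //; apply: le_trans he1.
  rewrite (_ : Ex pr _ = r ^+ 2 * Ex pr (fun M => Rm M ^+ 2)); last first.
    by rewrite -ExZ; apply: eq_Ex => M; rewrite exprMn.
  rewrite r2; apply: le_trans (ler_wpM2l _ V) _; first by rewrite divr_ge0 // ltW.
  rewrite le_eqVlt; apply/orP; left; apply/eqP; rewrite -/Gam -/lam -/theta.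
  by set q := flip_const _ _ _ _ + _; field; rewrite !gt_eqF.
have mI1 : `|mI| <= n%:R * bad_prob wp wm s k.
  by apply: le_trans (ler_norm_Ex p01 _) _.
rewrite (_ : 2 * r * n%:R * _ = r * (n%:R * bad_prob wp wm s k + n%:R * bad_prob wp wm s k)).
  by rewrite ler_wpM2l // lerD.
by ring.
Qed.

End FixedSize.

Lemma trunc_log2_le_ln (R : realType) (n : nat) : (0 < n)%N ->
  (trunc_log 2 n)%:R <= 2 * ln (n%:R : R).
Proof.
move=> n0; have h : expR (2^-1) <= 2 :> R.
  have : (2 : R)^-1 <= expR (- 2^-1) by have := expR_ge1Dx (- (2 : R)^-1); lra.
  by rewrite expRN lef_pV2 ?posrE ?expR_gt0.
suff : (trunc_log 2 n)%:R * 2^-1 <= ln (n%:R : R) by lra.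
rewrite -ler_expR lnK ?posrE ?ltr0n // expRM_natl.
apply: (@le_trans _ _ (2 ^+ trunc_log 2 n)).
  by apply: lerXn2r; rewrite ?nnegrE ?expR_ge0.
by rewrite -natrX ler_nat trunc_logP.
Qed.

Lemma growth_log2 (R : realType) (s : nat -> R) : assumption_X s ->
  (forall n, (0 < n)%N -> 0 < s n) ->
  forall K : R, \forall n \near \oo, K * ((log2S n).+1 ^ 2)%:R <= s n.
Proof.
move=> [xi [xi4 hX _]] hs K.
(* 16 comes from log2S + 1 <= 4 ln n, squared; adding 1 keeps the denominator positive when K =
   0. *)
pose eta := (16 * `|K| + 1)^-1.
have eta0 : 0 < eta by rewrite invr_gt0 ltr_wpDl // mulr_ge0.
have hlim : \forall n \near \oo, (ln n%:R) `^ xi / s n <= eta.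
  have /cvgrPdist_le/(_ _ eta0) := hX; apply: filterS => n.
  by rewrite sub0r normrN; apply: le_trans; exact: ler_norm.
near=> n.
have n4 : (4 <= n)%N by near: n; exact: nbhs_infty_ge.
have n0 : (0 < n)%N by apply: leq_trans n4.
have sn := hs n n0.
set L := ln (n%:R : R).
have L1 : 1 <= L.
  rewrite -ler_expR lnK ?posrE ?ltr0n //; apply: le_trans (expR1_le4 R) _.
  by rewrite ler_nat.
have l4 : (log2S n).+1%:R <= 4 * L.
  rewrite /log2S -!natr1; have := trunc_log2_le_ln R n0; rewrite -/L; lra.
have h2 : ((log2S n).+1 ^ 2)%:R <= 16 * L `^ xi.
  rewrite natrX; apply: (@le_trans _ _ ((4 * L) ^+ 2)).
    by apply: lerXn2r; rewrite ?nnegrE // mulr_ge0 // (le_trans ler01).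
  rewrite exprMn (_ : 4 ^+ 2 = 16); last by ring.
  rewrite ler_wpM2l // -powR_mulrn ?(le_trans ler01) //.
  by apply: ler_powR => //; lra.
have h3 : L `^ xi <= eta * s n.
  rewrite -ler_pdivrMr // /L; near: n; exact: hlim.
apply: (@le_trans _ _ (`|K| * ((log2S n).+1 ^ 2)%:R)).
  by rewrite ler_wpM2r // ler_norm.
have K0 := normr_ge0 K.
apply: le_trans (ler_wpM2l K0 h2) _.
have k16 : 0 <= 16 * `|K| by rewrite mulr_ge0.
apply: (@le_trans _ _ (16 * `|K| * (eta * s n))).
  by rewrite mulrCA mulrA ler_wpM2l.
rewrite mulrA; apply: ler_piMl; first exact: ltW sn.
have e1 : 0 < 16 * `|K| + 1 by rewrite ltr_wpDl.
by rewrite /eta ler_pdivrMr // mul1r lerDl.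
Unshelve. all: by end_near. Qed.

Lemma growth (R : realType) (s : nat -> R) : assumption_X s ->
  (forall n, (0 < n)%N -> 0 < s n) ->
  forall K : R, \forall n \near \oo, K <= s n.
Proof.
move=> hX hs K; have := growth_log2 hX hs `|K|; apply: filterS => n; apply: le_trans.
apply: le_trans (ler_norm K) _; rewrite ler_peMr //.
by rewrite ler1n expn_gt0.
Qed.

(** * Asymptotic comparison of the eigenvalue with the linear statistic *)

Section Asymptotics.
Variables (R : realType) (wp wm : forall n : nat, 'I_n -> R) (s : nat -> R) (c C : R).
Hypotheses (c0 : 0 < c) (cC : c < C).
Hypothesis hb : forall n (x : 'I_n), c <= wp x <= C /\ c <= wm x <= C.
Hypothesis hw : forall n, total_weight (wp (n:=n)) = total_weight (wm (n:=n)).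
Hypothesis hs : forall n, (0 < n)%N -> 0 < s n.
Hypothesis hX : assumption_X s.
Hypothesis hp : \forall n \near \oo, forall e, 0 <= edge_prob (wp (n:=n)) (wm (n:=n)) (s n) e <= 1.

Let C0 : 0 < C. Proof. exact: lt_trans cC. Qed.
Let Gam := C ^+ 2 / c ^+ 2.
Let Gam0 : 0 < Gam. Proof. by rewrite divr_gt0 ?exprn_gt0. Qed.
Let g := c ^+ 2 / C.
Let g0 : 0 < g. Proof. by rewrite divr_gt0 ?exprn_gt0. Qed.

Lemma near_bad_prob delta : 0 < delta -> \forall n \near \oo,
  bad_prob (wp (n:=n)) (wm (n:=n)) (s n) (delta * s n) <= 2 * n%:R / n%:R ^+ 9.
Proof.
move=> d0; near=> n.
have n0 : (0 < n)%N by near: n; exact: nbhs_infty_ge.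
apply: (bad_prob_le n0 c0 cC (hs n0) (hw n) (hb (n:=n))) => //.
- near: n; exact: hp.
- rewrite -ler_pdivrMl // mulrA; near: n; exact: growth_log2.
- rewrite -ler_pdivrMl ?exprn_gt0 // mulrA.
  apply: (@le_trans _ _ ((delta ^+ 2)^-1 * (2 ^+ 14 * C) * ((log2S n).+1 ^ 2)%:R)).
    rewrite ler_wpM2l ?mulr_ge0 ?invr_ge0 ?exprn_ge0 ?(ltW C0) ?(ltW d0) // ler_nat.
    by rewrite (leq_trans (leqnSn _)) // -mulnn leq_pmulr.
  near: n; exact: growth_log2.
Unshelve. all: by end_near. Qed.

Lemma lambda_lower n : (0 < n)%N ->
  g * s n <= s n / total_weight (wp (n:=n)) * dot (wp_col (wp (n:=n))) (wm_col (wm (n:=n))).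
Proof.
move=> n0; have nR : 0 < n%:R :> R by rewrite ltr0n.
have /andP[w1 w2] := total_weight_bounds (hb (n:=n)).
have /andP[d1 d2] := dot_weight_bounds c0 (hb (n:=n)).
have w0 : 0 < total_weight (wp (n:=n)) by rewrite (lt_le_trans _ w1) // mulr_gt0.
rewrite [g * _]mulrC -mulrA ler_wpM2l ?(ltW (hs n0)) // mulrC ler_pdivlMr //.
rewrite /g mulrAC ler_pdivrMr // [leRHS]mulrC.
apply: le_trans (ler_wpM2l (ltW (exprn_gt0 2 c0)) w2) _.
by rewrite mulrCA ler_wpM2l // ltW.
Qed.

Lemma flip_const_le eps th : 0 <= th <= eps ->
  flip_const c C eps th
  <= eps ^+ 2 * (32 * Gam ^+ 2 * (4 + 24 * Gam) ^+ 2 + 320 * Gam ^+ 2).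
Proof.
case/andP=> th0 the; have e0 := le_trans th0 the; rewrite /flip_const -/Gam.
rewrite [leRHS](_ : _ = 32 * Gam ^+ 2 * (4 * eps + 24 * eps * Gam) ^+ 2
  + 320 * eps ^+ 2 * Gam ^+ 2); last by ring.
have k0 : 0 <= 32 * Gam ^+ 2 by exact: mulr_ge0 (ler0n _ _) (sqr_ge0 _).
rewrite lerD2r (ler_wpM2l k0) //.
have G0 := ltW Gam0.
have t0 : 0 <= 24 * eps * Gam := mulr_ge0 (mulr_ge0 (ler0n _ _) e0) G0.
apply: lerXn2r; rewrite ?nnegrE.
- by apply: addr_ge0 => //; apply: mulr_ge0.
- by apply: addr_ge0 => //; apply: mulr_ge0.
- by rewrite lerD2r ler_wpM2l.
Qed.

Let r n := Num.sqrt (n%:R / s n).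

Lemma near_scale_le : \forall n \near \oo, r n ^+ 2 <= n%:R.
Proof.
near=> n.
have n0 : (0 < n)%N by near: n; exact: nbhs_infty_ge.
have s1 : 1 <= s n by near: n; exact: growth.
rewrite sqr_sqrtr ?divr_ge0 ?(ltW (hs n0)) //.
by rewrite ler_pdivrMr ?hs // ler_peMr.
Unshelve. all: by end_near. Qed.

Theorem scaled_law_lin_stat (F : R * R -> R) : bounded_Lipschitz F ->
  (fun n => scaled_law (wp (n:=n)) (wm (n:=n)) (s n) F
     - Ex (edge_prob (wp (n:=n)) (wm (n:=n)) (s n))
         (fun M => F (lin_stat (edge_prob (wp (n:=n)) (wm (n:=n)) (s n))
                        (scaled_coef (wp (n:=n)) (wm (n:=n)) (s n)) M, 0))) @ \oo --> 0.
Proof.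
move=> [_ [K0 FK0]]; pose K := `|K0|.
have FK z w : `|F z - F w| <= K * dist1 z w.
  by apply: le_trans (FK0 z w) _; rewrite ler_wpM2r ?dist1_ge0 // ler_norm.
have Kge : 0 <= K by exact: normr_ge0.
apply/cvgrPdist_le => /= e e0.
pose Q0 := 32 * Gam ^+ 2 * (4 + 24 * Gam) ^+ 2 + 320 * Gam ^+ 2.
have Q00 : 0 <= Q0 by rewrite addr_ge0 // mulr_ge0 ?sqr_ge0 // mulr_ge0 ?sqr_ge0.
pose P := C ^+ 2 / c.
have P0 : 0 <= P by rewrite divr_ge0 ?sqr_ge0 // ltW.
pose D := 1 + P * (Q0 + 1).
have D1 : 1 <= D by rewrite lerDl mulr_ge0 // addr_ge0.
have DP : P * (Q0 + 1) <= D ^+ 2.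
  have d0 : 0 <= P * (Q0 + 1) by rewrite mulr_ge0 // addr_ge0.
  by rewrite /D expr2; have := sqr_ge0 (P * (Q0 + 1)); rewrite expr2; lra.
have D0 : 0 < (K + 1) * (D + 1) by rewrite mulr_gt0 ?ltr_wpDl // (le_trans ler01).
(* The first term makes K (eps D + eps) <= e, where eps D bounds the real part and the second eps
   the imaginary part. The other two meet the perturbation hypotheses. *)
pose eps := Num.min (e / ((K + 1) * (D + 1))) (Num.min (48 * Gam)^-1 (1 / 2)).
have eps0 : 0 < eps by rewrite !lt_min !divr_gt0 // invr_gt0 mulr_gt0.
have eps1 : eps * ((K + 1) * (D + 1)) <= e.
  by rewrite -ler_pdivlMr // ge_min lexx.
have eps2 : 48 * eps * Gam <= 1.
  rewrite (_ : 48 * eps * Gam = eps * (48 * Gam)); last by ring.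
  have h48 : 0 < 48 * Gam by rewrite mulr_gt0.
  by rewrite -(ler_pdivlMr _ _ h48) div1r !ge_min lexx orbT.
have eps3 : eps <= 1 / 2 by rewrite !ge_min lexx !orbT.
clearbody eps.
(* As lam >= g s, half of eps lam serves as the norm bound and the other half leaves room for a
   flipped entry of norm 1. *)
pose delta := eps * g / 2.
have eg0 : 0 < eps * g := mulr_gt0 eps0 g0.
have delta0 : 0 < delta by rewrite divr_gt0.
near=> n.
have n0 : (0 < n)%N by near: n; exact: nbhs_infty_ge.
have nR : 0 < n%:R :> R by rewrite ltr0n.
have n1 : 1 <= n%:R :> R by rewrite ler1n.
have sn := hs n0.
have bad : bad_prob (wp (n:=n)) (wm (n:=n)) (s n) (delta * s n) <= 2 * n%:R / n%:R ^+ 9.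
  by near: n; exact: near_bad_prob.
set lam := s n / total_weight (wp (n:=n)) * dot (wp_col (wp (n:=n))) (wm_col (wm (n:=n))).
have lamg : g * s n <= lam by exact: lambda_lower.
have lam0 : 0 < lam by rewrite (lt_le_trans _ lamg) // mulr_gt0.
have kle : delta * s n + 1 <= eps * lam.
  apply: le_trans (ler_wpM2l (ltW eps0) lamg).
  have : 1 <= delta * s n.
    rewrite -ler_pdivrMl // mulr1; near: n; exact: growth.
  by rewrite /delta; lra.
have th0 : 0 <= (16 * Gam + 4) / lam.
  by rewrite divr_ge0 ?(ltW lam0) // addr_ge0 // mulr_ge0 // ltW.
have the : (16 * Gam + 4) / lam <= eps.
  rewrite ler_pdivrMr //; apply: le_trans (ler_wpM2l (ltW eps0) lamg).
  rewrite [leRHS]mulrA -(ler_pdivrMl _ _ eg0); near: n; exact: growth.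
have th2 : (16 * Gam + 4) / lam <= 1 / 2 by apply: le_trans the _.
have nG : Gam <= n%:R by near: n; exact: nbhs_infty_ger.
have n18 : 18 / eps ^+ 2 <= n%:R by near: n; exact: nbhs_infty_ger.
have n4 : 4 / eps <= n%:R by near: n; exact: nbhs_infty_ger.
have p01 : forall e, 0 <= edge_prob (wp (n:=n)) (wm (n:=n)) (s n) e <= 1.
  by near: n; exact: hp.
have rn : r n <= n%:R.
  rewrite -(@ler_pXn2r _ 2) ?nnegrE ?sqrtr_ge0 //.
  apply: (@le_trans _ _ n%:R); first by near: n; exact: near_scale_le.
  by rewrite expr2 ler_peMr.
have bad_ge0 : 0 <= bad_prob (wp (n:=n)) (wm (n:=n)) (s n) (delta * s n).
  by apply: Ex_ge0 => // M; rewrite ler0n.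
have e10 : 0 <= eps * D by rewrite mulr_ge0 ?(ltW eps0) // (le_trans ler01).
have main : P * (flip_const c C eps ((16 * Gam + 4) / lam)
   + n%:R ^+ 2 * (2 * n%:R + Gam) ^+ 2
     * bad_prob (wp (n:=n)) (wm (n:=n)) (s n) (delta * s n)) <= (eps * D) ^+ 2.
  rewrite exprMn; apply: (@le_trans _ _ (eps ^+ 2 * (P * (Q0 + 1)))); last first.
    by rewrite ler_wpM2l ?sqr_ge0.
  rewrite [leRHS]mulrCA; apply: ler_wpM2l => //; rewrite [leRHS]mulrDr mulr1; apply: lerD.
    by apply: flip_const_le; rewrite th0.
  apply: (@le_trans _ _ (n%:R ^+ 2 * (3 * n%:R) ^+ 2 * (2 * n%:R / n%:R ^+ 9))).
    apply: ler_pM => //; first by rewrite mulr_ge0 ?sqr_ge0.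
    rewrite ler_wpM2l ?sqr_ge0 //.
    apply: lerXn2r; rewrite ?nnegrE.
    - exact: addr_ge0 (mulr_ge0 (ler0n _ _) (ltW nR)) (ltW Gam0).
    - exact: mulr_ge0 (ler0n _ _) (ltW nR).
    - rewrite (_ : 3 * n%:R = 2 * n%:R + n%:R); last by ring.
      by rewrite lerD2l.
  rewrite (_ : _ * (2 * n%:R / _) = 18 / n%:R ^+ 4); last by field; rewrite gt_eqF.
  rewrite ler_pdivrMr ?exprn_gt0 //.
  rewrite mulrC -ler_pdivrMr ?exprn_gt0 //; apply: le_trans n18 _.
  by rewrite exprS ler_peMr // exprn_ege1.
rewrite sub0r normrN.
apply: le_trans (scaled_law_approx n0 c0 cC sn (hb (n:=n)) p01 Kge FK (ltW eps0)
  eps2 th2 kle e10 main) _.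
apply: le_trans eps1; rewrite [leRHS]mulrCA.
apply: (@le_trans _ _ (K * (eps * (D + 1)))); last first.
  have De : 0 <= eps * (D + 1).
    by apply: mulr_ge0 (ltW eps0) _; apply: addr_ge0 => //; exact: le_trans ler01 D1.
  by apply: ler_wpM2r => //; rewrite lerDl.
apply: ler_wpM2l => //; rewrite [leRHS]mulrDr mulr1 lerD2l.
apply: (@le_trans _ _ (2 * n%:R * n%:R * (2 * n%:R / n%:R ^+ 9))).
  have f0 : 0 <= 2 * Num.sqrt (n%:R / s n) * n%:R :=
    mulr_ge0 (mulr_ge0 (ler0n _ _) (sqrtr_ge0 _)) (ler0n _ _).
  apply: (ler_pM f0 bad_ge0 _ bad); apply: ler_wpM2r => //.
  exact: ler_wpM2l rn.
rewrite (_ : _ * (2 * n%:R / _) = 4 / n%:R ^+ 6); last by field; rewrite gt_eqF.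
rewrite ler_pdivrMr ?exprn_gt0 // mulrC -ler_pdivrMr //; apply: le_trans n4 _.
by rewrite exprS ler_peMr // exprn_ege1.
Unshelve. all: by end_near. Qed.

End Asymptotics.

Section EmpiricalMoments.
Variables (R : realType) (wp wm : forall n : nat, 'I_n -> R) (c C : R).
Hypotheses (c0 : 0 < c) (cC : c < C).
Hypothesis hb : forall n (x : 'I_n), c <= wp x <= C /\ c <= wm x <= C.

Let C0 : 0 < C. Proof. exact: lt_trans cC. Qed.
Let u n : R := Num.sqrt (n%:R / total_weight (wp (n:=n))).

Definition weight_moment (i j n : nat) : R :=
  n%:R^-1 * \sum_(x < n) (u n * wp x) ^+ i * (u n * wm x) ^+ j.

Let wgt0 n : (0 < n)%N -> 0 < total_weight (wp (n:=n)).
Proof.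
move=> n0; have /andP[h _] := total_weight_bounds (hb (n:=n)).
by rewrite (lt_le_trans _ h) // mulr_gt0 // ltr0n.
Qed.

Let u_bounds n : (0 < n)%N -> Num.sqrt C^-1 <= u n <= Num.sqrt c^-1.
Proof.
move=> n0; have /andP[h1 h2] := total_weight_bounds (hb (n:=n)).
have w0 := wgt0 n0.
apply/andP; split; apply: ler_wsqrtr.
  by rewrite ler_pdivlMr // ler_pdivrMl.
by rewrite ler_pdivrMr // ler_pdivlMl.
Qed.

(** Uniform in n, so it survives in the limit and makes the moments of rho, hence [sigma2], strictly
    positive. *)
Lemma weight_moment_ge i j n : (0 < n)%N ->
  (Num.sqrt C^-1 * c) ^+ (i + j) <= weight_moment i j n.
Proof.
move=> n0; have nR : 0 < n%:R :> R by rewrite ltr0n.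
have /andP[u1 _] := u_bounds n0; have m0 := sqrtr_ge0 C^-1.
rewrite /weight_moment ler_pdivlMl // mulr_natl -[n in leLHS]card_ord -sumr_const.
apply: ler_sum => x _; case: (hb x) => /andP[a1 _] /andP[b1 _].
have mc0 : 0 <= Num.sqrt C^-1 * c := mulr_ge0 m0 (ltW c0).
have ua : Num.sqrt C^-1 * c <= u n * wp x := ler_pM m0 (ltW c0) u1 a1.
have ub : Num.sqrt C^-1 * c <= u n * wm x := ler_pM m0 (ltW c0) u1 b1.
rewrite exprD; apply: ler_pM; rewrite ?exprn_ge0 //;
  apply: lerXn2r; rewrite ?nnegrE //; exact: le_trans mc0 _.
Qed.

Variable rho : probability (R * R)%type R.
Hypothesis weak : forall f : R * R -> R, bounded_continuous f ->
  (fun n => n%:R^-1 * \sum_(x < n) f (u n * wp x, u n * wm x)) @ \oo --> \int[rho]_z f z.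
Variable K : set (R * R).
Hypotheses (cK : compact K) (Kpos : K `<=` [set z | 0 < z.1 /\ 0 < z.2]) (K1 : rho K = 1%E).

Lemma weight_moment_cvg i j :
  weight_moment i j @ \oo --> \int[rho]_z (z.1 ^+ i * z.2 ^+ j).
Proof.
have [T0 [T00 hT0]] := compact_plane_bounded cK.
have v0 := sqrtr_ge0 c^-1.
pose T := T0 + Num.sqrt c^-1 * C.
have vC : 0 <= Num.sqrt c^-1 * C := mulr_ge0 v0 (ltW C0).
have T_ge0 : 0 <= T := addr_ge0 T00 vC.
have KT z : K z -> z.1 <= T /\ z.2 <= T.
  by move=> /hT0[h1 h2]; split; rewrite (le_trans h1 _, le_trans h2 _) // lerDl.
have := weak (bounded_continuous_clipped_monomial i j T_ge0).
rewrite (Rintegral_clipped_monomial i j cK Kpos K1 KT); apply: cvg_trans.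
apply: near_eq_cvg; near=> n.
have n0 : (0 < n)%N by near: n; exact: nbhs_infty_ge.
congr (_ * _); apply: eq_bigr => x _; rewrite /clipped_monomial /=.
have /andP[_ u2] := u_bounds n0; have u0 : 0 <= u n := sqrtr_ge0 _.
have le_T t : c <= t <= C -> 0 <= u n * t <= T.
  case/andP=> t1 t2; have t0 := le_trans (ltW c0) t1.
  rewrite (mulr_ge0 u0 t0) /=; apply: le_trans (ler_pM u0 t0 u2 t2) _.
  by rewrite lerDr.
by case: (hb x) => /le_T h1 /le_T h2; rewrite !clip_id.
Unshelve. all: by end_near. Qed.

Lemma moment_gt0 i j : 0 < \int[rho]_z (z.1 ^+ i * z.2 ^+ j).
Proof.
apply: (@lt_le_trans _ _ ((Num.sqrt C^-1 * c) ^+ (i + j))).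
  by rewrite exprn_gt0 // mulr_gt0 // sqrtr_gt0 invr_gt0.
apply: (cvgr_to_ge (@weight_moment_cvg i j)); near=> n.
by apply: weight_moment_ge; near: n; exact: nbhs_infty_ge.
Unshelve. all: by end_near. Qed.

Let sigma2E : sigma2 rho = \int[rho]_z (z.1 ^+ 2 * z.2 ^+ 1) * \int[rho]_z (z.1 ^+ 1 * z.2 ^+ 2)
  / (\int[rho]_z (z.1 ^+ 1 * z.2 ^+ 1)) ^+ 2.
Proof. by []. Qed.

Lemma sigma2_gt0 : 0 < sigma2 rho.
Proof.
rewrite sigma2E; apply: divr_gt0; last exact: exprn_gt0 (moment_gt0 1 1).
exact: mulr_gt0 (moment_gt0 2 1) (moment_gt0 1 2).
Qed.

Variable s : nat -> R.
Hypothesis hs : forall n, (0 < n)%N -> 0 < s n.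
Hypothesis sn0 : (fun n => s n / n%:R) @ \oo --> (0 : R).

Let main n := weight_moment 2 1 n * weight_moment 1 2 n / weight_moment 1 1 n ^+ 2.

Let main_cvg : main @ \oo --> sigma2 rho.
Proof.
rewrite sigma2E; apply: (@cvgM _ _ _ _ (fun n => weight_moment 2 1 n * weight_moment 1 2 n)
  (fun n => (weight_moment 1 1 n ^+ 2)^-1)).
  exact: (cvgM (@weight_moment_cvg 2 1) (@weight_moment_cvg 1 2)).
apply: (@cvgV _ _ _ _ (fun n => weight_moment 1 1 n ^+ 2)).
  by rewrite gt_eqF // exprn_gt0 // moment_gt0.
exact: (cvgM (@weight_moment_cvg 1 1) (@weight_moment_cvg 1 1)).
Qed.

Let pr n : 'I_n * 'I_n -> R := edge_prob (wp (n:=n)) (wm (n:=n)) (s n).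
Let cf n : 'I_n * 'I_n -> R := scaled_coef (wp (n:=n)) (wm (n:=n)) (s n).

Let weight_momentE i j n : weight_moment i j n
  = u n ^+ (i + j) * (n%:R^-1 * \sum_(x < n) wp x ^+ i * wm x ^+ j).
Proof.
rewrite mulrCA; congr (_ * _); rewrite mulr_sumr; apply: eq_bigr => x _.
by rewrite !exprMn exprD; ring.
Qed.

(** The summand splits into a factor in x, summing to the (1, 2) moment, and one in y, summing to
    the (2, 1) moment. The powers of [u n] reduce to u^2 = n / w, the normalization of
    [edge_prob]. *)
Let sum_coef n : (0 < n)%N -> \sum_(e : 'I_n * 'I_n) @cf n e ^+ 2 * @pr n e = main n.
Proof.
move=> n0; have w0 := wgt0 n0; have nR : 0 < n%:R :> R by rewrite ltr0n.
have S0 : 0 < dot (wp_col (wp (n:=n))) (wm_col (wm (n:=n))).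
  have /andP[h _] := dot_weight_bounds c0 (hb (n:=n)).
  by rewrite (lt_le_trans _ h) // mulr_gt0 // exprn_gt0.
have sn := hs n0.
have u2 : u n ^+ 2 = n%:R / total_weight (wp (n:=n)) by rewrite sqr_sqrtr // divr_ge0 // ltW.
have u0 : 0 < u n by rewrite sqrtr_gt0 divr_gt0.
have r2 : Num.sqrt (n%:R / s n) ^+ 2 = n%:R / s n by rewrite sqr_sqrtr // divr_ge0 // ltW.
have S0E : dot (wp_col (wp (n:=n))) (wm_col (wm (n:=n))) = \sum_(x < n) wp x ^+ 1 * wm x ^+ 1.
  by apply: eq_bigr => x _; rewrite !mxE.
rewrite /main !weight_momentE -S0E.
set S := dot _ _ in S0 S0E *; set S21 := \sum_(x < n) wp x ^+ 2 * _.
set S12 := \sum_(x < n) wp x ^+ 1 * wm x ^+ 2.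
have -> : u n ^+ (2 + 1) * (n%:R^-1 * S21) * (u n ^+ (1 + 2) * (n%:R^-1 * S12))
    / (u n ^+ (1 + 1) * (n%:R^-1 * S)) ^+ 2 = u n ^+ 2 * (S12 * S21) / S ^+ 2.
  by field; rewrite !gt_eqF.
rewrite u2 sum_pair mulr_suml mulr_sumr mulr_suml; apply: eq_bigr => x _.
rewrite mulr_sumr mulr_sumr mulr_suml; apply: eq_bigr => y _.
rewrite /cf /scaled_coef exprMn r2 /lin_coef /pr /edge_prob /= -/S !expr1.
by field; rewrite !gt_eqF.
Qed.

(** The factors 1 - p_xy lie between 1 - (C^2 / c) s / n and 1, and s / n tends to 0; the rest is
    [sum_coef]. *)
Lemma lin_var_cvg : (\forall n \near \oo, forall e, 0 <= @pr n e <= 1) ->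
  (fun n => lin_var (@pr n) (@cf n)) @ \oo --> sigma2 rho.
Proof.
move=> hp.
have lower : (fun n => main n * (1 - C ^+ 2 / c * (s n / n%:R))) @ \oo --> sigma2 rho.
  rewrite -[sigma2 rho]mulr1; apply: cvgM; first exact: main_cvg.
  rewrite -[X in _ --> X]subr0 -[X in _ --> _ - X](mulr0 (C ^+ 2 / c)).
  by apply: cvgB; [exact: cvg_cst | apply: cvgM => //; exact: cvg_cst].
apply: (squeeze_cvgr _ lower main_cvg); near=> n.
have n0 : (0 < n)%N by near: n; exact: nbhs_infty_ge.
have p01 : forall e, 0 <= @pr n e <= 1 by near: n.
rewrite -sum_coef // mulr_suml; apply/andP; split; apply: ler_sum => e _.
  rewrite -mulrA; apply: ler_wpM2l (sqr_ge0 _) _ _ _; case/andP: (p01 e) => q0 q1.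
  apply: ler_wpM2l => //; rewrite lerD2l lerN2.
  exact: (edge_prob_le n0 c0 (hs n0) (hb (n:=n)) e).
apply: ler_wpM2l (sqr_ge0 _) _ _ _; case/andP: (p01 e) => q0 q1.
by apply: ler_piMr => //; lra.
Unshelve. all: by end_near. Qed.

End EmpiricalMoments.

Section Limit.
Variables (R : realType) (wp wm : forall n : nat, 'I_n -> R) (s : nat -> R).
Variable rho : probability (R * R)%type R.
Hypothesis hw : forall n, total_weight (wp (n:=n)) = total_weight (wm (n:=n)).
Hypothesis hs : forall n, (0 < n)%N -> 0 < s n.
Hypothesis hW : assumption_W wp wm rho.
Hypothesis hX : assumption_X s.
Hypothesis hp : \forall n \near \oo, forall e, 0 <= edge_prob (wp (n:=n)) (wm (n:=n)) (s n) e <= 1.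

Theorem scaled_law_cvg (F : R * R -> R) : bounded_Lipschitz F ->
  (fun n => scaled_law (wp (n:=n)) (wm (n:=n)) (s n) F) @ \oo
    --> \int[normal_prob 0 (Num.sqrt (sigma2 rho))]_t F (t, 0).
Proof.
move=> lipF; have [[B FB] [K FK]] := lipF.
have [[c [C [c0 cC hb]]] [Kc [cK Kpos K1]] weak] := hW.
have [xi [_ _ sn0]] := hX.
have C0 := lt_trans c0 cC.
pose sigma := Num.sqrt (sigma2 rho).
have s20 := sigma2_gt0 c0 cC hb weak cK Kpos K1.
have sigma0 : 0 < sigma by rewrite sqrtr_gt0.
have sigma2E : sigma ^+ 2 = sigma2 rho by rewrite sqr_sqrtr // ltW.
pose pr n := edge_prob (wp (n:=n)) (wm (n:=n)) (s n).
pose cf n := scaled_coef (wp (n:=n)) (wm (n:=n)) (s n).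
pose v n := lin_var (pr n) (cf n).
have v_cvg : v @ \oo --> sigma2 rho := lin_var_cvg c0 cC hb weak cK Kpos K1 hs sn0 hp.
pose Gam := C ^+ 2 / c ^+ 2.
have Gam0 : 0 < Gam by rewrite divr_gt0 ?exprn_gt0.
(* A bound for all coefficients of the scaled statistic; its square is at most Gam^2 / n once s >=
   1. *)
pose kappa n := Num.sqrt (n%:R / s n) * (Gam / n%:R).
have kappa_ge0 n : 0 <= kappa n.
  exact: mulr_ge0 (sqrtr_ge0 _) (divr_ge0 (ltW Gam0) (ler0n _ _)).
have kappa_cvg : kappa @ \oo --> 0.
  apply/cvgrPdist_le => /= e e0; near=> n.
  have n0 : (0 < n)%N by near: n; exact: nbhs_infty_ge.
  have nR : 0 < n%:R :> R by rewrite ltr0n.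
  rewrite sub0r normrN (ger0_norm (kappa_ge0 n)).
  rewrite -(@ler_pXn2r _ 2) ?nnegrE ?kappa_ge0 ?(ltW e0) //.
  have r2 : Num.sqrt (n%:R / s n) ^+ 2 <= n%:R.
    by near: n; exact: near_scale_le hs hX.
  rewrite /kappa exprMn; apply: le_trans (ler_wpM2r (sqr_ge0 _) r2) _.
  rewrite (_ : n%:R * (Gam / n%:R) ^+ 2 = Gam ^+ 2 / n%:R); last first.
    by field; rewrite gt_eqF.
  rewrite ler_pdivrMr // -ler_pdivrMl ?exprn_gt0 //; near: n; exact: nbhs_infty_ger.
have hlip x y : `|F (x, 0) - F (y, 0)| <= K * `|x - y|.
  by have := FK (x, 0) (y, 0); rewrite /dist1 /= subrr normr0 addr0.
have [A A0 hA] := @Bernoulli_CLT R sigma (fun t => F (t, 0)) B K sigma0 (fun x => FB (x, 0)) hlip.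
pose En n := Ex (pr n) (fun M => F (lin_stat (pr n) (cf n) M, 0)).
pose bound n := A * (`|sigma ^+ 2 - v n| * (2 + v n) + kappa n * v n * (8 + 8 * v n)).
have affine (k m : R) : (fun n => k + m * v n) @ \oo --> k + m * sigma2 rho.
  by apply: cvgD; [exact: cvg_cst | apply: cvgM v_cvg; exact: cvg_cst].
have bound_cvg : bound @ \oo --> 0.
  rewrite (_ : 0 = A * (`|sigma ^+ 2 - sigma2 rho| * (2 + sigma2 rho)
    + 0 * sigma2 rho * (8 + 8 * sigma2 rho))); last first.
    by rewrite sigma2E subrr normr0 !mul0r addr0 mulr0.
  apply: cvgM; first exact: cvg_cst.
  apply: (@cvgD _ _ _ _ _ (fun n => `|sigma ^+ 2 - v n| * (2 + v n))
    (fun n => kappa n * v n * (8 + 8 * v n))).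
    apply: (@cvgM _ _ _ _ (fun n => `|sigma ^+ 2 - v n|) (fun n => 2 + v n)).
      by apply: cvg_norm; apply: cvgB v_cvg; exact: cvg_cst.
    by apply: cvgD v_cvg; exact: cvg_cst.
  apply: (@cvgM _ _ _ _ (fun n => kappa n * v n) (fun n => 8 + 8 * v n)).
    exact: cvgM kappa_cvg v_cvg.
  exact: affine.
have En_cvg : En @ \oo --> \int[normal_prob 0 sigma]_t F (t, 0).
  apply/cvgrPdist_le => /= e e0; near=> n.
  have n0 : (0 < n)%N by near: n; exact: nbhs_infty_ge.
  have p01 : forall e, 0 <= pr n e <= 1 by near: n.
  have k1 : kappa n <= 1 by near: n; exact: (cvgr_le _ kappa_cvg _ ltr01).
  have ck e' : `|cf n e'| <= kappa n.
    have /andP[l0 l1] := lin_coef_bound n0 c0 (hb n) e'.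
    rewrite /cf /scaled_coef normrM (ger0_norm (sqrtr_ge0 _)) (ger0_norm l0).
    exact: ler_wpM2l (sqrtr_ge0 _) _ _ l1.
  rewrite distrC; apply: le_trans (hA _ _ _ _ p01 k1 ck) _; rewrite -/(bound n).
  by near: n; exact: (cvgr_le _ bound_cvg _ e0).
have diff := scaled_law_lin_stat c0 cC hb hw hs hX hp lipF.
rewrite -[X in _ --> X]add0r.
rewrite (_ : (fun n => _) = (fun n => (scaled_law (wp (n:=n)) (wm (n:=n)) (s n) F - En n) + En n)).
  exact: cvgD diff En_cvg.
by apply: funext => n; rewrite subrK.
Unshelve. all: by end_near. Qed.

Lemma scaled_law_portmanteau (f : R * R -> R) : bounded_continuous f ->
  (fun n => scaled_law (wp (n:=n)) (wm (n:=n)) (s n) f) @ \oo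
    --> \int[normal_prob 0 (Num.sqrt (sigma2 rho))]_t f (t, 0).
Proof.
move=> bcf.
pose p01 n := `[< forall e, 0 <= edge_prob (wp (n:=n)) (wm (n:=n)) (s n) e <= 1 >].
(* Monotonicity is required for every n, while the weights of [Ex] are known to be nonnegative only
   for large n; the functional is therefore set to 0 for the remaining n. *)
pose En n F := if p01 n then scaled_law (wp (n:=n)) (wm (n:=n)) (s n) F else 0.
have nearE F : \forall n \near \oo, En n F = scaled_law (wp (n:=n)) (wm (n:=n)) (s n) F.
  by apply: filterS hp => n h; rewrite /En /p01 asboolT.
have mono n F G : (forall z, F z <= G z) -> En n F <= En n G.
  move=> FG; rewrite /En /p01; case: asboolP => // h.
  by apply: ler_Ex => // M.
have lipcvg F : bounded_Lipschitz F ->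
    En ^~ F @ \oo --> \int[normal_prob 0 (Num.sqrt (sigma2 rho))]_t F (t, 0).
  move=> /scaled_law_cvg; apply: cvg_trans; apply: near_eq_cvg.
  by apply: filterS (nearE F) => n ->.
apply: cvg_trans (bounded_Lipschitz_portmanteau mono lipcvg bcf).
by apply: near_eq_cvg; exact: nearE.
Qed.

End Limit.

Lemma adjacency_pattern (R : realType) n (d : measure_display) (Omega : measurableType d)
    (P : probability Omega R) (a : 'I_n -> 'I_n -> {RV P >-> bool}) w :
  adjacency a w = adj_of R (pattern (fun e : 'I_n * 'I_n => a e.1 e.2) w).
Proof. by apply/matrixP => x y; rewrite !mxE ffunE. Qed.

Lemma fine_expectation (R : realType) (d : measure_display) (Omega : measurableType d)
    (P : probability Omega R) (Y : Omega -> R) : fine 'E_P[Y] = \int[P]_w Y w.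
Proof. by rewrite unlock. Qed.

Lemma Rintegral_scaled_lambda1 (R : realType) n (d : measure_display) (Omega : measurableType d)
    (P : probability Omega R) (wp wm : 'I_n -> R) (s : R)
    (a : 'I_n -> 'I_n -> {RV P >-> bool}) (f : R * R -> R) :
  directed_Chung_Lu wp wm s a ->
  let Z w := (Num.sqrt (n%:R / s))%:C * (lambda1 (adjacency a w)
    - complex_expectation P (fun w' => lambda1 (adjacency a w'))) in
  \int[P]_w f (complex.Re (Z w), complex.Im (Z w)) = scaled_law wp wm s f.
Proof.
move=> [hP hI] Z; pose X (e : 'I_n * 'I_n) := a e.1 e.2.
have hP' e : P [set w | X e w = true] = (edge_prob wp wm s e)%:E by exact: hP.
rewrite /scaled_law -(Rintegral_pattern hP' hI).
apply: eq_Rintegral => w _.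
have EX (g : {ffun 'I_n * 'I_n -> bool} -> R) (Y : Omega -> R) :
    (forall w', Y w' = g (pattern X w')) -> fine 'E_P[Y] = Ex (edge_prob wp wm s) g.
  by move=> Yg; rewrite fine_expectation -(Rintegral_pattern hP' hI); exact: eq_Rintegral.
have cE : complex_expectation P (fun w' => lambda1 (adjacency a w'))
    = Ex (edge_prob wp wm s) (@ReL R n) +i* Ex (edge_prob wp wm s) (@ImL R n).
  congr (_ +i* _); apply: EX => w'; rewrite adjacency_pattern; exact: erefl.
rewrite /Z cE adjacency_pattern /ReL /ImL -/X.
case: (lambda1 _) => x y; move: (Ex _ _) (Ex _ _) => x' y'.
by congr (f (_, _)) => /=; rewrite mul0r ?subr0 ?addr0.
Qed.

Theorem theorem2p13 (R : realType)
    (wp wm : forall n : nat, 'I_n -> R) (s : nat -> R)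
    (rho : probability (R * R)%type R)
    (d : nat -> measure_display) (Omega : forall n, measurableType (d n))
    (P : forall n, probability (Omega n) R)
    (a : forall n, 'I_n -> 'I_n -> {RV (P n) >-> bool})
    (hw : forall n, total_weight (wp n) = total_weight (wm n))
    (hs : forall n, (0 < n)%N -> 0 < s n)
    (hA : \forall n \near \oo, directed_Chung_Lu (wp n) (wm n) (s n) (a n))
    (hW : assumption_W wp wm rho)
    (hX : assumption_X s) :
  cvg_in_distribution P
    (fun n w => (Num.sqrt (n%:R / s n))%:C *
       (lambda1 (adjacency (a n) w)
        - complex_expectation (P n) (fun w' => lambda1 (adjacency (a n) w'))))
    (normal_prob 0 (Num.sqrt (sigma2 rho)))
    (fun t : R => t%:C).
Proof.
move=> f bcf.
have hp : \forall n \near \oo, forall e, 0 <= edge_prob (wp n) (wm n) (s n) e <= 1.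
  apply: filterS hA => n [hP _] e.
  by apply: (@marginal_01 _ _ _ (P n) _ (fun e => a n e.1 e.2)) => e'; exact: hP.
apply: cvg_trans (scaled_law_portmanteau hw hs hW hX hp bcf).
apply: near_eq_cvg; apply: filterS hA => n hn.
by rewrite (Rintegral_scaled_lambda1 f hn).
Qed.
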